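(* Let $k$ be an algebraically closed field of characteristic $0$, let $p,q$ be prime numbers with $p^4<q$, and let $H$ be a semisimple Hopf algebra over $k$ of dimension $p^2q^2$. If $|G(H^* )|=pq^2$, then $H$ is upper semisolvable.
   Context: $G(H^* )$ is the group of group-like elements of the dual Hopf algebra $H^*$. A Hopf algebra is called trivial if it is isomorphic to a group algebra or to the dual of a group algebra (of a finite group). For a Hopf algebra map $\pi:H\to B$ put $H^{co\pi}=\{h\in H: (\mathrm{id}\otimes\pi)\Delta(h)=h\otimes 1\}$ and ${}^{co\pi}H=\{h\in H:(\pi\otimes \mathrm{id})\Delta(h)=1\otimes h\}$; $\pi$ is called normal if $H^{co\pi}={}^{co\pi}H$ (equivalently $H^{co\pi}$ is a Hopf subalgebra of $H$). A finite-dimensional Hopf algebra $H$ is upper semisolvable if there is a chain of quotient Hopf algebras $H_{(0)}=H\xrightarrow{\pi_1}H_{(1)}\xrightarrow{\pi_2}\cdots\xrightarrow{\pi_n}H_{(n)}=k$ with each $\pi_i$ normal and all $H_{(i-1)}^{co\pi_i}$ trivial. *)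

(* Defs.v *)
From HB Require Import structures.
From mathcomp Require Import all_boot all_order all_algebra all_fingroup all_field.

Set Implicit Arguments.
Unset Strict Implicit.
Unset Printing Implicit Defensive.

Import GRing.Theory VectorInternalTheory.
Local Open Scope ring_scope.

Reserved Notation "u ⊗ v" (at level 40, left associativity).

Section TensorProduct.

Variable k : fieldType.
Implicit Types U V W X : vectType k.

(* U ⊗ V is modelled by coordinates in the bases fixed by v2r; tliftE and
   tensor_span below are its universal property. *)
Definition tensor U V := 'M[k]_(dim U, dim V).

HB.instance Definition _ U V := Vector.copy (tensor U V) 'M[k]_(dim U, dim V).

Definition tprod U V (u : U) (v : V) : tensor U V := (v2r u)^T *m v2r v.

Definition tbasis V (i : 'I_(dim V)) : V := r2v (delta_mx 0 i).

Definition tlift U V W (b : U -> V -> W) (t : tensor U V) : W :=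
  \sum_i \sum_j t i j *: b (tbasis i) (tbasis j).

Definition bilin U V W (b : U -> V -> W) : Prop :=
  (forall v, linear (b^~ v)) /\ (forall u, linear (b u)).

Lemma tbasis_sum V (v : V) : v = \sum_i v2r v 0 i *: tbasis i.
Proof.
apply: v2r_inj; rewrite linear_sum /= {1}[v2r v]row_sum_delta.
by apply: eq_bigr => i _; rewrite linearZ /= r2vK.
Qed.

Fact tlift_is_linear U V W (b : U -> V -> W) : linear (tlift b).
Proof.
move=> c s t; rewrite /tlift scaler_sumr -big_split /=.
apply: eq_bigr => i _; rewrite scaler_sumr -big_split /=.
by apply: eq_bigr => j _; rewrite !mxE scalerDl scalerA.
Qed.

HB.instance Definition _ U V W (b : U -> V -> W) :=
  GRing.isLinear.Build k (tensor U V) W _ (tlift b) (tlift_is_linear b).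

Lemma tliftE U V W (b : U -> V -> W) u v : bilin b -> tlift b (tprod u v) = b u v.
Proof.
case=> bl br; rewrite {2}[u]tbasis_sum {2}[v]tbasis_sum.
pose blL y : {linear U -> W} := HB.pack (b^~ y) (GRing.isLinear.Build _ _ _ _ _ (bl y)).
pose brL x : {linear V -> W} := HB.pack (b x) (GRing.isLinear.Build _ _ _ _ _ (br x)).
rewrite -[RHS]/(blL _ _) linear_sum; apply: eq_bigr => i _.
rewrite linearZ /= -[b _ _]/(brL _ _) linear_sum scaler_sumr.
apply: eq_bigr => j _; rewrite linearZ /= scalerA.
by rewrite !mxE big_ord1 !mxE.
Qed.

Lemma tensor_span U V (t : tensor U V) :
  t = \sum_i \sum_j t i j *: tprod (tbasis i) (tbasis j).
Proof.
rewrite {1}[t]matrix_sum_delta; apply: eq_bigr => i _; apply: eq_bigr => j _.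
by rewrite /tprod !r2vK trmx_delta mul_delta_mx.
Qed.

Lemma tensor_ext U V W (f g : {linear tensor U V -> W}) :
  (forall u v, f (tprod u v) = g (tprod u v)) -> f =1 g.
Proof.
move=> fg t; rewrite [t]tensor_span !linear_sum; apply: eq_bigr => i _.
by rewrite !linear_sum; apply: eq_bigr => j _; rewrite !linearZ /= fg.
Qed.

Lemma tprod_bilin U V : bilin (@tprod U V).
Proof.
split=> [v|u] c x y; rewrite /tprod.
  by rewrite !linearP /= mulmxDl scalemxAl.
by rewrite !linearP.
Qed.

Definition tmap U V U' V' (f : U -> U') (g : V -> V') : tensor U V -> tensor U' V' :=
  tlift (fun u v => tprod (f u) (g v)).

Definition tassoc U V W : tensor (tensor U V) W -> tensor U (tensor V W) :=
  tlift (fun t w => tlift (fun u v => tprod u (tprod v w)) t).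

HB.instance Definition _ U V U' V' (f : U -> U') (g : V -> V') :=
  GRing.Linear.on (@tmap U V U' V' f g).
HB.instance Definition _ U V W := GRing.Linear.on (@tassoc U V W).

Definition tmul (A B : falgType k) (s t : tensor A B) : tensor A B :=
  tlift (fun a b => tlift (fun a' b' => tprod (a * a') (b * b')) t) s.

End TensorProduct.

Notation "u ⊗ v" := (tprod u v) : ring_scope.

HB.mixin Record isHopfAlgebra (k : fieldType) H of Falgebra k H := {
  comul : {linear H -> tensor H H};
  counit : {linear H -> k^o};
  antipode : {linear H -> H};
  comulA : forall h, tassoc (tmap comul idfun (comul h)) = tmap idfun comul (comul h);
  counitl : forall h, tlift (fun a b => counit a *: b) (comul h) = h;
  counitr : forall h, tlift (fun a b => counit b *: a) (comul h) = h;
  comul1 : comul 1 = 1 ⊗ 1;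
  comulM : forall a b, comul (a * b) = tmul (comul a) (comul b);
  counit1 : counit 1 = 1;
  counitM : forall a b, counit (a * b) = counit a * counit b;
  antipodel : forall h, tlift (fun a b => antipode a * b) (comul h) = (counit h)%:A;
  antipoder : forall h, tlift (fun a b => a * antipode b) (comul h) = (counit h)%:A
}.

#[short(type="hopfType")]
HB.structure Definition HopfAlgebra (k : fieldType) :=
  { H of isHopfAlgebra k H & Falgebra k H }.

Section TensorTheory.

Variable k : fieldType.
Implicit Types U V W X : vectType k.

Lemma tlift_linear U V W X (F : {linear W -> X}) (b : U -> V -> W) t :
  F (tlift b t) = tlift (fun u v => F (b u v)) t.
Proof.
rewrite linear_sum; apply: eq_bigr => i _; rewrite linear_sum.
by apply: eq_bigr => j _; rewrite linearZ.
Qed.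

Lemma tliftP U V W c (b1 b2 : U -> V -> W) t :
  tlift (fun u v => c *: b1 u v + b2 u v) t = c *: tlift b1 t + tlift b2 t.
Proof.
rewrite scaler_sumr -big_split; apply: eq_bigr => i _ /=.
rewrite scaler_sumr -big_split; apply: eq_bigr => j _ /=.
by rewrite scalerDr !scalerA mulrC.
Qed.

Lemma eq_tlift U V W (b1 b2 : U -> V -> W) : b1 =2 b2 -> tlift b1 =1 tlift b2.
Proof.
by move=> eb t; apply: eq_bigr => i _; apply: eq_bigr => j _; rewrite eb.
Qed.

Lemma tensor_extP U V W (f g : tensor U V -> W) : linear f -> linear g ->
  (forall u v, f (u ⊗ v) = g (u ⊗ v)) -> f =1 g.
Proof.
move=> lf lg.
pose fL : {linear _ -> _} := HB.pack f (GRing.isLinear.Build _ _ _ _ _ lf).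
pose gL : {linear _ -> _} := HB.pack g (GRing.isLinear.Build _ _ _ _ _ lg).
exact: (@tensor_ext _ _ _ _ fL gL).
Qed.

Lemma linear_ext U W (f g : U -> W) : linear f -> linear g ->
  (forall i, f (tbasis i) = g (tbasis i)) -> f =1 g.
Proof.
move=> lf lg fg u.
pose fL : {linear _ -> _} := HB.pack f (GRing.isLinear.Build _ _ _ _ _ lf).
pose gL : {linear _ -> _} := HB.pack g (GRing.isLinear.Build _ _ _ _ _ lg).
rewrite -[f]/(fL : _ -> _) -[g]/(gL : _ -> _) [u]tbasis_sum !linear_sum.
by apply: eq_bigr => i _; rewrite !linearZ /= fg.
Qed.

Lemma tprodPl U V c (x y : U) (v : V) : (c *: x + y) ⊗ v = c *: (x ⊗ v) + y ⊗ v.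
Proof. by case: (@tprod_bilin k U V) => /(_ v c x y). Qed.

Lemma tprodPr U V c (x y : V) (u : U) : u ⊗ (c *: x + y) = c *: (u ⊗ x) + u ⊗ y.
Proof. by case: (@tprod_bilin k U V) => _ /(_ u c x y). Qed.

Lemma tprodZl U V c (u : U) (v : V) : (c *: u) ⊗ v = c *: (u ⊗ v).
Proof. by rewrite /tprod !linearZ /= scalemxAl. Qed.

Lemma mulPl (A : falgType k) c (x y a : A) : (c *: x + y) * a = c *: (x * a) + y * a.
Proof. by rewrite mulrDl scalerAl. Qed.

Lemma mulPr (A : falgType k) c (x y a : A) : a * (c *: x + y) = c *: (a * x) + a * y.
Proof. by rewrite mulrDr scalerAr. Qed.

Lemma scalePl V c (x y : k^o) (v : V) : (c *: x + y) *: v = c *: (x *: v) + y *: v.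
Proof. by rewrite scalerDl scalerA. Qed.

Lemma scalePr V c (x y : V) (a : k) : a *: (c *: x + y) = c *: (a *: x) + a *: y.
Proof. by rewrite scalerDr !scalerA mulrC. Qed.

Lemma lfunPl U V c (f g : 'Hom(U, V)) u : (c *: f + g) u = c *: f u + g u.
Proof. by rewrite add_lfunE scale_lfunE. Qed.

End TensorTheory.

Ltac lin_step :=
  first [ rewrite linearP | rewrite lfunPl | rewrite tprodPl | rewrite tprodPr | rewrite mulPl
        | rewrite mulPr | rewrite scalePl | rewrite scalePr ].

Ltac lin := 
  let c := fresh "c" in let x := fresh "x" in let y := fresh "y" in
  move=> c x y /=; rewrite ?/tmap ?/tassoc ?/tmul;
  repeat lin_step; rewrite -?tliftP;
  try reflexivity;
  try (apply: eq_tlift => ? ? /=; rewrite ?/tmap ?/tassoc ?/tmul; repeat lin_step; rewrite -?tliftP);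
  try reflexivity;
  try (apply: eq_tlift => ? ? /=; rewrite ?/tmap ?/tassoc ?/tmul; repeat lin_step; rewrite -?tliftP);
  try reflexivity.

Ltac bil := split=> ?; lin.

Section TensorMaps.

Variable k : fieldType.
Implicit Types U V W X : vectType k.

Lemma tmapE U V U' V' (f : {linear U -> U'}) (g : {linear V -> V'}) u v :
  tmap f g (u ⊗ v) = f u ⊗ g v.
Proof. by rewrite /tmap tliftE //; bil. Qed.

Lemma tassocE U V W (u : U) (v : V) (w : W) :
  tassoc ((u ⊗ v) ⊗ w) = u ⊗ (v ⊗ w).
Proof.
rewrite /tassoc tliftE; last by bil.
by rewrite tliftE //; bil.
Qed.

Lemma tmulE (A B : falgType k) (a a' : A) (b b' : B) :
  tmul (a ⊗ b) (a' ⊗ b') = (a * a') ⊗ (b * b').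
Proof.
rewrite /tmul tliftE; last by bil.
by rewrite tliftE //; bil.
Qed.

Lemma tmulPr (A B : falgType k) c (s x y : tensor A B) :
  tmul s (c *: x + y) = c *: tmul s x + tmul s y.
Proof. by rewrite /tmul -tliftP; apply: eq_tlift => a b; rewrite linearP. Qed.

End TensorMaps.

Section Contraction.

Variable k : fieldType.
Implicit Types U V W X : vectType k.

Lemma scale_regC (a b : k^o) : a *: b = b *: a :> k^o.
Proof. exact: mulrC. Qed.

Definition dcoord V (i : 'I_(dim V)) : 'Hom(V, k^o) :=
  linfun (fun v : V => v2r v 0 i : k^o).

Lemma dcoordE V i (v : V) : dcoord i v = v2r v 0 i.
Proof.
rewrite /dcoord.
have lf : linear (fun v : V => v2r v 0 i : k^o) by move=> c x y; rewrite linearP !mxE.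
pose fL : {linear V -> k^o} := HB.pack (fun v : V => v2r v 0 i : k^o)
  (GRing.isLinear.Build _ _ _ _ _ lf).
exact: (lfunE fL).
Qed.

Lemma dcoord_sum V W (F : {linear V -> W}) v : \sum_i dcoord i v *: F (tbasis i) = F v.
Proof.
rewrite {2}[v]tbasis_sum linear_sum; apply: eq_bigr => i _.
by rewrite linearZ /= dcoordE.
Qed.

Definition contract V W (a : V) : tensor 'Hom(V, k^o) W -> W :=
  tlift (fun (f : 'Hom(V, k^o)) w => f a *: w).

HB.instance Definition _ V W (a : V) :=
  GRing.isLinear.Build k (tensor 'Hom(V, k^o) W) W _ (@contract V W a)
    (tlift_is_linear (fun (f : 'Hom(V, k^o)) w => f a *: w)).

Lemma contractE V W a (f : 'Hom(V, k^o)) (w : W) : contract a (f ⊗ w) = f a *: w.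
Proof. by rewrite /contract tliftE //; bil. Qed.

Lemma contract_lin V W (t : tensor 'Hom(V, k^o) W) : linear (fun a => contract a t).
Proof. by rewrite /contract; lin. Qed.

Lemma contract_inj V W (s t : tensor 'Hom(V, k^o) W) :
  (forall a, contract a s = contract a t) -> s = t.
Proof.
move=> st.
have rec : forall r : tensor 'Hom(V, k^o) W,
    r = \sum_i dcoord i ⊗ contract (tbasis i) r.
  apply: (@tensor_extP _ _ _ _ idfun) => //.
    move=> c x y; rewrite scaler_sumr -big_split; apply: eq_bigr => i _ /=.
    by rewrite linearP tprodPr.
  move=> f w /=; under eq_bigr do rewrite contractE.
  have -> : f = \sum_i f (tbasis i) *: dcoord i.
    apply/lfunP => v; rewrite sum_lfunE -[LHS](dcoord_sum f v).
    by apply: eq_bigr => i _; rewrite scale_lfunE scale_regC.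
  have [bl br] := @tprod_bilin k 'Hom(V, k^o) W.
  pose L : {linear 'Hom(V, k^o) -> tensor 'Hom(V, k^o) W} :=
    HB.pack (fun g : 'Hom(V, k^o) => g ⊗ w) (GRing.isLinear.Build _ _ _ _ _ (bl w)).
  rewrite -[LHS]/(L _) linear_sum; apply: eq_bigr => i _; rewrite linearZ /=.
  have -> : (\sum_j f (tbasis j) *: dcoord j : 'Hom(V, k^o)) (tbasis i) = f (tbasis i).
    rewrite sum_lfunE -[RHS](dcoord_sum f (tbasis i)).
    by apply: eq_bigr => j _; rewrite scale_lfunE scale_regC.
  pose L2 : {linear W -> tensor 'Hom(V, k^o) W} :=
    HB.pack (fun w => dcoord i ⊗ w) (GRing.isLinear.Build _ _ _ _ _ (br (dcoord i))).
  by rewrite -[RHS]/(L2 _) linearZ.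
by rewrite [s]rec [t]rec; apply: eq_bigr => i _; rewrite st.
Qed.

End Contraction.

Section DualHopf.

Variables (k : fieldType) (H : hopfType k).

Definition hopf_dual : Type := 'Hom(H, k^o).

HB.instance Definition _ := Vector.copy hopf_dual 'Hom(H, k^o).

Implicit Types f g : hopf_dual.

Definition dual_mul f g : hopf_dual :=
  linfun (tlift (fun a b => (f : 'Hom(H, k^o)) a * (g : 'Hom(H, k^o)) b : k^o) \o comul).

Definition dual_one : hopf_dual := linfun (counit : {linear H -> k^o}).

Lemma dual_mulE f g h :
  (dual_mul f g : 'Hom(H, k^o)) h
  = tlift (fun a b => (f : 'Hom(H, k^o)) a * (g : 'Hom(H, k^o)) b : k^o) (comul h).
Proof. by rewrite /dual_mul lfunE. Qed.

Lemma dual_oneE h : (dual_one : 'Hom(H, k^o)) h = counit h.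
Proof. by rewrite /dual_one lfunE. Qed.

Fact dual_mulA : associative dual_mul.
Proof.
move=> f g l; apply/lfunP => h; rewrite !dual_mulE.
pose T : tensor H (tensor H H) -> k^o := tlift (fun a bc =>
  (f : 'Hom(H, k^o)) a * tlift (fun b c => (g : 'Hom(H, k^o)) b * (l : 'Hom(H, k^o)) c : k^o) bc).
transitivity (T (tmap idfun comul (comul h))).
  move: (comul h); apply: tensor_extP; rewrite /T; first by lin.
    by lin.
  move=> u v; rewrite tmapE /= !tliftE; try by bil.
  by rewrite dual_mulE.
rewrite -comulA; move: (comul h); apply: tensor_extP; rewrite /T; first by lin.
  by lin.
move=> u v; rewrite tmapE /=.
rewrite [RHS]tliftE; last by bil.
rewrite dual_mulE; move: (comul u).
apply: tensor_extP; [by lin | by lin | move=> x y].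
rewrite tassocE !tliftE; try by bil.
by rewrite mulrA.
Qed.

Fact dual_mul1f : left_id dual_one dual_mul.
Proof.
move=> f; apply/lfunP => h; rewrite dual_mulE -[in RHS](counitl h) tlift_linear.
by apply: eq_tlift => a b; rewrite dual_oneE linearZ.
Qed.

Fact dual_mulf1 : right_id dual_one dual_mul.
Proof.
move=> f; apply/lfunP => h; rewrite dual_mulE -[in RHS](counitr h) tlift_linear.
by apply: eq_tlift => a b; rewrite dual_oneE linearZ /= mulrC.
Qed.

Fact dual_mulPl c f g l : dual_mul (c *: f + g) l = c *: dual_mul f l + dual_mul g l.
Proof.
apply/lfunP => h; rewrite lfunPl !dual_mulE -tliftP.
by apply: eq_tlift => a b; rewrite lfunPl mulPl.
Qed.

Fact dual_mulPr c f g l : dual_mul l (c *: f + g) = c *: dual_mul l f + dual_mul l g.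
Proof.
apply/lfunP => h; rewrite lfunPl !dual_mulE -tliftP.
by apply: eq_tlift => a b; rewrite lfunPl mulPr.
Qed.

Fact dual_mulDl : left_distributive dual_mul +%R.
Proof. by move=> f g l; have := dual_mulPl 1 f g l; rewrite !scale1r. Qed.

Fact dual_mulDr : right_distributive dual_mul +%R.
Proof. by move=> l f g; have := dual_mulPr 1 f g l; rewrite !scale1r. Qed.

Fact dual_mul0f f : dual_mul 0 f = 0.
Proof.
by apply: (addIr (dual_mul 0 f)); rewrite -dual_mulDl !add0r.
Qed.

Fact dual_mulf0 f : dual_mul f 0 = 0.
Proof.
by apply: (addIr (dual_mul f 0)); rewrite -dual_mulDr !add0r.
Qed.

Fact dual_one_neq0 : dual_one != 0.
Proof.
apply/eqP => /lfunP /(_ 1); rewrite dual_oneE counit1 zero_lfunE.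
by apply/eqP; exact: oner_neq0.
Qed.

HB.instance Definition _ := GRing.Zmodule_isNzRing.Build hopf_dual
  dual_mulA dual_mul1f dual_mulf1 dual_mulDl dual_mulDr dual_one_neq0.

Fact dual_scalerAl c f g : c *: (f * g) = (c *: f) * g.
Proof. by have := dual_mulPl c f 0 g; rewrite !dual_mul0f !addr0. Qed.

HB.instance Definition _ := GRing.Lmodule_isLalgebra.Build k hopf_dual dual_scalerAl.

Fact dual_scalerAr c f g : c *: (f * g) = f * (c *: g).
Proof. by have := dual_mulPr c g 0 f; rewrite !dual_mulf0 !addr0. Qed.

HB.instance Definition _ := GRing.Lalgebra_isAlgebra.Build k hopf_dual dual_scalerAr.

HB.instance Definition _ := Algebra_isFalgebra.Build k hopf_dual.

End DualHopf.

Section DualHopfCoalgebra.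

Variables (k : fieldType) (H : hopfType k).
Implicit Types f g : hopf_dual H.

Local Notation ev f := (f : 'Hom(H, k^o)).

(* The transpose of the multiplication: (comul f) (a ⊗ b) = f (a * b), cf.
   dual_comul_contract. *)
Definition dual_comul f : tensor (hopf_dual H) (hopf_dual H) :=
  \sum_i \sum_j
    ev f (tbasis i * tbasis j) *: ((dcoord i : hopf_dual H) ⊗ (dcoord j : hopf_dual H)).

Fact dual_comul_linear : linear dual_comul.
Proof.
move=> c x y; rewrite /dual_comul scaler_sumr -big_split; apply: eq_bigr => i _ /=.
rewrite scaler_sumr -big_split; apply: eq_bigr => j _ /=.
by rewrite lfunPl scalePl.
Qed.

HB.instance Definition _ :=
  GRing.isLinear.Build k (hopf_dual H) (tensor (hopf_dual H) (hopf_dual H)) _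
    dual_comul dual_comul_linear.

Definition dual_counit f : k^o := ev f 1.

Fact dual_counit_linear : linear dual_counit.
Proof. by move=> c x y; rewrite /dual_counit lfunPl. Qed.

HB.instance Definition _ :=
  GRing.isLinear.Build k (hopf_dual H) k^o _ dual_counit dual_counit_linear.

Definition dual_antipode f : hopf_dual H := linfun (ev f \o (antipode : {linear H -> H})).

Fact dual_antipodeE f h : ev (dual_antipode f) h = ev f (antipode h).
Proof. by rewrite /dual_antipode lfunE. Qed.

Fact dual_antipode_linear : linear dual_antipode.
Proof. by move=> c x y; apply/lfunP => h; rewrite lfunPl !dual_antipodeE lfunPl. Qed.

HB.instance Definition _ :=
  GRing.isLinear.Build k (hopf_dual H) (hopf_dual H) _ dual_antipode dual_antipode_linear.

Definition lshift_dual a f : hopf_dual H := linfun (ev f \o (fun b => a * b)).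

Fact lshift_dualE a f b : ev (lshift_dual a f) b = ev f (a * b).
Proof.
have la : linear (fun b => a * b) by move=> c x y; rewrite mulPr.
pose L : {linear H -> H} := HB.pack (fun b => a * b) (GRing.isLinear.Build _ _ _ _ _ la).
exact: (lfunE (ev f \o L)).
Qed.

Fact lshift_dual_linear a : linear (lshift_dual a).
Proof. by move=> c x y; apply/lfunP => h; rewrite lfunPl !lshift_dualE lfunPl. Qed.

HB.instance Definition _ a :=
  GRing.isLinear.Build k (hopf_dual H) (hopf_dual H) _ (lshift_dual a) (lshift_dual_linear a).

Local Notation ctr := (@contract k H _).

Lemma dual_comul_contract a f : ctr a (dual_comul f) = lshift_dual a f.
Proof.
apply/lfunP => b; rewrite lshift_dualE.
rewrite linear_sum sum_lfunE.
pose L (y : H) : {linear H -> k^o} := HB.pack (fun x => ev f (x * y)) 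
  (GRing.isLinear.Build _ _ _ _ _ (fun c x1 x2 => etrans (congr1 (ev f) (mulPl c x1 x2 y)) (linearP f c _ _))).
rewrite -[RHS]/(L b a) -(dcoord_sum (L b) a); apply: eq_bigr => i _ /=.
rewrite linear_sum sum_lfunE.
rewrite -lshift_dualE -(dcoord_sum (ev (lshift_dual (tbasis i) f)) b) scaler_sumr.
apply: eq_bigr => j _; rewrite linearZ /= contractE !scale_lfunE lshift_dualE.
by rewrite -!/(_ * _ : k) /GRing.scale /= mulrC -mulrA [X in _ * X]mulrC.
Qed.

Lemma dual_separate (s t : tensor (hopf_dual H) (hopf_dual H)) :
  (forall a b, ev (ctr a s) b = ev (ctr a t) b) -> s = t.
Proof. by move=> st; apply: contract_inj => a; apply/lfunP. Qed.

Fact dual_comulA f :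
  tassoc (tmap dual_comul idfun (dual_comul f)) = tmap idfun dual_comul (dual_comul f).
Proof.
apply: (@contract_inj k H) => a.
transitivity (dual_comul (ctr a (dual_comul f))); last first.
  move: (dual_comul f).
  apply: (@tensor_extP k (hopf_dual H) (hopf_dual H)); [by lin | by lin | move=> u v].
  by rewrite tmapE !contractE linearZ.
transitivity (tmap (lshift_dual a) idfun (dual_comul f)).
  move: (dual_comul f).
  apply: (@tensor_extP k (hopf_dual H) (hopf_dual H)); [by lin | by lin | move=> u v].
  rewrite !tmapE /= -dual_comul_contract; move: (dual_comul u).
  apply: (@tensor_extP k (hopf_dual H) (hopf_dual H)); [by lin | by lin | move=> x y].
  rewrite tassocE !contractE.
  by rewrite tprodZl.
apply: (@contract_inj k H) => b.
transitivity (ctr (a * b) (dual_comul f)).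
  move: (dual_comul f).
  apply: (@tensor_extP k (hopf_dual H) (hopf_dual H)); [by lin | by lin | move=> u v].
  by rewrite tmapE !contractE lshift_dualE.
rewrite !dual_comul_contract; apply/lfunP => c.
by rewrite !lshift_dualE mulrA.
Qed.

Fact dual_counitl f : tlift (fun a b => dual_counit a *: b) (dual_comul f) = f.
Proof.
rewrite -[LHS]/(ctr 1 (dual_comul f)) dual_comul_contract.
by apply/lfunP => h; rewrite lshift_dualE mul1r.
Qed.

Fact dual_counitr f : tlift (fun a b => dual_counit b *: a) (dual_comul f) = f.
Proof.
apply/lfunP => h.
transitivity (ev (ctr h (dual_comul f)) 1); last first.
  by rewrite dual_comul_contract lshift_dualE mulr1.
move: (dual_comul f).
apply: (@tensor_extP k (hopf_dual H) (hopf_dual H)); [by lin | by lin | move=> u v].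
rewrite contractE tliftE; last by bil.
by rewrite !scale_lfunE scale_regC.
Qed.

Fact dual_comul1 : dual_comul 1 = 1 ⊗ 1.
Proof.
apply: dual_separate => a b.
by rewrite dual_comul_contract contractE lshift_dualE scale_lfunE !dual_oneE counitM.
Qed.

Fact dual_comulM f g : dual_comul (f * g) = tmul (dual_comul f) (dual_comul g).
Proof.
apply: dual_separate => a b.
rewrite dual_comul_contract lshift_dualE dual_mulE comulM.
transitivity (tlift (fun a1 a2 => tlift (fun b1 b2 =>
    ev (ctr a1 (dual_comul f)) b1 * ev (ctr a2 (dual_comul g)) b2 : k^o) (comul b)) (comul a)).
  rewrite tlift_linear; apply: eq_tlift => a1 a2.
  rewrite tlift_linear; apply: eq_tlift => b1 b2.
  by rewrite /= tliftE; [rewrite !dual_comul_contract !lshift_dualE | bil].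
move: (dual_comul f) (dual_comul g) => s t; move: s.
apply: (@tensor_extP k (hopf_dual H) (hopf_dual H)); [by lin | by lin | move=> f1 f2].
move: t.
apply: (@tensor_extP k (hopf_dual H) (hopf_dual H)); [by lin | | move=> g1 g2];
  first by move=> c x y /=; rewrite tmulPr linearP lfunPl.
rewrite tmulE contractE scale_lfunE !dual_mulE.
transitivity (tlift (fun a1 a2 => tlift (fun b1 b2 =>
    (ev f1 a1 * ev f2 b1) * (ev g1 a2 * ev g2 b2) : k^o) (comul b)) (comul a)).
  apply: eq_tlift => a1 a2; apply: eq_tlift => b1 b2.
  by rewrite !contractE !scale_lfunE.
move: (comul a).
apply: tensor_extP; [by lin | by lin | move=> a1 a2].
rewrite tliftE; last by bil.
rewrite tliftE; last by bil.
move: (comul b).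
apply: tensor_extP; [by lin | by lin | move=> b1 b2].
rewrite !tliftE; try by bil.
by rewrite -[RHS]/(_ * _ : k^o) mulrACA.
Qed.

Fact dual_counit1 : dual_counit 1 = 1.
Proof. by rewrite /dual_counit dual_oneE counit1. Qed.

Fact dual_counitM f g : dual_counit (f * g) = dual_counit f * dual_counit g.
Proof. by rewrite /dual_counit dual_mulE comul1 tliftE; last by bil. Qed.

Fact dual_antipodel f :
  tlift (fun a b => dual_antipode a * b) (dual_comul f) = (dual_counit f)%:A.
Proof.
apply/lfunP => h; rewrite scale_lfunE dual_oneE.
transitivity (tlift (fun a b => ev (ctr (antipode a) (dual_comul f)) b) (comul h)).
  move: (dual_comul f).
  apply: (@tensor_extP k (hopf_dual H) (hopf_dual H)); [by lin | by lin | move=> u v].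
  rewrite tliftE; last by bil.
  rewrite dual_mulE; apply: eq_tlift => x y.
  by rewrite contractE scale_lfunE dual_antipodeE.
transitivity (ev f (tlift (fun a b => antipode a * b) (comul h))).
  rewrite tlift_linear; apply: eq_tlift => x y.
  by rewrite dual_comul_contract lshift_dualE.
by rewrite antipodel linearZ /= scale_regC.
Qed.

Fact dual_antipoder f :
  tlift (fun a b => a * dual_antipode b) (dual_comul f) = (dual_counit f)%:A.
Proof.
apply/lfunP => h; rewrite scale_lfunE dual_oneE.
transitivity (tlift (fun a b => ev (ctr a (dual_comul f)) (antipode b)) (comul h)).
  move: (dual_comul f).
  apply: (@tensor_extP k (hopf_dual H) (hopf_dual H)); [by lin | by lin | move=> u v].
  rewrite tliftE; last by bil.
  rewrite dual_mulE; apply: eq_tlift => x y.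
  by rewrite contractE scale_lfunE dual_antipodeE.
transitivity (ev f (tlift (fun a b => a * antipode b) (comul h))).
  rewrite tlift_linear; apply: eq_tlift => x y.
  by rewrite dual_comul_contract lshift_dualE.
by rewrite antipoder linearZ /= scale_regC.
Qed.

HB.instance Definition _ := isHopfAlgebra.Build k (hopf_dual H)
  dual_comulA dual_counitl dual_counitr dual_comul1 dual_comulM
  dual_counit1 dual_counitM dual_antipodel dual_antipoder.

End DualHopfCoalgebra.

Section GroupAlgebra.

Variables (k : fieldType) (gT : finGroupType).

Definition group_algebra : Type := {ffun gT -> k^o}.

HB.instance Definition _ := Vector.copy group_algebra {ffun gT -> k^o}.

Implicit Types x y z : group_algebra.

Definition gdelta (g : gT) : group_algebra := [ffun h => (h == g)%:R : k^o].

Definition glift (W : lmodType k) (F : gT -> W) (x : group_algebra) : W :=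
  \sum_g (x : {ffun gT -> k^o}) g *: F g.

Fact glift_is_linear (W : lmodType k) (F : gT -> W) : linear (glift F).
Proof.
move=> c x y; rewrite scaler_sumr -big_split; apply: eq_bigr => g _ /=.
by rewrite !ffunE scalerDl scalerA.
Qed.

HB.instance Definition _ (W : lmodType k) (F : gT -> W) :=
  GRing.isLinear.Build k group_algebra W _ (glift F) (glift_is_linear F).

Lemma gliftE (W : lmodType k) (F : gT -> W) g : glift F (gdelta g) = F g.
Proof.
rewrite /glift (bigD1 g) //= ffunE eqxx scale1r big1 ?addr0 // => h.
by rewrite ffunE => /negPf ->; rewrite scale0r.
Qed.

Lemma gliftP (W : lmodType k) c (F G : gT -> W) x :
  glift (fun g => c *: F g + G g) x = c *: glift F x + glift G x.
Proof.
rewrite scaler_sumr -big_split; apply: eq_bigr => g _ /=.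
by rewrite scalerDr !scalerA mulrC.
Qed.

Lemma eq_glift (W : lmodType k) (F G : gT -> W) : F =1 G -> glift F =1 glift G.
Proof. by move=> FG x; apply: eq_bigr => g _; rewrite FG. Qed.

Lemma glift_delta x : glift gdelta x = x.
Proof.
apply/ffunP => g; rewrite sum_ffunE (bigD1 g) //= !ffunE eqxx big1 => [|h ngh].
  by rewrite addr0; exact: mulr1.
by rewrite !ffunE eq_sym (negPf ngh); exact: mulr0.
Qed.

Lemma group_algebra_ext (W : lmodType k) (f f' : group_algebra -> W) :
  linear f -> linear f' -> (forall g, f (gdelta g) = f' (gdelta g)) -> f =1 f'.
Proof.
move=> lf lf' ff' x.
pose fL : {linear _ -> _} := HB.pack f (GRing.isLinear.Build _ _ _ _ _ lf).
pose gL : {linear _ -> _} := HB.pack f' (GRing.isLinear.Build _ _ _ _ _ lf').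
rewrite -[f]/(fL : _ -> _) -[f']/(gL : _ -> _) -(glift_delta x) !linear_sum.
by apply: eq_bigr => i _; rewrite !linearZ /= ff'.
Qed.

Definition group_mul x y : group_algebra :=
  glift (fun g => glift (fun h => gdelta (g * h)%g) y) x.

Definition group_one : group_algebra := gdelta 1%g.

Lemma group_mulE g h : group_mul (gdelta g) (gdelta h) = gdelta (g * h)%g.
Proof. by rewrite /group_mul !gliftE. Qed.

Fact group_mulPl c x y z : group_mul (c *: x + y) z = c *: group_mul x z + group_mul y z.
Proof. by rewrite /group_mul linearP. Qed.

Fact group_mulPr c x y z : group_mul z (c *: x + y) = c *: group_mul z x + group_mul z y.
Proof. by rewrite /group_mul -gliftP; apply: eq_glift => g; rewrite linearP. Qed.

Ltac glin := by move=> c ? ?; rewrite ?(group_mulPl, group_mulPr).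

Fact group_mulA : associative group_mul.
Proof.
move=> x y z; move: x; apply: group_algebra_ext; [glin | glin | move=> g].
move: y; apply: group_algebra_ext; [glin | glin | move=> h].
move: z; apply: group_algebra_ext; [glin | glin | move=> l].
by rewrite !group_mulE mulgA.
Qed.

Fact group_mul1x : left_id group_one group_mul.
Proof.
apply: group_algebra_ext => [|//|g]; first by glin.
by rewrite group_mulE mul1g.
Qed.

Fact group_mulx1 : right_id group_one group_mul.
Proof.
apply: group_algebra_ext => [|//|g]; first by glin.
by rewrite group_mulE mulg1.
Qed.

Fact group_mulDl : left_distributive group_mul +%R.
Proof. by move=> x y z; have := group_mulPl 1 x y z; rewrite !scale1r. Qed.

Fact group_mulDr : right_distributive group_mul +%R.
Proof. by move=> z x y; have := group_mulPr 1 x y z; rewrite !scale1r. Qed.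

Fact group_mul0x x : group_mul 0 x = 0.
Proof. by apply: (addIr (group_mul 0 x)); rewrite -group_mulDl !add0r. Qed.

Fact group_mulx0 x : group_mul x 0 = 0.
Proof. by apply: (addIr (group_mul x 0)); rewrite -group_mulDr !add0r. Qed.

Fact group_one_neq0 : group_one != 0.
Proof.
apply/eqP => /ffunP /(_ 1%g); rewrite !ffunE eqxx => /eqP.
by apply/negP; exact: oner_neq0.
Qed.

HB.instance Definition _ := GRing.Zmodule_isNzRing.Build group_algebra
  group_mulA group_mul1x group_mulx1 group_mulDl group_mulDr group_one_neq0.

Fact group_scalerAl c x y : c *: (x * y) = (c *: x) * y.
Proof. by have := group_mulPl c x 0 y; rewrite !group_mul0x !addr0. Qed.

HB.instance Definition _ := GRing.Lmodule_isLalgebra.Build k group_algebra group_scalerAl.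

Fact group_scalerAr c x y : c *: (x * y) = x * (c *: y).
Proof. by have := group_mulPr c y 0 x; rewrite !group_mulx0 !addr0. Qed.

HB.instance Definition _ := GRing.Lalgebra_isAlgebra.Build k group_algebra group_scalerAr.

HB.instance Definition _ := Algebra_isFalgebra.Build k group_algebra.

Definition group_comul : group_algebra -> tensor group_algebra group_algebra :=
  glift (fun g => gdelta g ⊗ gdelta g).
HB.instance Definition _ := GRing.Linear.on group_comul.

Definition group_counit : group_algebra -> k^o := glift (fun=> 1).
HB.instance Definition _ := GRing.Linear.on group_counit.

Definition group_antipode : group_algebra -> group_algebra :=
  glift (fun g => gdelta g^-1%g).
HB.instance Definition _ := GRing.Linear.on group_antipode.

Let comulE g : group_comul (gdelta g) = gdelta g ⊗ gdelta g.
Proof. exact: gliftE. Qed.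
Let counitE g : group_counit (gdelta g) = 1.
Proof. exact: gliftE. Qed.
Let antipodeE g : group_antipode (gdelta g) = gdelta g^-1%g.
Proof. exact: gliftE. Qed.
Let mulE g h : gdelta g * gdelta h = gdelta (g * h)%g.
Proof. exact: group_mulE. Qed.

Fact group_comulA x :
  tassoc (tmap group_comul idfun (group_comul x)) = tmap idfun group_comul (group_comul x).
Proof.
move: x; apply: group_algebra_ext; [by lin | by lin | move=> g].
by rewrite comulE !tmapE /= !comulE tassocE.
Qed.

Fact group_counitl x : tlift (fun a b => group_counit a *: b) (group_comul x) = x.
Proof.
move: x; apply: group_algebra_ext; [by lin | by [] | move=> g].
by rewrite comulE tliftE ?counitE ?scale1r //; bil.
Qed.

Fact group_counitr x : tlift (fun a b => group_counit b *: a) (group_comul x) = x.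
Proof.
move: x; apply: group_algebra_ext; [by lin | by [] | move=> g].
by rewrite comulE tliftE ?counitE ?scale1r //; bil.
Qed.

Fact group_comul1 : group_comul 1 = 1 ⊗ 1.
Proof. exact: comulE. Qed.

Fact group_comulM x y : group_comul (x * y) = tmul (group_comul x) (group_comul y).
Proof.
move: x; apply: group_algebra_ext; [by lin | by lin | move=> g].
move: y; apply: group_algebra_ext; [by lin | | move=> h].
  by move=> c x y; rewrite linearP tmulPr.
by rewrite !comulE tmulE mulE comulE.
Qed.

Fact group_counit1 : group_counit 1 = 1.
Proof. exact: counitE. Qed.

Fact group_counitM x y : group_counit (x * y) = group_counit x * group_counit y.
Proof.
move: x; apply: group_algebra_ext; [by lin | by lin | move=> g].
move: y; apply: group_algebra_ext; [by lin | by lin | move=> h].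
by rewrite mulE !counitE mulr1.
Qed.

Fact group_antipodel x :
  tlift (fun a b => group_antipode a * b) (group_comul x) = (group_counit x)%:A.
Proof.
move: x; apply: group_algebra_ext; [by lin | by lin | move=> g].
rewrite comulE tliftE; last by bil.
by rewrite counitE scale1r antipodeE mulE mulVg.
Qed.

Fact group_antipoder x :
  tlift (fun a b => a * group_antipode b) (group_comul x) = (group_counit x)%:A.
Proof.
move: x; apply: group_algebra_ext; [by lin | by lin | move=> g].
rewrite comulE tliftE; last by bil.
by rewrite counitE scale1r antipodeE mulE mulgV.
Qed.

HB.instance Definition _ := isHopfAlgebra.Build k group_algebra
  group_comulA group_counitl group_counitr group_comul1 group_comulM
  group_counit1 group_counitM group_antipodel group_antipoder.

End GroupAlgebra.

Section GroundField.

Variable k : fieldType.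

Definition field_comul (x : k^o) : tensor k^o k^o := x *: (1 ⊗ 1).

Fact field_comul_linear : linear field_comul.
Proof. by move=> c x y; rewrite /field_comul scalePl. Qed.

HB.instance Definition _ :=
  GRing.isLinear.Build k k^o (tensor k^o k^o) _ field_comul field_comul_linear.

Let fcounit : {linear k^o -> k^o} := idfun.

Let scale1A (x : k^o) : x *: (1 : k^o) = x. Proof. exact: mulr1. Qed.

Fact field_comulA (x : k^o) :
  tassoc (tmap field_comul idfun (field_comul x)) = tmap idfun field_comul (field_comul x).
Proof.
have -> : field_comul x = x *: (1 ⊗ 1) by [].
rewrite !linearZ /= !tmapE; congr (_ *: _).
by rewrite /= /field_comul !scale1r tassocE.
Qed.

Fact field_counitl (x : k^o) : tlift (fun a b : k^o => fcounit a *: b) (field_comul x) = x.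
Proof. by rewrite /field_comul linearZ /= tliftE ?scale1r ?scale1A //; bil. Qed.

Fact field_counitr (x : k^o) : tlift (fun a b : k^o => fcounit b *: a) (field_comul x) = x.
Proof. by rewrite /field_comul linearZ /= tliftE ?scale1r ?scale1A //; bil. Qed.

Fact field_comul1 : field_comul 1 = 1 ⊗ 1.
Proof. exact: scale1r. Qed.

Fact field_comulM (x y : k^o) : field_comul (x * y) = tmul (field_comul x) (field_comul y).
Proof.
rewrite /field_comul.
have -> : x *: (1 ⊗ 1) = (x *: 1) ⊗ 1 :> tensor k^o k^o by rewrite tprodZl.
have -> : y *: (1 ⊗ 1) = (y *: 1) ⊗ 1 :> tensor k^o k^o by rewrite tprodZl.
by rewrite tmulE mulr1 !scale1A -tprodZl scale1A.
Qed.

Fact field_antipode (x : k^o) :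
  tlift (fun a b : k^o => fcounit a * b) (field_comul x) = (fcounit x)%:A.
Proof. by rewrite /field_comul linearZ /= tliftE ?mulr1 //; bil. Qed.

HB.instance Definition _ := isHopfAlgebra.Build k k^o
  field_comulA field_counitl field_counitr field_comul1 field_comulM
  (erefl : fcounit 1 = 1) (fun a b => erefl : fcounit (a * b) = fcounit a * fcounit b)
  field_antipode field_antipode.

End GroundField.

Section HopfNotions.

Variable k : fieldType.
Implicit Types H A B : hopfType k.

Definition simple_left_ideal (A : falgType k) (I : {vspace A}) : Prop :=
  [/\ ({:A} * I <= I)%VS, I != 0%VS
    & forall J : {vspace A}, ({:A} * J <= J)%VS -> (J <= I)%VS -> J = 0%VS \/ J = I].

(* The left regular module is a direct sum of simple submodules. *)
Definition semisimple_algebra (A : falgType k) : Prop :=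
  exists (n : nat) (I : 'I_n -> {vspace A}),
    [/\ forall i, simple_left_ideal (I i), directv (\sum_i I i)
      & (\sum_i I i)%VS = fullv].

Definition grouplike H : pred H := fun g => (comul g == g ⊗ g) && (counit g == 1).

(* |G(H)| = n *)
Definition grouplike_order H (n : nat) : Prop :=
  exists s : seq H, [/\ uniq s, size s = n & s =i @grouplike H].

Definition hopf_morphism H B (f : {lrmorphism H -> B}) : Prop :=
  [/\ forall h, comul (f h) = tmap f f (comul h),
      forall h, counit (f h) = counit h
    & forall h, antipode (f h) = f (antipode h)].

Definition hopf_iso H B : Prop :=
  exists f : {lrmorphism H -> B}, hopf_morphism f /\ bijective f.

Definition trivial_hopf H : Prop :=
  exists gT : finGroupType,
    hopf_iso H (group_algebra k gT) \/ hopf_iso H (hopf_dual (group_algebra k gT)).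

Definition right_coinv H B (f : {lrmorphism H -> B}) : pred H :=
  fun h => tmap idfun f (comul h) == h ⊗ 1.

Definition left_coinv H B (f : {lrmorphism H -> B}) : pred H :=
  fun h => tmap f idfun (comul h) == 1 ⊗ h.

Definition normal_morphism H B (f : {lrmorphism H -> B}) : Prop :=
  right_coinv f =i left_coinv f.

(* P is a Hopf subalgebra of H and, as a Hopf algebra, it is trivial: the
   Hopf algebra A with its injective map to H is P with its inclusion. *)
Definition trivial_hopf_sub H (P : pred H) : Prop :=
  exists (A : hopfType k) (i : {lrmorphism A -> H}),
    [/\ hopf_morphism i, injective i, forall h, h \in P <-> exists a, h = i a
      & trivial_hopf A].

Definition upper_semisolvable H : Prop :=
  exists (n : nat) (K : nat -> hopfType k),
    [/\ K 0%N = H, hopf_iso (K n) k^o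
      & forall i, (i < n)%N -> exists f : {lrmorphism K i -> K i.+1},
          [/\ hopf_morphism f, forall b, exists h, f h = b,
              normal_morphism f & trivial_hopf_sub (right_coinv f)]].

End HopfNotions.

(* Main.v *)
Require Import Defs.
From HB Require Import structures.
From mathcomp Require Import all_boot all_order all_algebra all_fingroup all_solvable all_field.
From mathcomp Require Import zify.

(** The group algebra of [G(H^* )] is a Hopf subalgebra of [H^*] of index [p], the smallest
    prime divisor of [dim H].  Let [Lam] be its integral idempotent and [l0] the one of [H^*].
    The right ideal [Lam H^*] has dimension [p], so [Lam - l0], which has rank [p - 1], splits
    in the character ring of [H] into primitive idempotents [e] whose ranks add up to [p - 1].
    By the class equation of Kac and Zhu the rank of [e] divides [dim H]: [1 / T e], with [T e]
    the value of [e] at the integral of [H], is an eigenvalue of a matrix of multiplicities,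
    hence an algebraic integer.  All the ranks are therefore 1, and an idempotent of [H^*] of rank one gives a
    group-like element of [H].  So the coinvariants of the quotient map from [H] to the functions
    on [G(H^* )] are spanned by group-like elements: this map is normal with trivial
    coinvariants, and the chain continues with the counit.

    The class equation needs [S^2 = id] (Larson and Radford).  Here [S^4 = id] follows from
    Radford's formula once the integral [lmb] of [H^*] satisfies [lmb 1 != 0], and [lmb 1] is the
    trace of [S^2].  As [S^2] is inner of finite order, that trace is a sum of products
    [chi w * chi w^-1] of character values, which a comparison of roots of unity with those in
    [algC] turns into a sum of squared moduli. *)

Set Implicit Arguments.
Unset Strict Implicit.
Unset Printing Implicit Defensive.

Import Order.TTheory GRing.Theory Num.Theory VectorInternalTheory.
Local Open Scope ring_scope.

(** The field [k] is an abstract algebraically closed field: it has no absolute value and need not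
    embed into [algC], so arguments on positivity or integrality are phrased with integer
    polynomials, which can be read in both fields. Ranks appear as traces in [k]; characteristic 0
    recovers them as natural numbers, and [ltrace (rop f) = dim H * f L] makes the dimension of
    [f H^*] a value at the integral. Semisimplicity of [H] enters through the idempotents cut out by
    its simple left ideals. In the character ring the functional [f |-> f L] plays that part: it is
    symmetric, vanishes on nilpotents and makes the irreducible characters orthonormal, so a corner
    that is not scalar contains a further idempotent. Normality comes from the antipode, which
    exchanges the left and right actions of [H^*] on [H] and permutes the group-like elements
    spanning the coinvariants of one side. *)

Section LinearMaps.

Variable k : fieldType.
Implicit Types U V W : vectType k.

Lemma linear_id U : linear (fun x : U => x). Proof. by []. Qed.

Lemma linear_app U V W (F : {linear V -> W}) (g : U -> V) :
  linear g -> linear (fun x => F (g x)).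
Proof. by move=> lg c x y; rewrite lg linearP. Qed.

Lemma linear_appf U V W (F : V -> W) (g : U -> V) :
  linear F -> linear g -> linear (fun x => F (g x)).
Proof. by move=> lF lg c x y; rewrite lg lF. Qed.

Lemma linear_applf U V W (F : 'Hom(V, W)) (g : U -> V) :
  linear g -> linear (fun x => F (g x)).
Proof. by move=> lg c x y; rewrite lg linearP. Qed.

Lemma linear_lfunapp U V W (F : U -> 'Hom(V, W)) v :
  linear F -> linear (fun x => F x v).
Proof. by move=> lF c x y; rewrite lF lfunPl. Qed.

Lemma linear_mull U (A : falgType k) (F : U -> A) a : linear F -> linear (fun x => F x * a).
Proof. by move=> lF c x y; rewrite lF mulPl. Qed.

Lemma linear_mulr U (A : falgType k) (F : U -> A) a : linear F -> linear (fun x => a * F x).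
Proof. by move=> lF c x y; rewrite lF mulPr. Qed.

Lemma linear_scalel U W (F : U -> k^o) (w : W) : linear F -> linear (fun x => F x *: w).
Proof. by move=> lF c x y; rewrite lF scalePl. Qed.

Lemma linear_scaler U W (F : U -> W) (a : k) : linear F -> linear (fun x => a *: F x).
Proof. by move=> lF c x y; rewrite lF scalePr. Qed.

Lemma linear_add U W (F G : U -> W) : linear F -> linear G -> linear (fun x => F x + G x).
Proof. by move=> lF lG c x y; rewrite lF lG scalerDr addrACA. Qed.

Lemma linear_opp U W (F : U -> W) : linear F -> linear (fun x => - F x).
Proof. by move=> lF c x y; rewrite lF opprD scalerN. Qed.

Lemma linear_sumf U W I (r : seq I) (P : pred I) (F : I -> U -> W) :
  (forall i, linear (F i)) -> linear (fun x => \sum_(i <- r | P i) F i x).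
Proof.
move=> lF c x y; rewrite scaler_sumr -big_split /=.
by apply: eq_bigr => i _; rewrite lF.
Qed.

Lemma linear_tprodl U V W (F : U -> V) (w : W) : linear F -> linear (fun x => F x ⊗ w).
Proof. by move=> lF c x y; rewrite lF tprodPl. Qed.

Lemma linear_tprodr U V W (F : U -> V) (w : W) : linear F -> linear (fun x => w ⊗ F x).
Proof. by move=> lF c x y; rewrite lF tprodPr. Qed.

Lemma linear_tliftb U V V' W (F : U -> V -> V' -> W) t :
  (forall a b, linear (fun x => F x a b)) -> linear (fun x => tlift (F x) t).
Proof. by move=> lF c x y; rewrite -tliftP; apply: eq_tlift => a b; rewrite lF. Qed.

Lemma linear_tliftt U V V' W (F : V -> V' -> W) (t : U -> tensor V V') :
  linear t -> linear (fun x => tlift F (t x)).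
Proof. by move=> lt c x y; rewrite lt linearP. Qed.

End LinearMaps.

(* Syntax-directed proof of linearity of an explicit expression. *)
Ltac not_id g := lazymatch g with (fun x => x) => fail | _ => idtac end.

Ltac slin_step :=
  first
    [ lazymatch goal with |- GRing.linear_for _ (fun x => @GRing.mul _ (@?F x) ?a) =>
        apply: (@linear_mull _ _ _ F a) end
    | lazymatch goal with |- GRing.linear_for _ (fun x => @GRing.mul _ ?a (@?F x)) =>
        apply: (@linear_mulr _ _ _ F a) end
    | lazymatch goal with |- GRing.linear_for _ (fun x => @GRing.scale _ _ ?a (@?F x)) =>
        apply: (@linear_scaler _ _ _ F a) end
    | lazymatch goal with |- GRing.linear_for _ (fun x => @GRing.scale _ _ (@?F x) ?a) =>
        apply: (@linear_scalel _ _ _ F a) end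
    | lazymatch goal with |- GRing.linear_for _ (fun x => @GRing.add _ (@?F x) (@?G x)) =>
        apply: (@linear_add _ _ _ F G) end
    | lazymatch goal with |- GRing.linear_for _ (fun x => @GRing.opp _ (@?F x)) =>
        apply: (@linear_opp _ _ _ F) end
    | lazymatch goal with |- GRing.linear_for _ (fun x => @tprod _ _ _ (@?F x) ?a) =>
        apply: (@linear_tprodl _ _ _ _ F a) end
    | lazymatch goal with |- GRing.linear_for _ (fun x => @tprod _ _ _ ?a (@?F x)) =>
        apply: (@linear_tprodr _ _ _ _ F a) end
    | lazymatch goal with |- GRing.linear_for _ (fun x => @tlift _ _ _ _ ?F (@?t x)) =>
        apply: (@linear_tliftt _ _ _ _ _ F t) end
    | lazymatch goal with |- GRing.linear_for _ (fun x => @tlift _ _ _ _ (@?F x) ?t) =>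
        apply: (@linear_tliftb _ _ _ _ _ F t) end
    | lazymatch goal with |- GRing.linear_for _ (fun x => bigop _ _ _) =>
        apply: linear_sumf => ? /= end
    | lazymatch goal with |- GRing.linear_for _ (fun x => (fun_of_lfun ?F) (@?g x)) =>
        apply: (@linear_applf _ _ _ _ F g) end
    | lazymatch goal with |- GRing.linear_for _ (fun x => (fun_of_lfun (@?F x)) ?v) =>
        apply: (@linear_lfunapp _ _ _ _ F v) end
    | lazymatch goal with |- GRing.linear_for _ (fun x => ?F (@?g x)) =>
        not_id g; first [ apply: (@linear_app _ _ _ _ _ g) | apply: (@linear_appf _ _ _ _ F g) ]
      end
    | lazymatch goal with |- GRing.linear_for _ (fun x => ?F (@?g x) ?b) =>
        not_id g; apply: (@linear_appf _ _ _ _ (fun y => F y b) g) end ].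

Ltac slin :=
  lazymatch goal with
  | |- forall _, _ => intro; cbv beta; slin
  | |- GRing.linear_for _ _ =>
    first
      [ match goal with H : _ |- _ => solve [simple apply H] end
      | exact: linear_id
      | exact: linearP
      | slin_step; slin ]
  end.
Ltac sbil := split=> ?; cbv beta; slin.

(** * Traces, ranks and idempotent operators *)

Section Trace.

Variable k : fieldType.
Implicit Types U V W : vectType k.

(** It takes bare functions, with linearity as a hypothesis of the lemmas that need it, so that
    explicit Sweedler expressions can be traced without being bundled. *)
Definition ltrace V (f : V -> V) : k := \sum_i v2r (f (tbasis i)) 0 i.

Lemma eq_ltrace V (f g : V -> V) : f =1 g -> ltrace f = ltrace g.
Proof. by move=> fg; apply: eq_bigr => i _; rewrite fg. Qed.

Lemma linear_sum_ext U W I (r : seq I) (P : pred I) (f : U -> W) (F : I -> U) :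
  linear f -> f (\sum_(i <- r | P i) F i) = \sum_(i <- r | P i) f (F i).
Proof.
move=> lf.
pose fL : {linear U -> W} := HB.pack f (GRing.isLinear.Build _ _ _ _ _ lf).
exact: (linear_sum fL).
Qed.

Lemma linear0_ext U W (f : U -> W) : linear f -> f 0 = 0.
Proof. by move=> lf; have := lf (-1) 0 0; rewrite !scaler0 addr0 scaleN1r addNr. Qed.

Lemma linearZ_ext U W (f : U -> W) : linear f -> forall c x, f (c *: x) = c *: f x.
Proof. by move=> lf c x; have := lf c x 0; rewrite !addr0 (linear0_ext lf) addr0. Qed.

Lemma linearD_ext U W (f : U -> W) : linear f -> forall x y, f (x + y) = f x + f y.
Proof. by move=> lf x y; have := lf 1 x y; rewrite !scale1r. Qed.

Lemma linearB_ext U W (f : U -> W) : linear f -> forall x y, f (x - y) = f x - f y.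
Proof. by move=> lf x y; rewrite addrC -scaleN1r lf scaleN1r addrC. Qed.

Lemma linearN_ext U W (f : U -> W) : linear f -> forall x, f (- x) = - f x.
Proof. by move=> lf x; rewrite -scaleN1r linearZ_ext // scaleN1r. Qed.

(** The families need not be bases: every expression of the identity as a sum of rank one maps
    computes traces. Casimir elements supply such expressions below. *)
Lemma ltrace_dual V (J : finType) (P : pred J) (phi : J -> V -> k^o) (v : J -> V) (f : V -> V) :
    linear f -> (forall j, linear (phi j)) ->
    (forall h, h = \sum_(j | P j) phi j h *: v j) ->
  ltrace f = \sum_(j | P j) phi j (f (v j)).
Proof.
move=> lf lphi dual; transitivity (\sum_i \sum_(j | P j) phi j (f (tbasis i)) * v2r (v j) 0 i).
  apply: eq_bigr => i _; rewrite {1}[f _]dual linear_sum summxE.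
  by apply: eq_bigr => j _; rewrite linearZ /= mxE.
rewrite exchange_big; apply: eq_bigr => j _ /=.
rewrite {2}[v j]tbasis_sum linear_sum_ext // linear_sum_ext //.
by apply: eq_bigr => i _; rewrite !linearZ_ext // mulrC.
Qed.

Lemma ltraceC U V (f : U -> V) (g : V -> U) : linear f -> linear g ->
  ltrace (fun x => f (g x)) = ltrace (fun x => g (f x)).
Proof.
move=> lf lg; rewrite /ltrace.
transitivity (\sum_i \sum_j v2r (g (tbasis i)) 0 j * v2r (f (tbasis j)) 0 i).
  apply: eq_bigr => i _; rewrite {1}[g _]tbasis_sum linear_sum_ext // linear_sum summxE.
  by apply: eq_bigr => j _; rewrite linearZ_ext // linearZ /= mxE.
rewrite exchange_big; apply: eq_bigr => j _ /=.
rewrite {2}[f _]tbasis_sum linear_sum_ext // linear_sum summxE.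
by apply: eq_bigr => i _; rewrite linearZ_ext // linearZ /= mxE mulrC.
Qed.

Lemma ltrace_sum V I (r : seq I) (P : pred I) (F : I -> V -> V) :
  ltrace (fun x => \sum_(i <- r | P i) F i x) = \sum_(i <- r | P i) ltrace (F i).
Proof.
rewrite /ltrace exchange_big /=; apply: eq_bigr => i _.
by rewrite linear_sum summxE.
Qed.

Lemma ltraceZ V (c : k) (f : V -> V) : ltrace (fun x => c *: f x) = c * ltrace f.
Proof. by rewrite /ltrace big_distrr /=; apply: eq_bigr => i _; rewrite linearZ /= mxE. Qed.

Lemma ltraceD V (f g : V -> V) : ltrace (fun x => f x + g x) = ltrace f + ltrace g.
Proof. by rewrite /ltrace -big_split; apply: eq_bigr => i _; rewrite linearD /= mxE. Qed.

Lemma ltraceB V (f g : V -> V) : ltrace (fun x => f x - g x) = ltrace f - ltrace g.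
Proof. by rewrite /ltrace -sumrB; apply: eq_bigr => i _; rewrite linearB /= !mxE. Qed.

Lemma ltrace0 V : ltrace (fun _ : V => 0) = 0.
Proof. by rewrite /ltrace big1 // => i _; rewrite linear0 mxE. Qed.

Lemma ltrace_id V : ltrace (fun x : V => x) = (dim V)%:R.
Proof.
rewrite /ltrace -[RHS]mulr1 mulr_natl -[dim V in RHS]card_ord -sumr_const.
by apply: eq_bigr => i _; rewrite /tbasis r2vK mxE !eqxx.
Qed.

Lemma ltrace_rank1 V (phi : V -> k^o) (v : V) : linear phi -> ltrace (fun x => phi x *: v) = phi v.
Proof.
move=> lphi; rewrite [in RHS](tbasis_sum v) linear_sum_ext //.
by apply: eq_bigr => i _; rewrite linearZ /= mxE linearZ_ext // mulrC.
Qed.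

(** Factorization through the image. Exchanging the two factors under the trace replaces [f] by
    [g \o h] on the image, where an idempotent becomes the identity and a nilpotent map loses one
    order of nilpotency. *)
Lemma linear_factor V (f : V -> V) : linear f ->
  exists r (g : V -> 'rV[k]_r) (h : 'rV[k]_r -> V),
    [/\ linear g, linear h, forall x, f x = h (g x),
        injective h & forall y, exists x, g x = y].
Proof.
move=> lf.
pose fL : {linear V -> V} := HB.pack f (GRing.isLinear.Build _ _ _ _ _ lf).
pose M := lin1_mx (v2r \o fL \o r2v).
exists (\rank M), (fun x => v2r x *m col_base M), (fun y => r2v (y *m row_base M)); split.
- by move=> c x y; rewrite linearP mulmxDl scalemxAl.
- by move=> c x y; rewrite mulmxDl -scalemxAl linearP.
- move=> x; rewrite -mulmxA mulmx_base -[v2r x](v2rK) mul_rV_lin1 /=.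
  by rewrite !v2rK.
- by move=> x y /r2v_inj; exact: (row_free_inj (row_base_free M)).
move=> y; have /row_fullP [B BE] := col_base_full M.
by exists (r2v (y *m B)); rewrite r2vK -mulmxA BE mulmx1.
Qed.

Lemma ltrace_idem V (f : V -> V) : linear f -> (forall x, f (f x) = f x) ->
  exists r : nat, [/\ ltrace f = r%:R, r = 0%N -> forall x, f x = 0
   & r = 1%N -> exists (phi : V -> k^o) v, linear phi /\ forall x, f x = phi x *: v].
Proof.
move=> lf ff; have [r [g [h [lg lh fE injh surg]]]] := linear_factor lf.
have gh y : g (h y) = y.
  by have [x <-] := surg y; apply: injh; rewrite -!fE ff.
exists r; split.
- rewrite (eq_ltrace fE) ltraceC // (eq_ltrace gh) ltrace_id /=.
  by congr (_%:R); rewrite /dim /= mul1n.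
- move=> r0 x; subst r; rewrite fE (_ : g x = 0) ?linear0_ext //.
  by apply/rowP; case.
move=> r1; subst r; exists (fun x => g x 0 0 : k^o), (h 1%:M); split.
  by move=> c x y; rewrite lg !mxE.
move=> x; rewrite fE -linearZ_ext //; congr h.
by apply/rowP => i; rewrite !mxE !ord1 mulr1.
Qed.

Lemma ltrace_idem_nat V (f : V -> V) : linear f -> (forall x, f (f x) = f x) ->
  exists r : nat, ltrace f = r%:R.
Proof. by move=> lf ff; have [r [rE _ _]] := ltrace_idem lf ff; exists r. Qed.

Lemma ltrace_nilp m V (f : V -> V) : linear f -> (forall x, iter m f x = 0) -> ltrace f = 0.
Proof.
elim: m V f => [|m IH] V f lf nf.
  have f0 x : f x = 0 := nf (f x).
  by rewrite /ltrace big1 // => i _; rewrite f0 linear0 mxE.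
have [r [g [h [lg lh fE injh surg]]]] := linear_factor lf.
rewrite (eq_ltrace fE) ltraceC //; apply: (IH _ (fun y => g (h y))) => [|y].
  by slin.
have itE j x : iter j f (h x) = h (iter j (fun y => g (h y)) x).
  by elim: j => //= j ->; rewrite fE.
apply: injh; rewrite linear0_ext // -itE; have [x <-] := surg y.
by rewrite -fE -iterSr nf.
Qed.

End Trace.

Arguments linear_sum_ext {k U W I r P f F} _.

(** * Sweedler calculus and the antipode *)

Section Sweedler.

Variable k : fieldType.
Implicit Types U V W X : vectType k.

Lemma linear_tlift U V W X (f : W -> X) (b : U -> V -> W) t :
  linear f -> f (tlift b t) = tlift (fun u v => f (b u v)) t.
Proof.
move=> lf; pose F : {linear W -> X} := HB.pack f (GRing.isLinear.Build _ _ _ _ _ lf).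
exact: (tlift_linear F).
Qed.

Lemma exchange_tlift U V U' V' W (F : U -> V -> U' -> V' -> W) s t :
  tlift (fun a b => tlift (fun a' b' => F a b a' b') t) s =
  tlift (fun a' b' => tlift (fun a b => F a b a' b') s) t.
Proof.
rewrite /tlift.
under eq_bigr => i _ do under eq_bigr => j _ do rewrite scaler_sumr;
  under eq_bigr => i _ do rewrite exchange_big.
rewrite exchange_big /=; apply: eq_bigr => i' _.
under eq_bigr => i _ do under eq_bigr => j _ do rewrite scaler_sumr;
  under eq_bigr => i _ do rewrite exchange_big.
rewrite exchange_big /=; apply: eq_bigr => j' _.
rewrite scaler_sumr; apply: eq_bigr => i _; rewrite scaler_sumr.
by apply: eq_bigr => j _; rewrite !scalerA mulrC.
Qed.

Lemma tlift_sum U V W I (r : seq I) (P : pred I) (F : I -> U -> V -> W) t :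
  tlift (fun u v => \sum_(i <- r | P i) F i u v) t = \sum_(i <- r | P i) tlift (F i) t.
Proof.
rewrite exchange_big; apply: eq_bigr => a _ /=; rewrite exchange_big.
by apply: eq_bigr => b _ /=; rewrite scaler_sumr.
Qed.

Variable H : hopfType k.
Implicit Types a b h : H.

Local Notation S := (@antipode k H).
Local Notation eps := (@counit k H).

(** [tlift] evaluates its argument on basis vectors only, so coassociativity passes to [F] through
    its linearity in each of the three places. *)
Lemma comul_assoc W (F : H -> H -> H -> W) h :
    (forall b c, linear (fun a => F a b c)) -> (forall a c, linear (fun b => F a b c)) ->
    (forall a b, linear (fun c => F a b c)) ->
  tlift (fun a b => tlift (fun a1 a2 => F a1 a2 b) (comul a)) (comul h) =
  tlift (fun a b => tlift (fun b1 b2 => F a b1 b2) (comul b)) (comul h).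
Proof.
move=> l1 l2 l3.
pose T : tensor H (tensor H H) -> W := tlift (fun a bc => tlift (F a) bc).
have lT : linear T by exact: linearP.
have bT : bilin (fun (a : H) (bc : tensor H H) => tlift (F a) bc) by sbil.
transitivity (T (tassoc (tmap comul idfun (comul h)))).
  move: (comul h); apply: tensor_extP => [||u v]; first by slin.
    by slin.
  rewrite tmapE tliftE; last by sbil.
  move: (comul u); apply: tensor_extP => [||x y]; first by slin.
    by slin.
  rewrite tassocE /T [LHS]tliftE; last by sbil.
  rewrite [RHS]tliftE; last by sbil.
  by rewrite tliftE; last by sbil.
rewrite comulA; move: (comul h); apply: tensor_extP => [||u v]; first by slin.
  by slin.
rewrite tmapE; rewrite [LHS]tliftE; last by sbil.
by rewrite tliftE; last by sbil.
Qed.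

Lemma comul_mul W (F : H -> H -> W) a b :
    (forall y, linear (F^~ y)) -> (forall x, linear (F x)) ->
  tlift F (comul (a * b)) =
  tlift (fun a1 a2 => tlift (fun b1 b2 => F (a1 * b1) (a2 * b2)) (comul b)) (comul a).
Proof.
move=> l1 l2; rewrite comulM; move: (comul a); apply: tensor_extP => [||x y].
- by rewrite /tmul; slin.
- by slin.
rewrite [RHS]tliftE; last by sbil.
move: (comul b); apply: tensor_extP => [||x' y'].
- by move=> c u v; rewrite tmulPr linearP.
- by slin.
rewrite tmulE; rewrite [LHS]tliftE; last by sbil.
by rewrite tliftE; last by sbil.
Qed.

Lemma comul_one W (F : H -> H -> W) :
  (forall y, linear (F^~ y)) -> (forall x, linear (F x)) -> tlift F (comul 1) = F 1 1.
Proof. by move=> l1 l2; rewrite comul1 tliftE. Qed.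

Lemma counitr_tlift W (F : H -> W) h :
  linear F -> tlift (fun a b => eps b *: F a) (comul h) = F h.
Proof.
move=> lF; rewrite -{2}[h]counitr linear_tlift //.
by apply: eq_tlift => a b; rewrite linearZ_ext.
Qed.

Lemma counitl_tlift W (F : H -> W) h :
  linear F -> tlift (fun a b => eps a *: F b) (comul h) = F h.
Proof.
move=> lF; rewrite -{2}[h]counitl linear_tlift //.
by apply: eq_tlift => a b; rewrite linearZ_ext.
Qed.

Lemma antipodel_tlift W (F : H -> W) h :
  linear F -> tlift (fun a b => F (S a * b)) (comul h) = eps h *: F 1.
Proof. by move=> lF; rewrite -linear_tlift // antipodel linearZ_ext. Qed.

Lemma antipoder_tlift W (F : H -> W) h :
  linear F -> tlift (fun a b => F (a * S b)) (comul h) = eps h *: F 1.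
Proof. by move=> lF; rewrite -linear_tlift // antipoder linearZ_ext. Qed.

Lemma antipode1 : S 1 = 1.
Proof.
have := antipodel (1 : H); rewrite comul_one; try by slin.
by rewrite mulr1 counit1 scale1r.
Qed.

Lemma counit_antipode h : eps (S h) = eps h.
Proof.
transitivity (eps (tlift (fun a b => S a * b) (comul h))).
  rewrite linear_tlift; last by slin.
  transitivity (tlift (fun a b => eps b *: eps (S a)) (comul h)).
    by rewrite (counitr_tlift (F := fun x => eps (S x))) //; slin.
  by apply: eq_tlift => a b; rewrite counitM scale_regC.
by rewrite antipodel linearZ /= counit1 scale_regC scale1r.
Qed.

(* Both sides equal [S (a1 b1) a2 b2 S (b3) S (a3)]. *)
Lemma antipodeM a b : S (a * b) = S b * S a.
Proof.
pose X a1 b1 a2 b2 a3 b3 := S (a1 * b1) * (a2 * b2 * S b3 * S a3).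
transitivity (tlift (fun a1 a' => tlift (fun a2 a3 => tlift (fun b1 b' =>
    tlift (fun b2 b3 => X a1 b1 a2 b2 a3 b3) (comul b')) (comul b)) (comul a')) (comul a)).
  rewrite -(counitr_tlift (F := fun x => S (x * b))); last by slin.
  apply: eq_tlift => a1 a'.
  rewrite -(counitr_tlift (F := fun y => S (a1 * y))); last by slin.
  rewrite [RHS]exchange_tlift (linear_tlift (f := fun z => eps a' *: z)); last by slin.
  apply: eq_tlift => b1 b'.
  transitivity (tlift (fun a2 a3 => (eps b' : k) *: (S (a1 * b1) * (a2 * S a3) : H)) (comul a')).
    rewrite (antipoder_tlift (F := fun y => (eps b' : k) *: (S (a1 * b1) * y : H))); last by slin.
    by rewrite mulr1.
  apply: eq_tlift => a2 a3; rewrite /X.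
  under eq_tlift => b2 b3 do rewrite -(mulrA a2).
  rewrite (antipoder_tlift (F := fun y => S (a1 * b1) * (a2 * y * S a3))); last by slin.
  by rewrite mulr1.
rewrite -comul_assoc; try by rewrite /X; slin.
transitivity (tlift (fun a' a3 => tlift (fun b' b3 => (eps (a' * b') : k) *: (S b3 * S a3 : H)) (comul b))
   (comul a)).
  apply: eq_tlift => a' a3.
  transitivity (tlift (fun a1 a2 => tlift (fun b' b3 => tlift (fun b1 b2 =>
     X a1 b1 a2 b2 a3 b3) (comul b')) (comul b)) (comul a')).
    by apply: eq_tlift => a1 a2; rewrite -comul_assoc //; rewrite /X; slin.
  rewrite exchange_tlift; apply: eq_tlift => b' b3.
  rewrite -[S b3 * S a3]mul1r.
  rewrite -(antipodel_tlift (F := fun y => y * (S b3 * S a3))); last by slin.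
  rewrite comul_mul; try by slin.
  by apply: eq_tlift => a1 a2; apply: eq_tlift => b1 b2; rewrite /X !mulrA.
rewrite -(counitl_tlift (F := fun y => S b * S y)); last by slin.
apply: eq_tlift => a1 a2.
rewrite -(counitl_tlift (F := fun y => (eps a1 : k) *: (S y * S a2 : H))); last by slin.
by apply: eq_tlift => b1 b2; rewrite counitM scalerA mulrC.
Qed.

End Sweedler.

(** * Functionals separate vectors and tensors *)

Section Separation.

Variable k : fieldType.
Implicit Types U V W : vectType k.

Lemma tensor_coord U V (t : tensor U V) i j :
  t i j = tlift (fun u v => dcoord i u * dcoord j v : k^o) t.
Proof.
rewrite /tlift (bigD1 i) //= (bigD1 j) //= !big1 ?addr0.
- rewrite !dcoordE /tbasis !r2vK !mxE !eqxx mulr1.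
  exact/esym/mulr1.
- move=> i' ni; rewrite big1 // => j' _.
  by rewrite !dcoordE /tbasis !r2vK !mxE eqxx /= [i == _]eq_sym (negPf ni) mul0r scaler0.
move=> j' nj.
by rewrite !dcoordE /tbasis !r2vK !mxE eqxx /= [j == _]eq_sym (negPf nj) mulr0 scaler0.
Qed.

(** Pairing [comul h] with [f] and [g] gives the value at [h] of the product [f * g] in the dual, so
    an identity of tensors becomes one in the algebra [hopf_dual H]. *)
Lemma tensor_sep U V (s t : tensor U V) :
    (forall (f : 'Hom(U, k^o)) (g : 'Hom(V, k^o)),
      tlift (fun u v => f u * g v : k^o) s = tlift (fun u v => f u * g v : k^o) t) ->
  s = t.
Proof. by move=> st; apply/matrixP => i j; rewrite !tensor_coord st. Qed.

Lemma hom_sep V (x y : V) : (forall f : 'Hom(V, k^o), f x = f y) -> x = y.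
Proof. by move=> xy; apply/v2r_inj/rowP => i; rewrite -!dcoordE xy. Qed.

Definition mk_hom V W (f : V -> W) (lf : linear f) : 'Hom(V, W) :=
  linfun (HB.pack f (GRing.isLinear.Build _ _ _ _ _ lf) : {linear V -> W}).

Lemma mk_homE V W (f : V -> W) (lf : linear f) x : mk_hom lf x = f x.
Proof. by rewrite /mk_hom lfunE. Qed.

Lemma hom_of V W (f : V -> W) : linear f -> exists F : 'Hom(V, W), F =1 f.
Proof. by move=> lf; exists (mk_hom lf) => x; rewrite mk_homE. Qed.

End Separation.

(** * The actions of the dual on a Hopf algebra, and group-like elements *)

Section HopfBasics.

Variables (k : fieldType) (H : hopfType k).
Implicit Types a b h : H.
Implicit Types f g : hopf_dual H.

Local Notation S := (@antipode k H).
Local Notation eps := (@counit k H).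
Local Notation ev f := (f : 'Hom(H, k^o)).

Lemma evM f g h : ev (f * g) h = tlift (fun a b => ev f a * ev g b : k^o) (comul h).
Proof. exact: dual_mulE. Qed.

Lemma ev1 h : ev (1 : hopf_dual H) h = eps h.
Proof. exact: dual_oneE. Qed.

(** This is [antipodeM] for the Hopf algebra [hopf_dual H], paired with [h]. *)
Lemma comul_antipode h : comul (S h) = tlift (fun a b => S b ⊗ S a) (comul h).
Proof.
apply: tensor_sep => f g.
have := congr1 (fun l => ev l h) (antipodeM (f : hopf_dual H) (g : hopf_dual H)).
rewrite /= dual_antipodeE evM => ->; rewrite evM.
rewrite linear_tlift; last by slin.
apply: eq_tlift => a b; rewrite tliftE; last by sbil.
by rewrite !dual_antipodeE mulrC.
Qed.

Lemma antipode_tlift (W : vectType k) (F : H -> H -> W) h :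
    (forall y, linear (F^~ y)) -> (forall x, linear (F x)) ->
  tlift F (comul (S h)) = tlift (fun a b => F (S b) (S a)) (comul h).
Proof.
move=> l1 l2; rewrite comul_antipode linear_tlift; last by slin.
by apply: eq_tlift => a b; rewrite tliftE.
Qed.

(** [rop f] and [lop f] are the transposes of left and right multiplication by [f] in [H^*], see
    [ev_rop] and [ev_lop]. The rank of [rop f] is thus the dimension of the right ideal [f H^*]. *)
Definition rop f h : H := tlift (fun a b => (ev f a : k) *: b) (comul h).
Definition lop f h : H := tlift (fun a b => (ev f b : k) *: a) (comul h).

Lemma rop_linear f : linear (rop f). Proof. by rewrite /rop; slin. Qed.
Lemma lop_linear f : linear (lop f). Proof. by rewrite /lop; slin. Qed.

Lemma ropM f g h : rop (f * g) h = rop g (rop f h).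
Proof.
rewrite /rop.
transitivity (tlift (fun a b => tlift (fun a1 a2 => (ev f a1 * ev g a2 : k) *: b) (comul a)) (comul h)).
  by apply: eq_tlift => a b; rewrite evM (linear_tlift (f := fun z : k^o => z *: b)) //; slin.
rewrite (comul_assoc (F := fun a b c => (ev f a * ev g b : k) *: c)) //; try by slin.
rewrite (linear_tlift (f := fun x => tlift _ (comul x))); last by slin.
apply: eq_tlift => a b; rewrite linearZ /= linearZ /=.
rewrite (linear_tlift (f := fun x => (ev f a : k) *: x)); last by slin.
by apply: eq_tlift => b1 b2; rewrite scalerA.
Qed.

Lemma lopM f g h : lop (f * g) h = lop f (lop g h).
Proof.
rewrite /lop.
transitivity (tlift (fun a b => tlift (fun b1 b2 => (ev f b1 * ev g b2 : k) *: a) (comul b)) (comul h)).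
  by apply: eq_tlift => a b; rewrite evM (linear_tlift (f := fun z : k^o => z *: a)) //; slin.
rewrite -(comul_assoc (F := fun a b c => (ev f b * ev g c : k) *: a)) //; try by slin.
rewrite (linear_tlift (f := fun x => tlift _ (comul x))); last by slin.
apply: eq_tlift => a b; rewrite linearZ /= linearZ /=.
rewrite (linear_tlift (f := fun x => (ev g b : k) *: x)); last by slin.
by apply: eq_tlift => b1 b2; rewrite scalerA mulrC.
Qed.

Lemma rop1 h : rop 1 h = h.
Proof. by rewrite -[RHS]counitl; apply: eq_tlift => a b; rewrite ev1. Qed.

Lemma ev_rop f g h : ev g (rop f h) = ev (f * g) h.
Proof.
rewrite evM /rop (linear_tlift (f := ev g)); last by slin.
by apply: eq_tlift => a b; rewrite linearZ.
Qed.

Lemma ev_lop f g h : ev f (lop g h) = ev (f * g) h.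
Proof.
rewrite evM /lop (linear_tlift (f := ev f)); last by slin.
by apply: eq_tlift => a b; rewrite linearZ /= [RHS]mulrC.
Qed.

Lemma ropD f g h : rop (f + g) h = rop f h + rop g h.
Proof.
have := tliftP 1 (fun a b : H => (ev f a : k) *: b) (fun a b => (ev g a : k) *: b) (comul h).
rewrite !scale1r => <-; apply: eq_tlift => a b.
by rewrite scale1r add_lfunE scalerDl.
Qed.

Lemma ropZ c f h : rop (c *: f) h = c *: rop f h.
Proof.
rewrite /rop (linear_tlift (f := fun x => c *: x)); last by slin.
by apply: eq_tlift => a b; rewrite scale_lfunE scalerA.
Qed.

Lemma ev_sum I (r : seq I) (P : pred I) (F : I -> hopf_dual H) h :
  ev (\sum_(i <- r | P i) F i) h = \sum_(i <- r | P i) ev (F i) h.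
Proof.
apply: (big_morph (fun f : hopf_dual H => ev f h)) => [f g|]; first exact: add_lfunE.
exact: zero_lfunE.
Qed.

Lemma rop_sum I (r : seq I) (P : pred I) (F : I -> hopf_dual H) h :
  rop (\sum_(i <- r | P i) F i) h = \sum_(i <- r | P i) rop (F i) h.
Proof.
rewrite /rop -tlift_sum; apply: eq_tlift => a b.
by rewrite -scaler_suml ev_sum.
Qed.

Lemma grouplikeP (g : H) : reflect (comul g = g ⊗ g /\ eps g = 1) (grouplike g).
Proof. by apply: (iffP andP) => [[/eqP ? /eqP ?]|[-> ->]]. Qed.

Lemma grouplike1 : grouplike (1 : H).
Proof. by apply/grouplikeP; rewrite comul1 counit1. Qed.

Lemma grouplikeM a b : grouplike a -> grouplike b -> grouplike (a * b).
Proof.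
move=> /grouplikeP [ca ea] /grouplikeP [cb eb]; apply/grouplikeP.
by rewrite comulM ca cb tmulE counitM ea eb mulr1.
Qed.

Lemma grouplikeS a : grouplike a -> grouplike (S a).
Proof.
move=> /grouplikeP [ca ea]; apply/grouplikeP.
rewrite comul_antipode ca tliftE; last by sbil.
by rewrite counit_antipode.
Qed.

Lemma grouplike_tlift (W : vectType k) (F : H -> H -> W) a :
    (forall y, linear (F^~ y)) -> (forall x, linear (F x)) -> grouplike a ->
  tlift F (comul a) = F a a.
Proof. by move=> l1 l2 /grouplikeP [-> _]; rewrite tliftE. Qed.

Lemma grouplike_mulVr a : grouplike a -> S a * a = 1.
Proof.
move=> ga; have := antipodel a; rewrite grouplike_tlift //; try by slin.
by case/grouplikeP: ga => _ ->; rewrite scale1r.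
Qed.

Lemma grouplike_mulrV a : grouplike a -> a * S a = 1.
Proof.
move=> ga; have := antipoder a; rewrite grouplike_tlift //; try by slin.
by case/grouplikeP: ga => _ ->; rewrite scale1r.
Qed.

Lemma grouplike_rop f a : grouplike a -> rop f a = (ev f a : k) *: a.
Proof. by move=> ga; rewrite /rop grouplike_tlift //; slin. Qed.

(** Dedekind's independence argument: [rop f] acts on a group-like [g] by the scalar [f g], so
    subtracting [f (iota j0)] times the relation from its image under [rop f] removes the term of
    [j0] and multiplies every other coefficient by [f (iota i) - f (iota j0)]. For each [i] some [f]
    makes this factor nonzero. *)
Lemma grouplike_free (J : eqType) (r : seq J) (iota : J -> H) (c : J -> k) :
    uniq r -> {in r &, injective iota} -> {in r, forall j, grouplike (iota j)} ->
    \sum_(j <- r) c j *: iota j = 0 -> {in r, forall j, c j = 0}.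
Proof.
elim: r c => // j0 r IH c /= /andP [j0r ur] inj gl; rewrite big_cons => s0.
have sub : {subset r <= j0 :: r} by move=> j jr; rewrite inE jr orbT.
have rest : {in r, forall j, c j = 0}.
  move=> j jr.
  have nj : iota j != iota j0.
    apply: contra j0r => /eqP /(inj _ _ (sub _ jr) (mem_head _ _)) <-; exact: jr.
  apply/eqP; apply: contraNT nj => cj; apply/eqP/hom_sep => f.
  pose c' i := c i * (f (iota i) - f (iota j0)).
  have : c' j = 0.
    apply: IH jr => //; first by move=> x y /sub xr /sub yr; exact: inj.
      by move=> x /sub xr; exact: gl.
    have := congr1 (rop f) s0.
    rewrite (linear0_ext (rop_linear (f : hopf_dual H))).
    rewrite (linearD_ext (rop_linear (f : hopf_dual H))).
    rewrite (linear_sum_ext (rop_linear (f : hopf_dual H))).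
    rewrite (linearZ_ext (rop_linear (f : hopf_dual H))).
    rewrite grouplike_rop; last by apply: gl; rewrite mem_head.
    move=> s1; have := congr1 (fun x => (f (iota j0) : k) *: x) s0.
    rewrite scaler0 scalerDr -[X in _ = X]s1 !scalerA [_ * c j0]mulrC => /addrI s2.
    rewrite /c'.
    transitivity (\sum_(i <- r) rop f (c i *: iota i) - (f (iota j0) : k) *: \sum_(i <- r) c i *: iota i).
      rewrite scaler_sumr -sumrB !big_seq; apply: eq_bigr => i ir.
      rewrite (linearZ_ext (rop_linear (f : hopf_dual H))).
      rewrite grouplike_rop ?scalerA; last by apply/gl/sub.
      by rewrite -scalerBl mulrBr [f (iota j0) * _]mulrC.
    by rewrite s2 subrr.
  by move/eqP; rewrite mulf_eq0 (negPf cj) /= subr_eq0 => /eqP.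
move=> j; rewrite inE => /predU1P [->|/rest //].
move: s0; rewrite big_seq big1 ?addr0 => [s0|i ir]; last by rewrite rest ?scale0r.
have := congr1 eps s0; rewrite linearZ linear0 /=.
by case/grouplikeP: (gl _ (mem_head _ _)) => _ ->; rewrite scale_regC scale1r.
Qed.

(** The powers are group-like, and more than [dim H] distinct group-like elements cannot be
    independent. *)
Lemma grouplike_finite_order a : grouplike a -> exists2 N, (0 < N)%N & a ^+ N = 1.
Proof.
move=> ga; have gX i : grouplike (a ^+ i).
  by elim: i => [|i IH]; rewrite ?grouplike1 // exprS grouplikeM.
have [inj|] := boolP (injectiveb (fun i : 'I_(dim H).+1 => a ^+ i)).
  exfalso; pose M : 'M[k]_((dim H).+1, dim H) := \matrix_i v2r (a ^+ i).
  have : ~~ row_free M by rewrite /row_free neq_ltn ltnS rank_leq_col.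
  rewrite -kermx_eq0 => /rowV0Pn [v /sub_kermxP vM v0]; case/negP: v0.
  apply/eqP/rowP => i; rewrite mxE.
  apply: (@grouplike_free _ (index_enum _) (fun i : 'I_(dim H).+1 => a ^+ i) (v 0)) => //.
  - exact: index_enum_uniq.
  - by move=> x y _ _; exact: (injectiveP _ inj).
  - apply: v2r_inj; rewrite linear0 -vM linear_sum mulmx_sum_row; apply: eq_bigr => j _.
    by rewrite linearZ rowK.
case/injectivePn => i [j ij eij].
wlog lt_ij : i j ij eij / (i < j)%N.
  by move=> WL; case: (ltngtP i j) => [|ji|/val_inj e]; [apply: WL|apply: (WL j i); rewrite // eq_sym|
    rewrite e eqxx in ij].
exists (j - i)%N; first by rewrite subn_gt0.
rewrite -[LHS]mul1r -(grouplike_mulVr (gX i)) -mulrA -exprD subnKC 1?ltnW // -eij.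
by rewrite grouplike_mulVr.
Qed.

End HopfBasics.

(** * Semisimple algebras through primitive idempotents *)

Definition simple_idempotents (k : fieldType) (E : falgType k) N (e : 'I_N -> E) : Prop :=
  [/\ \sum_i e i = 1, forall i j, e i * e j = if i == j then e i else 0, forall i, e i != 0
    & forall i z, z * e i = z -> z != 0 -> exists y, y * z = e i].

(** The [e i] are the components of 1 along the simple left ideals [I i]. Multiplying 1 by [x] in
    [I i] and comparing components gives [x * e i = x] and [x * e j = 0] for [j != i], so [e i]
    generates [I i]; the last clause of [simple_idempotents] is the simplicity of [I i]. *)
Lemma semisimple_idempotents (k : fieldType) (E : falgType k) :
  semisimple_algebra E -> exists N (e : 'I_N -> E), simple_idempotents e.
Proof.
case=> N [I [simI dirI sumI]]; have: (1 : E) \in (\sum_i I i)%VS by rewrite sumI memvf.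
case/memv_sumP => v vI sumv; exists N, v.
have idl i x y : y \in I i -> x * y \in I i.
  case: (simI i) => /prodvP h _ _ yI; apply: h => //; exact: memvf.
have key i x : x \in I i -> forall j, x * v j = if j == i then x else 0.
  move=> xI; have /directv_sum_unique uniqI := dirI.
  have usI j : true -> x * v j \in I j by move=> _; exact/idl/vI.
  have vsI j : true -> (if j == i then x else 0) \in I j.
    by move=> _; case: eqP => [->|_]; rewrite ?mem0v.
  have := uniqI _ _ usI vsI.
  rewrite -mulr_sumr -sumv mulr1 -big_mkcond big_pred1_eq eqxx => /esym/forallP h j.
  exact/eqP/h.
have v0 i : v i != 0.
  case: (simI i) => _ nz _; apply: contra nz => /eqP vi; rewrite -subv0.
  by apply/subvP => x /key /(_ i); rewrite eqxx vi mulr0 => <-; rewrite mem0v.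
split=> [||//|i z zi z0]; first by rewrite sumv.
  by move=> i j; rewrite (key i) ?vI // eq_sym.
have zI : z \in I i by rewrite -zi idl ?vI.
pose J := (amulr z @: fullv)%VS.
have zJ x : x * z \in J by apply/memv_imgP; exists x; rewrite ?memvf // lfunE.
case: (simI i) => _ _ /(_ J) [||J0|JI].
- apply/prodvP => x y _ /memv_imgP [t _ ->]; rewrite lfunE /= mulrA; exact: zJ.
- by apply/subvP => y /memv_imgP [t _ ->]; rewrite lfunE /= idl.
- by case/eqP: z0; apply/eqP; rewrite -memv0 -J0 -[z]mul1r zJ.
have : v i \in J by rewrite JI vI.
by case/memv_imgP => y _ ->; exists y; rewrite lfunE.
Qed.

Definition regular_trace (k : fieldType) (E : falgType k) (x : E) : k^o :=
  ltrace (fun y : E => x * y).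

Section SimpleIdempotents.

Variables (k : closedFieldType) (E : falgType k) (N : nat) (e : 'I_N -> E).
Hypothesis char_k : [pchar k] =i pred0.
Hypothesis e_simple : simple_idempotents e.

Local Notation tau := (@regular_trace k E).

Let esum : \sum_i e i = 1. Proof. by case: e_simple. Qed.
Let eO i j : e i * e j = if i == j then e i else 0. Proof. by case: e_simple. Qed.
Let e0 i : e i != 0. Proof. by case: e_simple. Qed.
Let esimp i z : z * e i = z -> z != 0 -> exists y, y * z = e i.
Proof. by case: e_simple => _ _ _; apply. Qed.
Let ee i : e i * e i = e i. Proof. by rewrite eO eqxx. Qed.

Lemma closed_eigenvector (V : vectType k) (f : V -> V) : linear f -> (exists v : V, v != 0) ->
  exists mu v, v != 0 /\ f v = mu *: v.
Proof.
move=> lf [v0 nz0].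
pose fL : {linear V -> V} := HB.pack f (GRing.isLinear.Build _ _ _ _ _ lf).
pose M : 'M[k]_(dim V) := lin1_mx (v2r \o fL \o r2v).
have dimpos : (0 < dim V)%N.
  rewrite lt0n; apply: contra nz0 => /eqP d0; apply/eqP/v2r_inj/rowP => i.
  by have := ltn_ord i; rewrite {2}d0.
have /closed_rootP [mu] : size (char_poly M) != 1%N by rewrite size_char_poly eqSS -lt0n.
rewrite -eigenvalue_root_char => /eigenvalueP [w wM w0].
exists mu, (r2v w); split; first by apply: contra w0 => /eqP /(congr1 v2r); rewrite r2vK linear0 => ->.
by apply: v2r_inj; rewrite linearZ /= r2vK -wM mul_rV_lin1.
Qed.

(** Schur's lemma for the left ideal [E e_i], which [linear_factor] presents as a space of row
    vectors. Right multiplication by the corner element [y] has an eigenvector there; if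
    [y - mu *: e i] were nonzero, it would be invertible in the corner and yet kill that
    eigenvector. *)
Lemma corner_scalar i x : exists mu, e i * x * e i = mu *: e i.
Proof.
set y := e i * x * e i.
have yi : y * e i = y by rewrite /y -!mulrA ee.
have iy : e i * y = y by rewrite /y !mulrA ee.
have lf : linear (fun v : E => v * e i) by slin.
have [r [g [h [lg lh fE injh surg]]]] := linear_factor lf.
have gh v : g (h v) = v.
  by have [u <-] := surg v; apply: injh; rewrite -!fE -mulrA ee.
have hi v : h v * e i = h v by rewrite fE gh.
have [||mu [v [v0 hv]]] := @closed_eigenvector _ (fun v => g (h v * y)); first by slin.
  exists (g (e i)); apply: contra (e0 i) => /eqP gi.
  by rewrite -[e i]ee fE gi linear0_ext.
exists mu; apply/eqP; rewrite -subr_eq0; apply: contraT => nz; case/negP: v0; apply/eqP.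
set z := y - mu *: e i in nz.
have zi : z * e i = z by rewrite mulrBl yi -scalerAl ee.
have iz : e i * z = z by rewrite mulrBr iy -scalerAr ee.
have [w wz] := esimp zi nz.
pose w' := e i * w * e i.
have w'z : w' * z = e i by rewrite /w' -!mulrA iz wz ee.
have w'i : w' * e i = w' by rewrite /w' -!mulrA ee.
have iw' : e i * w' = w' by rewrite /w' !mulrA ee.
have w'0 : w' != 0 by apply: contra (e0 i) => /eqP w0; rewrite -w'z w0 mul0r.
have [u uw] := esimp w'i w'0.
have zw : z * w' = e i.
  have -> : z = u * e i by rewrite -w'z mulrA uw iz.
  by rewrite -mulrA iw'.
have hvz : h v * z = 0.
  rewrite mulrBr -scalerAr hi -linearZ_ext // -hv -fE -mulrA yi.
  by rewrite subrr.
by apply: injh; rewrite linear0_ext // -hi -zw mulrA hvz mul0r.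
Qed.

Lemma corner_inverse i j z : e i * z = z -> z * e j = z -> z != 0 ->
  exists w, [/\ e j * w = w, w * e i = w, w * z = e j & z * w = e i].
Proof.
move=> iz zj z0; have [y yz] := esimp zj z0.
pose w := e j * y * e i.
have wz : w * z = e j by rewrite /w -!mulrA iz yz ee.
have jw : e j * w = w by rewrite /w !mulrA ee.
have wi : w * e i = w by rewrite /w -!mulrA ee.
exists w; split=> //.
have [mu] := corner_scalar i (z * w); rewrite mulrA iz -mulrA wi => zw.
have zwz : z * w * z = z by rewrite -mulrA wz zj.
rewrite zw; suff -> : mu = 1 by rewrite scale1r.
apply/eqP; rewrite -subr_eq0; apply: contraNT z0 => nmu.
have : (mu - 1) *: z = 0 by rewrite scalerBl scale1r -{2}zwz zw -scalerAl iz subrr.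
by move/eqP; rewrite scaler_eq0 (negPf nmu).
Qed.

(* The simple modules [E e_i] and [E e_j] are isomorphic. *)
Definition linked (i j : 'I_N) := [exists a, e i * tbasis a * e j != 0].

Lemma linkedPn i j : ~~ linked i j -> forall x, e i * x * e j = 0.
Proof.
move=> /existsPn h x; rewrite [x]tbasis_sum mulr_sumr mulr_suml big1 // => a _.
by rewrite -scalerAr -scalerAl; have := h a; rewrite negbK => /eqP ->; rewrite scaler0.
Qed.

Lemma linkedI i j x : e i * x * e j != 0 -> linked i j.
Proof. by apply: contraR => /linkedPn ->. Qed.

Lemma linkedP i j : linked i j -> exists z w,
  [/\ e i * z = z, z * e j = z, e j * w = w, w * e i = w & w * z = e j /\ z * w = e i].
Proof.
case/existsP=> a nz; pose z := e i * tbasis a * e j.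
have iz : e i * z = z by rewrite /z !mulrA ee.
have zj : z * e j = z by rewrite /z -!mulrA ee.
by have [w [? ? ? ?]] := corner_inverse iz zj nz; exists z, w.
Qed.

Lemma linked_refl i : linked i i.
Proof. by apply: (@linkedI i i 1); rewrite mulr1 ee. Qed.

Lemma linked_sym i j : linked i j = linked j i.
Proof.
suff H a b : linked a b -> linked b a by apply/idP/idP; apply: H.
case/linkedP => z [w [_ _ bw wa [wz _]]]; apply: (@linkedI b a w); rewrite bw wa.
by apply: contra (e0 b) => /eqP w0; rewrite -wz w0 mul0r.
Qed.

Lemma linked_trans i j l : linked i j -> linked j l -> linked i l.
Proof.
case/linkedP => z [w [iz zj jw wi [wz _]]] /linkedP [z' [w' [jz' zl' lw' wj' [wz' zw']]]].
apply: (@linkedI i l (z * z')); rewrite mulrA iz -mulrA zl'.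
apply: contra (e0 j) => /eqP zz; rewrite -zw' -[z']jz' -wz -!mulrA [z * (_ * _)]mulrA zz.
by rewrite mul0r mulr0.
Qed.

Lemma linked_eq i j l : linked i j -> linked i l = linked j l.
Proof.
move=> ij; apply/idP/idP; last exact: linked_trans.
by apply: linked_trans; rewrite linked_sym.
Qed.

Lemma corner_rank1 i j x z : e i * x * e j = x -> z != 0 -> e i * z = z -> z * e j = z ->
  exists mu, x = mu *: z.
Proof.
move=> xE z0 iz zj; have [w [jw wi wz zw]] := corner_inverse iz zj z0.
have [mu muE] := corner_scalar i (x * w); exists mu.
have ix : e i * x = x by rewrite -xE !mulrA ee.
have xj : x * e j = x by rewrite -xE -!mulrA ee.
by rewrite -[in RHS]iz scalerAl -muE mulrA ix -!mulrA [e i * z]iz wz xj.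
Qed.

(** The Peirce component [e_i E e_j] is a line when [i] and [j] are linked and zero otherwise; the
    trace of the projection onto it is its dimension. *)
Lemma ltrace_corner i j : ltrace (fun x : E => e i * x * e j) = (linked i j)%:R.
Proof.
have [|nl] := boolP (linked i j); last first.
  by rewrite (eq_ltrace (linkedPn nl)) ltrace0.
case/linkedP => z [w [iz zj jw wi [wz zw]]].
have z0 : z != 0 by apply: contra (e0 i) => /eqP z0; rewrite -zw z0 mul0r.
have [a aP] : exists a, v2r z 0 a != 0.
  apply/existsP; apply: contraR z0 => /existsPn h; apply/eqP/v2r_inj/rowP => a.
  by rewrite linear0 mxE; apply/eqP; rewrite -[_ == _]negbK h.
pose phi (x : E) : k^o := v2r (e i * x * e j) 0 a / v2r z 0 a.
have lphi : linear phi.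
  move=> c x y; rewrite /phi mulrDr mulrDl linearD !mxE -scalerAr -scalerAl linearZ /= !mxE.
  by rewrite mulrDl -[in LHS]mulrA.
rewrite (eq_ltrace (g := fun x => phi x *: z)) => [|x].
  by rewrite ltrace_rank1 // /phi iz zj divff.
have xE : e i * (e i * x * e j) * e j = e i * x * e j by rewrite !mulrA ee -!mulrA ee.
have [mu muE] := corner_rank1 xE z0 iz zj.
by rewrite /phi muE linearZ mxE mulfK.
Qed.

(** The scalar of [corner_scalar]: left multiplication by [e i * x * e i] on the line [e_i E e_i]
    has that scalar as its trace, which gives a closed formula for it. *)
Definition lam i (x : E) : k^o := ltrace (fun y : E => e i * x * e i * y * e i).

Lemma lamE i x : e i * x * e i = (lam i x : k) *: e i.
Proof.
have [mu muE] := corner_scalar i x; rewrite {1}muE; congr (_ *: _).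
rewrite /lam (eq_ltrace (g := fun y => mu *: (e i * y * e i))) => [|y].
  by rewrite ltraceZ ltrace_corner linked_refl mulr1.
by rewrite muE -!scalerAl.
Qed.

Lemma scale_e_inj i (a b : k) : a *: e i = b *: e i -> a = b.
Proof.
move/eqP; rewrite -subr_eq0 -scalerBl scaler_eq0 (negPf (e0 i)) orbF subr_eq0.
by move/eqP.
Qed.

Lemma lam_uniq i x mu : e i * x * e i = mu *: e i -> lam i x = mu.
Proof. by rewrite lamE => /scale_e_inj. Qed.

Lemma lam_linear i : linear (lam i).
Proof.
move=> c x y; apply: (@lam_uniq i).
by rewrite mulrDr mulrDl -scalerAr -scalerAl !lamE scalerDl scalerA.
Qed.

Lemma lam_e i j : lam i (e j) = (i == j)%:R.
Proof.
apply: lam_uniq; rewrite eO; case: eqP => _; last by rewrite mul0r scale0r.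
by rewrite ee scale1r.
Qed.

(* Peirce decomposition of the bimodule operator [y |-> x y b]. *)
Lemma ltrace_LR x b : ltrace (fun y : E => x * y * b) =
  \sum_j \sum_(i | linked i j) lam i x * lam j b.
Proof.
transitivity (\sum_j \sum_i ltrace (fun y : E => e i * (x * y * b) * e j)).
  under eq_bigr do rewrite -ltrace_sum; rewrite -ltrace_sum; apply: eq_ltrace => y.
  under eq_bigr => j _ do rewrite -mulr_suml -mulr_suml esum mul1r.
  by rewrite -mulr_sumr esum mulr1.
apply: eq_bigr => j _; rewrite [RHS]big_mkcond /=; apply: eq_bigr => i _.
transitivity (ltrace (fun y : E => (e i * x * e i) * y * (e j * b * e j))).
  transitivity (ltrace (fun y : E => e i * (x * (e i * y * e j) * b) * e j)).
    pose F (y : E) : E := e i * (x * y * b) * e j; pose G (y : E) : E := e i * y * e j.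
    rewrite -/(ltrace (fun y => F (G y))) (@ltraceC _ _ _ F G); try by rewrite /F /G; slin.
    by apply: eq_ltrace => y; rewrite /F /G !mulrA ee -!mulrA ee.
  by apply: eq_ltrace => y; rewrite !mulrA.
transitivity (ltrace (fun y : E => (lam i x * lam j b : k) *: (e i * y * e j))).
  by apply: eq_ltrace => y; rewrite !lamE -!scalerAl -scalerAr scalerA.
by rewrite ltraceZ ltrace_corner; case: linked; rewrite ?mulr1 ?mulr0.
Qed.

(* The character of the simple module [E e_i]. *)
Definition chi i (x : E) : k^o := ltrace (fun y : E => x * y * e i).

Lemma chi_lam i x : chi i x = \sum_(j | linked j i) lam j x.
Proof.
rewrite /chi ltrace_LR (bigD1 i) //= [X in _ + X]big1 => [|j nj].
  by rewrite addr0; apply: eq_bigr => j _; rewrite lam_e eqxx mulr1.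
by apply: big1 => l _; rewrite lam_e (negPf nj) mulr0.
Qed.

Lemma chi_linear i : linear (chi i).
Proof.
move=> c x y; rewrite !chi_lam scaler_sumr -big_split /=.
by apply: eq_bigr => j _; rewrite lam_linear.
Qed.

Lemma ltrace_LR_chi x b : ltrace (fun y : E => x * y * b) = \sum_j lam j b * chi j x.
Proof.
rewrite ltrace_LR; apply: eq_bigr => j _; rewrite chi_lam mulr_sumr.
by apply: eq_bigr => i _; rewrite mulrC.
Qed.

Lemma chi_linked i j x : linked i j -> chi i x = chi j x.
Proof.
by move=> ij; rewrite !chi_lam; apply: eq_bigl => l; rewrite !(linked_sym l) (linked_eq _ ij).
Qed.

Lemma chi_mulC i x y : chi i (x * y) = chi i (y * x).
Proof.
pose F (z : E) : E := x * z; pose G (z : E) : E := y * z * e i.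
transitivity (ltrace (fun z => F (G z))); first by apply: eq_ltrace => z; rewrite /F /G !mulrA.
rewrite ltraceC; try by rewrite /F /G; slin.
by apply: eq_ltrace => z; rewrite /F /G !mulrA.
Qed.

Lemma chi_one i : chi i 1 = #|[pred j | linked j i]|%:R.
Proof.
rewrite chi_lam -[RHS]mulr1 mulr_natl -sumr_const; apply: eq_bigr => j _.
by apply: lam_uniq; rewrite mulr1 ee scale1r.
Qed.

(** The choice made by [pick] depends only on the linkage class, so linked indices share their
    representative; the default [i] is never reached, as [linked] is reflexive. Sums over [is_crep]
    are sums over the irreducible characters. *)
Definition crep i := odflt i [pick j | linked j i].
Definition is_crep i := crep i == i.

Lemma crep_linked i : linked (crep i) i.
Proof. by rewrite /crep; case: pickP => //= _; exact: linked_refl. Qed.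

Lemma crep_eq i j : linked i j -> crep i = crep j.
Proof.
move=> ij; have eqp : [pred l | linked l i] =1 [pred l | linked l j].
  by move=> l; rewrite /= !(linked_sym l) (linked_eq _ ij).
rewrite /crep (eq_pick eqp); case: pickP => //= h.
by have := h j; rewrite /= linked_refl.
Qed.

Lemma is_crep_crep i : is_crep (crep i).
Proof. by rewrite /is_crep (crep_eq (crep_linked i)). Qed.

Lemma crep_linkedE i c : is_crep c -> linked i c = (crep i == c).
Proof.
move=> /eqP cc; apply/idP/eqP => [/crep_eq -> //|<-].
by rewrite linked_sym crep_linked.
Qed.

Lemma sum_crep (F : 'I_N -> k) :
  \sum_i F i = \sum_(c | is_crep c) \sum_(i | linked i c) F i.
Proof.
rewrite (partition_big crep is_crep) => [|i _]; last exact: is_crep_crep.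
by apply: eq_bigr => c Rc; apply: eq_bigl => i; rewrite crep_linkedE.
Qed.

(** As a bimodule, [E] is the sum over the irreducible modules [V] of the tensor product of [V] with
    its dual. *)
Lemma ltrace_LR_crep x b : ltrace (fun y : E => x * y * b) = \sum_(c | is_crep c) chi c x * chi c b.
Proof.
rewrite ltrace_LR_chi sum_crep; apply: eq_bigr => c Rc.
rewrite [in RHS](chi_lam c b) mulr_sumr; apply: eq_bigr => i ic.
by rewrite mulrC (chi_linked _ ic).
Qed.

(** A trace form takes equal values on linked idempotents, since these are [z * w] and [w * z]; its
    values on the [e c] therefore determine it. *)
Lemma trace_form_chi (f : E -> k^o) : linear f -> (forall x y, f (x * y) = f (y * x)) ->
  forall x, f x = \sum_(c | is_crep c) (f (e c) : k) * chi c x.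
Proof.
move=> lf fC x.
have fe i j : linked i j -> f (e i) = f (e j).
  by case/linkedP => z [w [_ _ _ _ [<- <-]]]; rewrite fC.
transitivity (\sum_i (lam i x : k) * f (e i)).
  rewrite -{1}[x]mulr1 -esum mulr_sumr (linear_sum_ext lf); apply: eq_bigr => i _.
  by rewrite -{1}[e i]ee mulrA fC mulrA lamE linearZ_ext.
rewrite sum_crep; apply: eq_bigr => c Rc; rewrite chi_lam mulr_sumr.
by apply: eq_bigr => i /fe ->; rewrite mulrC.
Qed.

Lemma tau_chi x : tau x = \sum_i chi i x.
Proof.
rewrite /regular_trace (eq_ltrace (g := fun y => x * y * 1)) => [|y]; last by rewrite mulr1.
rewrite ltrace_LR_chi; apply: eq_bigr => i _; rewrite (@lam_uniq i 1 1) ?mul1r //.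
by rewrite mulr1 ee scale1r.
Qed.

Lemma tau_mulC x y : tau (x * y) = tau (y * x).
Proof. by rewrite !tau_chi; apply: eq_bigr => i _; rewrite chi_mulC. Qed.

Lemma tau_linear : linear tau.
Proof.
move=> c x y; rewrite !tau_chi scaler_sumr -big_split /=.
by apply: eq_bigr => j _; rewrite chi_linear.
Qed.

Lemma natr_neq0 n : (0 < n)%N -> n%:R != 0 :> k.
Proof. by move=> n0; have /pcharf0P -> := char_k; rewrite -lt0n. Qed.

Lemma tau_e_neq0 i : tau (e i) != 0.
Proof.
rewrite tau_chi (eq_bigr (fun j => (linked i j)%:R)) => [|j _].
  rewrite -natr_sum natr_neq0 // lt0n sum_nat_eq0; apply/forallPn; exists i.
  by rewrite linked_refl.
rewrite chi_lam big_mkcond (bigD1 i) //= big1 ?addr0 => [|l nl].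
  by rewrite lam_e eqxx; case: linked.
by rewrite lam_e (negPf nl); case: linked.
Qed.

(** If [x != 0], some component [z] of [x] in [e_i E e_j] is nonzero and has a [w] with
    [z * w = e i]; the trace of [e i] is a positive integer. *)
Lemma tau_nondeg x : (forall y, tau (x * y) = 0) -> x = 0.
Proof.
move=> h; apply/eqP; apply: contraT => x0.
have [i [j nz]] : exists i j, e i * x * e j != 0.
  suff /existsP [i /existsP [j nz]] : [exists i, exists j, e i * x * e j != 0] by exists i, j.
  apply: contraR x0 => /existsPn n; rewrite -[x]mul1r -[1 * x]mulr1 -esum mulr_sumr big1 // => j _.
  rewrite -!mulrA mulr_suml big1 // => i _; rewrite mulrA.
  by have /existsPn /(_ j) := n i; rewrite negbK => /eqP.
set z := e i * x * e j in nz.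
have iz : e i * z = z by rewrite /z !mulrA ee.
have zj : z * e j = z by rewrite /z -!mulrA ee.
have [w [jw wi wz zw]] := corner_inverse iz zj nz.
case/negP: (tau_e_neq0 i); rewrite -zw; apply/eqP.
by rewrite /z -!mulrA tau_mulC -!mulrA h.
Qed.

Lemma lam_centralE i z : (forall x, z * x = x * z) -> z * e i = (lam i z : k) *: e i.
Proof. by move=> zC; rewrite -lamE -zC -mulrA ee. Qed.

Lemma lam_central i j z : (forall x, z * x = x * z) -> linked i j -> lam i z = lam j z.
Proof.
move=> zC; case/linkedP => u [v [iu uj jv _ [vu uv]]]; apply: (@scale_e_inj i).
rewrite -lam_centralE // -uv mulrA zC -mulrA -{1}jv [z * _]mulrA lam_centralE //.
by rewrite -scalerAl jv -scalerAr.
Qed.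

End SimpleIdempotents.

(** * Bijectivity by dimension, and traces computed from a tensor *)

Section LinearBijection.

Variable k : fieldType.
Implicit Types U V : vectType k.

Lemma linear_inj_surj U V (f : U -> V) : linear f -> injective f -> dim U = dim V ->
  forall y, exists x, f x = y.
Proof.
move=> lf injf dUV y.
pose F : 'Hom(U, V) := linfun (HB.pack f (GRing.isLinear.Build _ _ _ _ _ lf) : {linear U -> V}).
have FE x : F x = f x by rewrite lfunE.
have kerF : lker F = 0%VS by apply/eqP/lker0P => u v; rewrite !FE; exact: injf.
have imF : limg F = fullv.
  apply/eqP; rewrite eqEdim subvf /=; have := limg_ker_dim F fullv.
  by rewrite kerF capv0 dimv0 add0n !dimvf dUV => ->.
have : y \in limg F by rewrite imF memvf.
by case/memv_imgP => x _ ->; exists x; rewrite FE.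
Qed.

Lemma linear_surj_inj V (f : V -> V) : linear f -> (forall y, exists x, f x = y) -> injective f.
Proof.
move=> lf surj.
pose F : 'End(V) := linfun (HB.pack f (GRing.isLinear.Build _ _ _ _ _ lf) : {linear V -> V}).
have FE x : F x = f x by rewrite lfunE.
have imF : limg F = fullv.
  apply/vspaceP => y; rewrite memvf; apply/memv_imgP.
  by have [x <-] := surj y; exists x; rewrite ?memvf ?FE.
have kerF : lker F == 0%VS.
  rewrite -dimv_eq0; have := limg_ker_dim F fullv.
  by rewrite imF capfv => /eqP; rewrite -{2}[\dim fullv]add0n eqn_add2r.
by move=> x y; rewrite -!FE; apply/lker0P.
Qed.

Lemma ltrace_tlift U V (W : vectType k) (phi : V -> U -> k^o) (v : W -> V) t (f : V -> V) :
    linear f -> (forall a, linear (phi^~ a)) ->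
    (forall h, h = tlift (fun a b => (phi h a : k) *: v b) t) ->
  ltrace f = tlift (fun a b => phi (f (v b)) a) t.
Proof.
move=> lf lphi hE.
rewrite (@ltrace_dual _ _ _ xpredT (fun p h => (t p.1 p.2 : k) *: phi h (tbasis p.1))
  (fun p => v (tbasis p.2))) //.
- by rewrite [RHS]/tlift pair_big.
- by move=> j; slin.
move=> h; rewrite {1}[h]hE /tlift pair_big /=.
by apply: eq_bigr => p _; rewrite scalerA.
Qed.

End LinearBijection.

(** * Two-sided integrals *)

Section Integral.

Variables (k : fieldType) (H : hopfType k).

Definition integral (L : H) : Prop :=
  [/\ forall h, h * L = (counit h : k) *: L, forall h, L * h = (counit h : k) *: L
    & counit L = 1].

(** Some [e i] has nonzero counit. Were [h * e i - counit h *: e i] nonzero, it would generate [e i]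
    although its counit is 0: so [e i] is a left integral. Its defect [x] as a right integral is
    again a left integral, now of counit 0. If [x * e j != 0], then [e j] is a left multiple of
    [x * e j], so it has counit 0 too, which forces [e j = e j * e j = 0]. *)
Lemma integral_of_idempotents N (e : 'I_N -> H) : simple_idempotents e ->
  exists2 i, integral (e i) & e i != 0.
Proof.
case=> esum eO e0 esimp.
have [i ci] : exists i, counit (e i) != 0.
  apply/existsP; apply: contraT => /existsPn h; case/eqP: (oner_neq0 k).
  rewrite -(counit1 (s := H)) -esum linear_sum big1 // => i _.
  by apply/eqP; have := h i; rewrite negbK.
have c1 : counit (e i) = 1.
  by apply: (mulfI ci); rewrite -counitM eO eqxx mulr1.
have lint h : h * e i = (counit h : k) *: e i.
  apply/eqP; rewrite -subr_eq0; apply: contraT => nz.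
  have [|y yE] := esimp i _ _ nz.
    by rewrite mulrBl -scalerAl -mulrA eO eqxx.
  case/eqP: (oner_neq0 k); rewrite -[LHS]c1 -yE counitM linearB linearZ /= c1.
  by rewrite counitM c1 mulr1 [_ *: _]mulr1 subrr mulr0.
exists i => //; split=> // h.
apply/eqP; rewrite -subr_eq0; set x := _ - _; apply: contraT => x0.
have cx : counit x = 0.
  by rewrite linearB linearZ /= counitM c1 mul1r [_ *: _]mulr1 subrr.
have xl (g : H) : g * x = (counit g : k) *: x.
  by rewrite /x mulrBr mulrA -scalerAr !lint -scalerAl scalerBr !scalerA [counit h * _]mulrC.
have [j xj] : exists j, x * e j != 0.
  apply/existsP; apply: contraR x0 => /existsPn n; rewrite -[x]mulr1 -esum mulr_sumr big1 // => j _.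
  by apply/eqP; have := n j; rewrite negbK.
have [|y yE] := esimp j (x * e j) _ xj; first by rewrite -mulrA eO eqxx.
have cj : counit (e j) = 0 by rewrite -yE !counitM cx mul0r mulr0.
case/eqP: (e0 j); have := eO j j; rewrite eqxx -{2}yE mulrA mulrA -[_ * y * _]mulrA xl.
by rewrite -scalerAr xl cj scale0r scaler0 mul0r => <-.
Qed.

End Integral.

(** * The Frobenius form, its Nakayama automorphism and Radford's formula *)

Section Frobenius.

Variables (k : fieldType) (H : hopfType k) (L : H).
Hypothesis intL : integral L.
Implicit Types a b h x y : H.
Implicit Types f g : hopf_dual H.

Local Notation S := (@antipode k H).
Local Notation eps := (@counit k H).
Local Notation ev f := (f : 'Hom(H, k^o)).

Let hL h : h * L = (eps h : k) *: L. Proof. by case: intL. Qed.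
Let Lh h : L * h = (eps h : k) *: L. Proof. by case: intL. Qed.
Let eL : eps L = 1. Proof. by case: intL. Qed.

(* [F] applied to the Casimir element [L_1 ⊗ S(L_2)]. *)
Definition cas (W : vectType k) (F : H -> H -> W) : W := tlift (fun a b => F a (S b)) (comul L).

Lemma eq_cas (W : vectType k) (F G : H -> H -> W) : F =2 G -> cas F = cas G.
Proof. by move=> FG; apply: eq_tlift => a b; exact: FG. Qed.

Lemma cas_lin (W X : vectType k) (f : W -> X) (F : H -> H -> W) :
  linear f -> f (cas F) = cas (fun a b => f (F a b)).
Proof. by move=> lf; rewrite /cas linear_tlift. Qed.

(** In Sweedler notation [T] feeds [F] with [h1 L1] and [S(L2) S(h2) h3]. Contracting [h2] with [h3]
    leaves [h L1] and [S(L2)]; replacing [h1 L] by [eps h1 *: L] leaves [L1] and [S(L2) h]. *)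
Lemma cas_l (W : vectType k) (F : H -> H -> W) h :
    (forall y, linear (F^~ y)) -> (forall x, linear (F x)) ->
  cas (fun x y => F (h * x) y) = cas (fun x y => F x (y * h)).
Proof.
move=> l1 l2.
pose T a b c := cas (fun x y => F (a * x) (y * S b * c)).
transitivity (tlift (fun a bc => tlift (T a) (comul bc)) (comul h)).
  rewrite -(counitr_tlift (F := fun z => cas (fun x y => F (z * x) y))); last by rewrite /cas; slin.
  apply: eq_tlift => a b.
  transitivity (tlift (fun b1 b2 => cas (fun x y => F (a * x) (y * (S b1 * b2)))) (comul b)).
    rewrite (antipodel_tlift (F := fun z => cas (fun x y => F (a * x) (y * z))));
      last by rewrite /cas; slin.
    by congr (_ *: _); apply: eq_cas => x y; rewrite mulr1.
  by apply: eq_tlift => b1 b2; apply: eq_cas => x y; rewrite mulrA.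
rewrite -comul_assoc; try by rewrite /T /cas; slin.
rewrite -(counitl_tlift (F := fun z => cas (fun x y => F x (y * z)))); last by rewrite /cas; slin.
apply: eq_tlift => a b.
transitivity (tlift (fun u v => F u (S v * b)) (comul (a * L))); last by rewrite hL linearZ /= linearZ.
rewrite comul_mul; try by slin.
by apply: eq_tlift => a1 a2; apply: eq_tlift => x y; rewrite antipodeM.
Qed.

(** The double reading of [cas_l], now based on [L * h1]; the factor [S (S h)] arises because the
    inserted [S h3] stands under the antipode of the second leg. *)
Lemma cas_r (W : vectType k) (F : H -> H -> W) h :
    (forall y, linear (F^~ y)) -> (forall x, linear (F x)) ->
  cas (fun x y => F (x * h) y) = cas (fun x y => F x (S (S h) * y)).
Proof.
move=> l1 l2.
pose T a b c := tlift (fun x (z : H) => F (x * a) (S (z * b * S c))) (comul L).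
transitivity (tlift (fun a bc => tlift (T a) (comul bc)) (comul h)).
  rewrite -(counitr_tlift (F := fun z => cas (fun x y => F (x * z) y))); last by rewrite /cas; slin.
  apply: eq_tlift => a b.
  transitivity (tlift (fun b1 b2 => tlift (fun x (z : H) => F (x * a) (S (z * (b1 * S b2)))) (comul L))
    (comul b)).
    rewrite (antipoder_tlift (F := fun u => tlift (fun x (z : H) => F (x * a) (S (z * u))) (comul L)));
      last by slin.
    by congr (_ *: _); apply: eq_tlift => x z; rewrite mulr1.
  by apply: eq_tlift => b1 b2; apply: eq_tlift => x y; rewrite mulrA.
rewrite -comul_assoc; try by rewrite /T; slin.
rewrite -(counitl_tlift (F := fun z => cas (fun x y => F x (S (S z) * y)))); last by rewrite /cas; slin.
apply: eq_tlift => a b.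
transitivity (tlift (fun u v => F u (S (S b) * S v)) (comul (L * a))); last by rewrite Lh linearZ /= linearZ.
rewrite comul_mul; try by slin.
rewrite exchange_tlift; apply: eq_tlift => a1 a2; apply: eq_tlift => x y.
by rewrite [in LHS]antipodeM.
Qed.

Lemma cas_mul : cas (fun x y => x * y) = 1.
Proof. by rewrite /cas antipoder eL scale1r. Qed.

Definition frob f : H := cas (fun x y => (ev f x : k) *: y).

Lemma frob_linear : linear frob. Proof. by rewrite /frob /cas; slin. Qed.

(** Since [L1 S(L2) = 1], [f h] is a sum over the basis vectors [b] of coordinates of the elements
    [f(h L1 b) S(L2)], and the two Casimir relations turn each of them into [S (S b) * frob f * h].
    Bijectivity of [frob] then yields a preimage [lmb] of 1 and the bijectivity of [S]. *)
Lemma frob_inj : injective frob.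
Proof.
have ker f : frob f = 0 -> f = 0.
  move=> f0; apply/lfunP => h; rewrite zero_lfunE -[h]mulr1 -cas_mul.
  rewrite (cas_lin (f := fun z => ev f (h * z))); last by slin.
  transitivity (\sum_i dcoord i (cas (fun x y => (ev f (h * x * tbasis i) : k) *: y))).
    rewrite (eq_bigr (fun i => cas (fun x y =>
      dcoord i ((ev f (h * x * tbasis i) : k) *: y)))) => [|i _]; last first.
      by rewrite (cas_lin (f := dcoord i)) //; exact: linearP.
    rewrite /cas -tlift_sum; apply: eq_tlift => a b.
    rewrite mulrA {1}[S b]tbasis_sum mulr_sumr linear_sum; apply: eq_bigr => j _.
    by rewrite -scalerAr !linearZ /= dcoordE scale_regC.
  apply: big1 => i _.
  have -> : cas (fun x y => (ev f (h * x * tbasis i) : k) *: y) = S (S (tbasis i)) * frob f * h.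
    transitivity (cas (fun x y => (ev f (h * x) : k) *: (S (S (tbasis i)) * y))).
      rewrite -(cas_r (F := fun x y => (ev f (h * x) : k) *: y)); try by slin.
      by apply: eq_cas => x y; rewrite mulrA.
    rewrite (cas_l (F := fun x y => (ev f x : k) *: (S (S (tbasis i)) * y))); try by slin.
    rewrite /frob (cas_lin (f := fun z => S (S (tbasis i)) * z * h)); last by slin.
    by apply: eq_cas => x y; rewrite -scalerAr -scalerAl mulrA.
  by rewrite f0 mulr0 mul0r linear0.
move=> f g fg; apply/eqP; rewrite -subr_eq0; apply/eqP/ker.
by rewrite (linearB_ext frob_linear) fg subrr.
Qed.

Lemma frob_surj h : exists f, frob f = h.
Proof.
apply: linear_inj_surj; [exact: frob_linear | exact: frob_inj |].
by rewrite [LHS]/dim /= muln1.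
Qed.

Lemma frob_rop f : frob f = S (rop f L).
Proof.
rewrite /rop linear_tlift; last by slin.
by apply: eq_tlift => a b; rewrite linearZ.
Qed.

Lemma antipode_surj h : exists x, S x = h.
Proof. by have [f <-] := frob_surj h; exists (rop f L); rewrite frob_rop. Qed.

Lemma antipode_inj : injective S.
Proof. by apply: linear_surj_inj; [slin | exact: antipode_surj]. Qed.

Lemma antipode_integral : S L = L.
Proof.
have h2 h : S L * h = (eps h : k) *: S L.
  by have [x <-] := antipode_surj h; rewrite -antipodeM hL linearZ /= counit_antipode.
by have := h2 L; rewrite hL counit_antipode eL !scale1r.
Qed.

Lemma rop_integral_inj : injective (fun f => rop f L).
Proof. by move=> f g /(congr1 S); rewrite -!frob_rop => /frob_inj. Qed.

Variable lmb : hopf_dual H.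
Hypothesis frob_lmb : frob lmb = 1.

(** [L1] and [S(L2)] are dual bases for the bilinear form [lmb (x * y)]; [ltrace_cas] evaluates
    traces with them. *)
Lemma lmb_dual h : cas (fun x y => (ev lmb (h * x) : k) *: y) = h.
Proof.
rewrite (cas_l (F := fun x y => (ev lmb x : k) *: y)); try by slin.
transitivity (frob lmb * h); last by rewrite frob_lmb mul1r.
rewrite /frob (cas_lin (f := fun z => z * h)); last by slin.
by apply: eq_cas => x y; rewrite -scalerAl.
Qed.

Lemma lmb_nondeg a b : (forall x, ev lmb (a * x) = ev lmb (b * x)) -> a = b.
Proof.
by move=> ab; rewrite -[a]lmb_dual -[b]lmb_dual; apply: eq_cas => x y; rewrite ab.
Qed.

Lemma ltrace_cas (f : H -> H) : linear f -> ltrace f = cas (fun x y => ev lmb (f y * x)).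
Proof.
move=> lf; rewrite /cas.
apply: (@ltrace_tlift _ _ _ _ (fun h a => ev lmb (h * a)) S) => //; first by slin.
by move=> h; rewrite -[LHS]lmb_dual.
Qed.

(** The Nakayama automorphism of the Frobenius form [lmb] is [S^2]: both sides, as functionals of
    [x], have the image [S (S b)] under the injective [frob]. *)
Lemma nakayama x b : ev lmb (x * b) = ev lmb (S (S b) * x).
Proof.
have [g1 g1E] := @hom_of _ _ k^o (fun x => ev lmb (x * b)) ltac:(slin).
have [g2 g2E] := @hom_of _ _ k^o (fun x => ev lmb (S (S b) * x)) ltac:(slin).
suff: g1 = g2 by rewrite -g1E -g2E => ->.
apply: frob_inj; transitivity (S (S b)).
  transitivity (S (S b) * frob lmb); last by rewrite frob_lmb mulr1.
  transitivity (cas (fun x y => (ev lmb (x * b) : k) *: y)).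
    by apply: eq_cas => u v; rewrite g1E.
  rewrite (cas_r (F := fun x y => (ev lmb x : k) *: y)); try by slin.
  rewrite /frob (cas_lin (f := fun z => S (S b) * z)); last by slin.
  by apply: eq_cas => u v; rewrite -scalerAr.
by rewrite -[LHS]lmb_dual; apply: eq_cas => u v; rewrite g2E.
Qed.

Lemma rop_lmb_integral : rop lmb L = 1.
Proof. by apply: antipode_inj; rewrite -frob_rop frob_lmb antipode1. Qed.

Lemma lmb_right f : lmb * f = (ev f 1 : k) *: lmb.
Proof.
apply: rop_integral_inj; rewrite /= ropM ropZ rop_lmb_integral.
by rewrite grouplike_rop ?grouplike1.
Qed.

Lemma right_integral_uniq (mu : hopf_dual H) :
  (forall f, mu * f = (ev f 1 : k) *: mu) -> mu = (ev mu L : k) *: lmb.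
Proof.
move=> muE; apply: rop_integral_inj; rewrite /= ropZ rop_lmb_integral.
apply: hom_sep => f; rewrite ev_rop muE scale_lfunE linearZ /=.
exact: scale_regC.
Qed.

Lemma lmb_neq0 : lmb != 0.
Proof.
apply/eqP => l0; case/eqP: (oner_neq0 H).
by rewrite -frob_lmb l0 (linear0_ext frob_linear).
Qed.

Lemma lmb_integral : ev lmb L = 1.
Proof.
have := right_integral_uniq lmb_right => /eqP.
rewrite -{1}[lmb]scale1r -subr_eq0 -scalerBl scaler_eq0 (negPf lmb_neq0) orbF subr_eq0.
by move/eqP.
Qed.

(** The distinguished group-like element of [H]: by [lmb_left] it measures how far the right
    integral [lmb] of [H^*] is from being a left one. *)
Definition modular := lop lmb L.

Lemma lmb_left f : f * lmb = (ev f modular : k) *: lmb.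
Proof.
rewrite {1}(@right_integral_uniq (f * lmb)) ?ev_lop // => g.
by rewrite -mulrA lmb_right -scalerAr.
Qed.

Lemma scale_lmb_inj (c d : k) : c *: lmb = d *: lmb -> c = d.
Proof.
move/eqP; rewrite -subr_eq0 -scalerBl scaler_eq0 (negPf lmb_neq0) orbF subr_eq0.
by move/eqP.
Qed.

Lemma modular_grouplike : grouplike modular.
Proof.
apply/grouplikeP; split; last first.
  by apply: scale_lmb_inj; rewrite -ev1 -lmb_left mul1r scale1r.
apply: tensor_sep => f g; rewrite -[LHS](@evM _ _ f g) tliftE; last by sbil.
apply: scale_lmb_inj; rewrite -lmb_left -mulrA lmb_left -scalerAr lmb_left scalerA.
by rewrite mulrC.
Qed.

Lemma lop_lmb h : lop lmb h = (ev lmb h : k) *: modular.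
Proof.
apply: hom_sep => f; rewrite ev_lop lmb_left scale_lfunE linearZ /=.
exact: scale_regC.
Qed.

(** [lmb (modular * _)] is a left integral of [H^*]. Composing it with the inverse of [S] gives a
    right integral [mu], and right integrals are multiples of [lmb]. *)
Lemma modular_twist : exists2 c : k, c != 0 & forall h, ev lmb (modular * h) = c * ev lmb (S h).
Proof.
have gm := modular_grouplike.
have [l2 l2E] := @hom_of _ _ k^o (fun x => ev lmb (modular * x)) ltac:(slin).
have l2int f : f * (l2 : hopf_dual H) = (ev f 1 : k) *: (l2 : hopf_dual H).
  apply/lfunP => h; rewrite scale_lfunE evM.
  have -> : tlift (fun a b => ev f a * ev (l2 : hopf_dual H) b : k^o) (comul h)
      = ev f (lop (l2 : hopf_dual H) h).
    rewrite /lop linear_tlift; last by slin.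
    by apply: eq_tlift => a b; rewrite linearZ /= mulrC.
  have -> : lop (l2 : hopf_dual H) h = (l2 h : k) *: 1; last by rewrite linearZ /= scale_regC.
  transitivity (S modular * lop lmb (modular * h)); last first.
    by rewrite lop_lmb l2E -scalerAr grouplike_mulVr.
  rewrite /lop comul_mul; try by slin.
  rewrite (grouplike_tlift (a := modular)) //; try by slin.
  rewrite (linear_tlift (f := fun x => S modular * x)); last by slin.
  by apply: eq_tlift => a b; rewrite l2E -scalerAr mulrA grouplike_mulVr // mul1r.
have [mu muE] : exists mu : hopf_dual H, forall h, ev mu (S h) = l2 h.
  have [|||mu muE] := @linear_inj_surj _ (hopf_dual H) (hopf_dual H) (@dual_antipode k H) _ _ _ l2.
  - by slin.
  - move=> f g fg; apply/lfunP => h; have [x <-] := antipode_surj h.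
    by rewrite -!dual_antipodeE fg.
  - by [].
  by exists mu => h; rewrite -muE dual_antipodeE.
have mul2 : dual_antipode mu = l2 by apply/lfunP => h; rewrite dual_antipodeE muE.
have inj f g : dual_antipode f = dual_antipode g :> hopf_dual H -> f = g.
  move=> fg; apply/lfunP => h; have [x <-] := antipode_surj h.
  by rewrite -!dual_antipodeE fg.
have muint f : mu * f = (ev f 1 : k) *: mu.
  apply: inj; have -> : dual_antipode (mu * f) = dual_antipode f * dual_antipode mu.
    exact: (@antipodeM _ (hopf_dual H)).
  rewrite mul2 l2int linearZ /= mul2 dual_antipodeE.
  by rewrite antipode1.
exists (ev mu L).
  apply: contraTneq lmb_neq0 => c0.
  rewrite negbK; apply/eqP/lfunP => h.
  have := muE (S modular * h); rewrite (right_integral_uniq muint) c0 scale0r zero_lfunE l2E.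
  by rewrite mulrA grouplike_mulrV // mul1r => <-; rewrite zero_lfunE.
by move=> h; rewrite -l2E -muE {1}(right_integral_uniq muint) scale_lfunE.
Qed.

(** Radford's formula; a single modular element occurs because the integral [L] is two-sided. [flip]
    exchanges two factors under [lmb (modular * _)] by passing through [S], at the price of one
    [S^2]; exchanging them back by [nakayama] costs another. *)
Lemma modular_antipode4 a : modular * a = S (S (S (S a))) * modular.
Proof.
have [c c0 cE] := modular_twist.
apply: lmb_nondeg => b.
have flip u v : ev lmb (modular * (u * v)) = ev lmb (modular * (v * S (S u))).
  rewrite !cE; congr (_ * _).
  by rewrite antipodeM nakayama -antipodeM.
by rewrite -!mulrA flip mulrA nakayama.
Qed.

Lemma antipode2_finite_order : exists2 N, (0 < N)%N & forall a, iter N (fun x => S (S x)) a = a.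
Proof.
have [N N0 gN] := grouplike_finite_order modular_grouplike.
(* Conjugation by [modular] is [S^4], so [modular ^+ N = 1] makes the [2 N]-th iterate of [S^2]
   trivial. *)
exists (N + N)%N; first by rewrite addn_gt0 N0.
have it j a : modular ^+ j * a = iter (j + j) (fun x => S (S x)) a * modular ^+ j.
  elim: j => [|j IH]; first by rewrite !expr0 mul1r mulr1.
  by rewrite exprS -mulrA IH mulrA modular_antipode4 -mulrA addSn addnS.
by move=> a; have := it N a; rewrite gN mul1r mulr1 => <-.
Qed.

(** [lop lmb 1] is [lmb 1] times the unit by definition and [lmb 1] times [modular] by [lop_lmb], so
    [modular = 1]. *)
Lemma antipode4 : ev lmb 1 != 0 -> forall a, S (S (S (S a))) = a.
Proof.
move=> nz a; have := lop_lmb 1; rewrite /lop comul_one; try by slin.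
move/eqP; rewrite -subr_eq0 -scalerBr scaler_eq0 (negPf nz) /= subr_eq0 => /eqP m1.
by have := modular_antipode4 a; rewrite -m1 mul1r mulr1.
Qed.

Lemma ltrace_antipode2 : ltrace (fun x => S (S x)) = ev lmb 1.
Proof.
rewrite ltrace_cas; last by slin.
transitivity (ev lmb (cas (fun x y => x * y))); last by rewrite cas_mul.
rewrite (cas_lin (f := ev lmb)); last by slin.
by apply: (@eq_cas k^o) => x y; rewrite [RHS]nakayama.
Qed.

End Frobenius.

Arguments cas_lin {k H L W X f F} _.
Arguments eq_cas {k H L W F G} _.

(** * Roots of unity in [k] and in [algC], and traces of cyclic groups *)

Section RootsOfUnity.

Variable k : fieldType.
Hypothesis char_k : [pchar k] =i pred0.

Lemma pchar0_intr_eq0 (a : int) : (a%:~R == 0 :> k) = (a == 0).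
Proof.
have /pcharf0P h := char_k; case: a => n; first exact: h.
by rewrite NegzE mulrNz oppr_eq0 /=; rewrite -[n.+1%:~R]/(n.+1%:R) h.
Qed.

Lemma root_Cyclotomic_closed N (z : k) : N.-primitive_root z ->
  root (map_poly intr 'Phi_N : {poly k}) z.
Proof.
move=> pz; have N0 := prim_order_gt0 pz.
have XdE d : (0 < d)%N ->
    \prod_(c <- divisors d) (map_poly intr 'Phi_c : {poly k}) = 'X^d - 1.
  by move=> d0; rewrite -rmorph_prod prod_Cyclotomic // rmorphB /= rmorph1 map_polyXn.
have rN : root (\prod_(c <- divisors N) (map_poly intr 'Phi_c : {poly k})) z.
  by rewrite XdE // rootE !hornerE (prim_expr_order pz) subrr.
have /hasP [d dN rd] : has (fun d => root (map_poly intr 'Phi_d : {poly k}) z) (divisors N).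
  elim: (divisors N) rN => [|d r IH]; first by rewrite big_nil (negPf (root1 _)).
  by rewrite big_cons rootM /=; case: (root _ _) => //= /IH.
have d0 : (0 < d)%N by move: dN; rewrite -dvdn_divisors // => /dvdn_gt0 ->.
suff -> : N = d by [].
apply/eqP; rewrite eqn_dvd [X in _ && X]dvdn_divisors // dN andbT (prim_order_dvd pz).
have : root (\prod_(c <- divisors d) (map_poly intr 'Phi_c : {poly k})) z.
  rewrite (big_rem d) /= ?rootM ?rd // -dvdn_divisors //.
by rewrite XdE // rootE !hornerE subr_eq0.
Qed.

(* Both roots of unity generate the same number field: 'Phi_N is irreducible. *)
Lemma cyclotomic_transfer N (z : k) (y : algC) (Q : {poly int}) :
    N.-primitive_root z -> N.-primitive_root y ->
  root (map_poly intr Q : {poly k}) z -> root (map_poly intr Q : {poly algC}) y.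
Proof.
move=> pz py rQ; apply: contraT => nQ.
have [p [pE _] rp] := minCpolyP y.
have ZQC (F : {poly int}) :
    map_poly intr F = map_poly ratr (map_poly intr F : {poly rat}) :> {poly algC}.
  by rewrite -map_poly_comp; apply: eq_map_poly => b; rewrite /= rmorph_int.
have {}pE : p = map_poly intr 'Phi_N.
  apply: (map_poly_inj (ratr : {rmorphism rat -> algC})).
  by rewrite -pE (minCpoly_cyclotomic py) -(Cintr_Cyclotomic py) ZQC.
set q : {poly rat} := map_poly intr Q.
have npq : ~~ (p %| q) by rewrite -rp -ZQC.
(* [p] is the minimal polynomial of [y]. Either [y] is a root of [p %/ gcdp p q], which by degree
   makes the gcd constant, or of the gcd itself, and then [p] divides [q]. *)
have cop : coprimep p q.
  have gp := dvdp_gcdl p q; have gq := dvdp_gcdr p q.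
  have p0 : p != 0 by rewrite pE; apply/monic_neq0/monic_map/Cyclotomic_monic.
  have : root (map_poly ratr p : {poly algC}) y by rewrite rp.
  rewrite -{1}(divpK gp) rmorphM rootM !rp => /orP [/dvdp_leq h|h]; last first.
    by case/negP: npq; exact: dvdp_trans h gq.
  have g0 : gcdp p q != 0 by rewrite gcdp_eq0 (negPf p0).
  have d0 : p %/ gcdp p q != 0 by rewrite divp_eq0 (negPf p0) (negPf g0) /= -leqNgt dvdp_leq.
  have := h d0; rewrite size_divp // => le.
  rewrite /coprimep eqn_leq lt0n size_poly_eq0 g0 andbT.
  have := size_poly_gt0 p; rewrite p0; have := dvdp_leq p0 gp.
  have : (0 < size (gcdp p q))%N by rewrite size_poly_gt0.
  by case: (size (gcdp p q)) le => [|[|n]] //= le _ le2 s0; move: le; rewrite leqNgt ltn_subrL s0.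
have /Bezout_eq1_coprimepP [[u v] /= uv] := cop.
have [U [a a0 uE]] := rat_poly_scale u; have [V [b b0 vE]] := rat_poly_scale v.
(* With denominators cleared, the Bezout relation is an identity over the integers; read in [k] at
   [z], it says that the nonzero integer [a * b] vanishes. *)
have ZE : (b *: U) * 'Phi_N + (a *: V) * Q = (a * b)%:P.
  apply: (map_inj_poly (intr_inj : injective (intr : int -> rat))) => //.
  transitivity ((a%:~R * b%:~R : rat) *: (u * p + v * q)); last first.
    by rewrite uv alg_polyC /= map_polyC /= intrM.
  rewrite rmorphD /= !rmorphM /= !map_polyZ /= -pE -/q uE vE scalerDr -!scalerAl !scalerA.
  by rewrite mulrAC mulfV ?intr_eq0 // mul1r -mulrA mulfV ?intr_eq0 // mulr1.
have := congr1 (fun F => (map_poly intr F : {poly k}).[z]) ZE.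
rewrite /= rmorphD /= [map_poly _ (_ * 'Phi_N)]rmorphM [map_poly _ (_ * Q)]rmorphM /=.
rewrite hornerD !hornerM (eqP (root_Cyclotomic_closed pz)).
rewrite (eqP rQ) !mulr0 addr0 map_polyC hornerC => /esym ab0.
have /eqP : (a * b)%:~R = 0 :> k := ab0.
by rewrite pchar0_intr_eq0 mulf_eq0 (negPf a0) (negPf b0).
Qed.

End RootsOfUnity.

Lemma closed_prim_root (k : closedFieldType) N :
  [pchar k] =i pred0 -> (0 < N)%N -> exists z : k, N.-primitive_root z.
Proof.
move=> ck N0; have [r rE] := closed_field_poly_normal ('X^N - 1 : {poly k}).
have mon : ('X^N - 1 : {poly k}) \is monic := monicXnsubC 1 N0.
rewrite (monicP mon) scale1r in rE.
have /hasP [z zr pz] : has N.-primitive_root r.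
  apply: has_prim_root => //.
  - apply/allP => z zr; rewrite unity_rootE; have : root ('X^N - 1 : {poly k}) z.
      by rewrite rE root_prod_XsubC.
    by rewrite rootE !hornerE subr_eq0.
  - rewrite -separable_prod_XsubC -rE separable_Xn_sub_1 //.
    by have /pcharf0P -> := ck; rewrite -lt0n.
  by rewrite -ltnS -(size_prod_XsubC r id) -rE size_XnsubC.
by exists z.
Qed.

(* The representation of a cyclic group splits into eigenspaces. *)
Lemma cyclic_trace (k : fieldType) (V : vectType k) N (z : k) (F : nat -> V -> V) :
    [pchar k] =i pred0 -> N.-primitive_root z -> (forall i, linear (F i)) ->
    (forall i j x, F i (F j x) = F (i + j)%N x) -> (forall x, F N x = F 0%N x) ->
  exists m : 'I_N -> nat, forall i, ltrace (F i) = \sum_(j < N) (m j)%:R * z ^+ (i * j).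
Proof.
move=> ck pz lF FM FN; have N0 := prim_order_gt0 pz.
have z0 : z != 0.
  apply/eqP => z0; have := prim_expr_order pz.
  by rewrite z0 expr0n gtn_eqF // => /esym/eqP; rewrite oner_eq0.
have nz : (N%:R : k) != 0 by have /pcharf0P -> := ck; rewrite -lt0n.
have Fmod i x : F (i %% N)%N x = F i x.
  rewrite [in RHS](divn_eq i N); elim: (i %/ N)%N => [|q IH]; first by rewrite mul0n.
  by rewrite mulSn -addnA -FM FN FM add0n.
(* The projections onto the eigenspaces. They sum to the idempotent [F 0], which need not be the
   identity: in the application it is right multiplication by [e c]. *)
pose Pi (j : 'I_N) x := (N%:R^-1 : k) *: \sum_(i < N) (z ^- (i * j) : k) *: F i x.
have lPi j : linear (Pi j) by rewrite /Pi; slin.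
have zmod i j : z ^- ((i %% N) * j) = z ^- (i * j).
  congr (_^-1); apply/eqP; rewrite (eq_prim_root_expr pz).
  by rewrite modnMml.
have shift (G : nat -> V) a : (forall i, G (i %% N)%N = G i) ->
    \sum_(i < N) G (a + i)%N = \sum_(i < N) G i.
  move=> Gm; elim: a => [|a IH]; first by apply: eq_bigr.
  rewrite -IH; case: N N0 Gm {IH pz FN nz Fmod Pi lPi zmod} => // n _ Gm.
  rewrite [LHS]big_ord_recr [RHS]big_ord_recl /= addn0 addrC.
  rewrite -(Gm (_ + n)%N) addSn -addnS modnDr Gm; congr (_ + _).
  by apply: eq_bigr => i _; rewrite addSnnS.
have PiPi j x : Pi j (Pi j x) = Pi j x.
  rewrite {1}/Pi.
  transitivity ((N%:R^-1 : k) *: \sum_(i < N) (Pi j x)).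
    congr (_ *: _); apply: eq_bigr => i _; rewrite linearZ_ext // (linear_sum_ext (lF i)).
    rewrite scalerA mulrC -scalerA scaler_sumr; congr (_ *: _).
    rewrite -(shift (fun i => (z ^- (i * j) : k) *: F i x) i) => [|l]; last by rewrite zmod Fmod.
    by apply: eq_bigr => l _; rewrite linearZ_ext // FM scalerA mulnDl exprD invfM.
  by rewrite sumr_const card_ord -scaler_nat scalerA mulVf // scale1r.
have /fin_all_exists [m mE] : forall j, exists r : nat, ltrace (Pi j) = r%:R.
  by move=> j; apply: ltrace_idem_nat.
exists m => i.
transitivity (ltrace (fun x => \sum_(j < N) (z ^+ (i * j) : k) *: Pi j x)); last first.
  by rewrite ltrace_sum; apply: eq_bigr => j _; rewrite ltraceZ mE mulrC.
apply: eq_ltrace => x; rewrite -Fmod; pose i0 := Ordinal (ltn_pmod i N0).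
rewrite /Pi; under eq_bigr => j _ do rewrite scaler_sumr scaler_sumr.
rewrite exchange_big /= (bigD1 i0) //= [X in _ + X]big1 ?addr0 => [|l nl].
  rewrite (eq_bigr (fun=> (N%:R^-1 : k) *: F (i %% N)%N x)) => [|j _].
    by rewrite sumr_const card_ord -scaler_nat scalerA mulfV // scale1r.
  by rewrite zmod !scalerA mulrAC mulfV ?mul1r // expf_neq0.
pose w := z ^+ i / z ^+ l.
have w1 : w != 1.
  rewrite -(inj_eq (mulIf (expf_neq0 l z0))) divfK ?expf_neq0 // mul1r (eq_prim_root_expr pz).
  by apply: contra nl => /eqP e; apply/eqP/val_inj; rewrite /= e modn_small.
under eq_bigr => j _ do rewrite scalerA scalerA.
rewrite -scaler_suml (_ : \sum_(j < N) _ = N%:R^-1 * \sum_(j < N) w ^+ j).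
  have : (w - 1) * \sum_(j < N) w ^+ j = 0.
    rewrite -subrX1 /w expr_div_n -!exprM ![(_ * N)%N]mulnC !exprM (prim_expr_order pz) !expr1n.
    by rewrite divr1 subrr.
  by move/eqP; rewrite mulf_eq0 subr_eq0 (negPf w1) /= => /eqP ->; rewrite mulr0 scale0r.
rewrite mulr_sumr; apply: eq_bigr => j _.
by rewrite /w expr_div_n -!exprM mulrAC mulrC.
Qed.

(** * The square of the antipode is inner and has nonzero trace *)

Section AntipodeSquare.

Variables (k : closedFieldType) (H : hopfType k) (n : nat) (e : 'I_n -> H) (i0 : 'I_n).
Hypothesis char_k : [pchar k] =i pred0.
Hypothesis e_simple : simple_idempotents e.
Hypothesis intL : integral (e i0).
Variable lmb : hopf_dual H.
Hypothesis frob_lmb : frob (e i0) lmb = 1.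
Implicit Types a b h x y : H.

Local Notation S := (@antipode k H).
Local Notation eps := (@counit k H).
Local Notation L := (e i0).
Local Notation ev f := (f : 'Hom(H, k^o)).
Local Notation tau := (@regular_trace k H).
Local Notation chi := (chi e).

(** In Sweedler notation [S(L2) L1], the density of the regular trace with respect to [lmb]. *)
Definition casw : H := cas L (fun x y => y * x).

Lemma tau_casw x : tau x = ev lmb (x * casw).
Proof.
rewrite /regular_trace (ltrace_cas intL frob_lmb); last by slin.
rewrite /casw (cas_lin (f := fun z => ev lmb (x * z))); last by slin.
by apply: (@eq_cas _ _ _ k^o) => u v; rewrite mulrA.
Qed.

Lemma casw_unit : exists v, v * casw = 1 /\ casw * v = 1.
Proof.
have inj x : x * casw = 0 -> x = 0.
  move=> x0; apply: (tau_nondeg char_k e_simple) => y.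
  by rewrite (tau_mulC e_simple) tau_casw -mulrA x0 mulr0 linear0.
have [|||v vw] := @linear_inj_surj _ H H (fun x => x * casw) _ _ _ 1; first by slin.
- move=> x y xy; apply/eqP; rewrite -subr_eq0; apply/eqP/inj.
  by rewrite mulrBl xy subrr.
- by [].
exists v; split=> //; apply/eqP; rewrite -subr_eq0; apply/eqP/inj.
by rewrite mulrBl -mulrA vw mulr1 mul1r subrr.
Qed.

Lemma antipode2M x y : S (S (x * y)) = S (S x) * S (S y).
Proof. by rewrite !antipodeM. Qed.

(** The regular trace is symmetric while [lmb] is symmetric only up to [S^2]. Writing the former as
    [lmb (_ * casw)] transfers this discrepancy to [casw], which [nakayama] brings to the front as
    [S (S casw)]. *)
Lemma casw_antipode2 a : S (S casw) * a = S (S a) * S (S casw).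
Proof.
apply: (lmb_nondeg intL frob_lmb) => b.
rewrite -mulrA -[in LHS](nakayama intL frob_lmb) -tau_casw (tau_mulC e_simple) tau_casw.
by rewrite -[b * a * _]mulrA [in LHS](nakayama intL frob_lmb) antipode2M.
Qed.

(* [S^2] is conjugation by an element of finite order: a central factor normalises [casw]. *)
Lemma antipode2_inner : exists N (w : H), [/\ (0 < N)%N, w ^+ N = 1 & forall a, w * a = S (S a) * w].
Proof.
have [N N0 SN] := antipode2_finite_order intL frob_lmb.
set w := S (S casw); have wa a : w * a = S (S a) * w := casw_antipode2 a.
have [v0 [v0w wv0]] := casw_unit; set v := S (S v0).
have vw : v * w = 1 by rewrite /v /w -antipode2M v0w !antipode1.
have wv : w * v = 1 by rewrite /v /w -antipode2M wv0 !antipode1.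
pose z := w ^+ N.
have zC x : z * x = x * z.
  have it j a : w ^+ j * a = iter j (fun x => S (S x)) a * w ^+ j.
    elim: j => [|j IH]; first by rewrite !expr0 mul1r mulr1.
    by rewrite exprS -mulrA IH mulrA wa -mulrA.
  by rewrite /z it SN.
have zv : z * v ^+ N = 1.
  rewrite /z; elim: (N) => [|j IH]; first by rewrite !expr0 mulr1.
  by rewrite exprSr exprS -mulrA [w * _]mulrA wv mul1r IH.
have [esum eO e0 _] := e_simple.
have lz i : lam e i z != 0.
  apply: contra (e0 i) => /eqP l0.
  by rewrite -[e i]mulr1 -zv mulrA -zC (lam_centralE e_simple) // l0 scale0r mul0r.
have rootP (c : k) : exists r, r ^+ N * c == 1 \/ c = 0.
  have [->|c0] := eqVneq c 0; first by exists 0; right.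
  have [r rE] := @solve_monicpoly k N (fun j => if j == 0%N then c^-1 else 0) N0.
  exists r; left; rewrite rE (bigD1 (Ordinal N0)) //= big1 ?addr0 => [|j nj].
    by rewrite expr0 mulr1 mulVf.
  by rewrite -(inj_eq val_inj) /= in nj; rewrite (negPf nj) mul0r.
have root_ex (c : k) : exists r, (r ^+ N * c == 1) || (c == 0).
  by have [r rP] := rootP c; exists r; case: rP => ->; rewrite ?eqxx ?orbT.
(* [xchoose] depends only on the scalar [lam e i z], so linked indices receive the same root; this
   is what makes [y] central. *)
pose r i := xchoose (root_ex (lam e i z)).
have rE i : r i ^+ N * lam e i z = 1.
  by have /orP [/eqP|] := xchooseP (root_ex (lam e i z)); last rewrite (negPf (lz i)).
have rl i j : linked e i j -> r i = r j.
  by move=> ij; rewrite /r; move: (lam_central e_simple zC ij) => ->.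
pose y := \sum_i r i *: e i.
have yX j : y ^+ j = \sum_i r i ^+ j *: e i.
  elim: j => [|j IH].
    by rewrite expr0 -esum; apply: eq_bigr => i _; rewrite expr0 scale1r.
  rewrite exprS IH /y mulr_suml; apply: eq_bigr => i _.
  rewrite mulr_sumr (bigD1 i) //= big1 ?addr0 => [|l nl].
    by rewrite -scalerAl -scalerAr eO eqxx scalerA -exprS.
  by rewrite -scalerAl -scalerAr eO eq_sym (negPf nl) !scaler0.
have yC x : y * x = x * y.
  transitivity (\sum_i \sum_j r i *: (e i * x * e j)).
    rewrite /y mulr_suml; apply: eq_bigr => i _.
    by rewrite -scaler_sumr -mulr_sumr esum mulr1 scalerAl.
  rewrite exchange_big /y mulr_sumr; apply: eq_bigr => j _ /=.
  transitivity (\sum_i r j *: (e i * x * e j)).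
    apply: eq_bigr => i _; have [ij|/linkedPn nl] := boolP (linked e i j); first by rewrite (rl _ _ ij).
    by rewrite nl !scaler0.
  by rewrite -scaler_sumr -!mulr_suml esum mul1r scalerAr.
have yz : y ^+ N * z = 1.
  rewrite yX mulr_suml -esum; apply: eq_bigr => i _.
  by rewrite -scalerAl -zC (lam_centralE e_simple) // scalerA rE scale1r.
exists N, (w * y); split=> // [|a].
  by rewrite exprMn_comm; [rewrite -/z zC yz | exact/esym/yC].
by rewrite -mulrA yC mulrA wa -mulrA.
Qed.

(** The trivial module is one-dimensional: an element [z] with [z * L = z] is a multiple of [L], and
    orthogonality of the idempotents leaves no link to another [e i]. *)
Lemma linked_integral i : linked e i i0 -> i = i0.
Proof.
have [_ eO e0 _] := e_simple; case: intL => hL _ _.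
case/(linkedP e_simple) => z [w [iz zi _ _ [wz _]]].
apply/eqP; apply: contraT => ni; case/eqP: (e0 i0); rewrite -wz.
have : z = (eps z : k) *: L by rewrite -hL zi.
move=> zE; suff -> : z = 0 by rewrite mulr0.
by rewrite -iz zE -scalerAr eO (negPf ni) scaler0.
Qed.

Lemma lmb1_neq0 : ev lmb 1 != 0.
Proof.
have [N [w [N0 wN wa]]] := antipode2_inner.
have [z pz] := closed_prim_root char_k N0.
have [y py] := C_prim_root_exists N0.
have S2E a : S (S a) = w * a * w ^+ N.-1.
  rewrite wa -mulrA -exprS prednK // wN; exact/esym/mulr1.
have := ltrace_antipode2 intL frob_lmb; rewrite (eq_ltrace S2E) (ltrace_LR_crep e_simple) => <-.
have /fin_all_exists [m mE] : forall c, exists m : 'I_N -> nat,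
    forall i, chi c (w ^+ i) = \sum_(j < N) (m j)%:R * z ^+ (i * j).
  move=> c; apply: cyclic_trace => //; first by move=> i; slin.
    move=> i j x; have [_ eO _ _] := e_simple.
    by rewrite !mulrA -exprD -!mulrA eO eqxx.
  by move=> x; rewrite wN expr0.
(* [D c i] at [z] is [chi c (w ^+ i)], and its integer coefficients allow it to be evaluated at the
   root [y] of [algC] too. The exponent [N.-1] stands for the inverse of [w]. *)
pose D c i : {poly int} := \sum_(j < N) (m c j)%:Z *: 'X^(i * j).
have DE (R : comNzRingType) c i (x : R) :
    (map_poly intr (D c i)).[x] = \sum_(j < N) (m c j)%:R * x ^+ (i * j).
  rewrite raddf_sum horner_sum; apply: eq_bigr => j _.
  by rewrite /= map_polyZ /= map_polyXn hornerZ hornerXn.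
pose Q : {poly int} := \sum_(c | is_crep e c) D c 1%N * D c N.-1.
have QE (R : comNzRingType) (x : R) : (map_poly intr Q).[x] =
    \sum_(c | is_crep e c) (\sum_(j < N) (m c j)%:R * x ^+ (1 * j)) *
                          (\sum_(j < N) (m c j)%:R * x ^+ (N.-1 * j)).
  rewrite raddf_sum horner_sum; apply: eq_bigr => c _.
  by rewrite /= rmorphM hornerM /= !DE.
have -> : \sum_(c | is_crep e c) chi c w * chi c (w ^+ N.-1) = (map_poly intr Q).[z].
  by rewrite QE; apply: eq_bigr => c _; rewrite -{1}[w]expr1 !mE.
apply/negP => /(cyclotomic_transfer char_k pz py); rewrite rootE QE.
have y1 : `|y| = 1 :> algC.
  by apply/eqP; rewrite -(pexpr_eq1 (n := N)) ?normr_ge0 // -normrX (prim_expr_order py) normr1.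
have yconj : y^* = y ^+ N.-1.
  have y0 : y != 0 by rewrite -normr_eq0 y1 oner_eq0.
  apply: (mulfI y0); rewrite -exprS prednK // (prim_expr_order py).
  by rewrite -normCK y1 expr1n.
have sq c : (\sum_(j < N) (m c j)%:R * y ^+ (1 * j)) * (\sum_(j < N) (m c j)%:R * y ^+ (N.-1 * j))
    = `| \sum_(j < N) (m c j)%:R * y ^+ j | ^+ 2.
  rewrite normCK rmorph_sum /=; congr (_ * _); apply: eq_bigr => j _; first by rewrite mul1n.
  by rewrite rmorphM rmorphXn /= yconj rmorph_nat -exprM.
under eq_bigr do rewrite sq.
rewrite psumr_eq0 => [/allP h|c _]; last by rewrite exprn_ge0 ?normr_ge0.
(* The trivial character supplies a term that cannot vanish: its multiplicities sum to
   [chi i0 1 = 1], so it is a single power of [y], of modulus 1. *)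
have Rc : is_crep e i0.
  by apply/eqP; apply: linked_integral; exact: (crep_linked e_simple).
have := h i0 (mem_index_enum _); rewrite Rc /= expf_eq0 normr_eq0 /=.
have m1 : (\sum_(j < N) m i0 j = 1)%N.
  have := mE i0 0%N; rewrite expr0 (chi_one e_simple) (eq_card1 (x := i0)) => [|i].
    rewrite (eq_bigr (fun j => (m i0 j)%:R)) => [|j _]; last by rewrite mul0n expr0 mulr1.
    rewrite -natr_sum => /eqP; rewrite -subr_eq0.
    case: (\sum_(j < N) m i0 j)%N => [|[|s]] //.
      by rewrite subr0 oner_eq0.
    rewrite -[s.+2]addn1 natrD [_ + 1]addrC opprD addNKr oppr_eq0.
    by have /pcharf0P -> := char_k.
  rewrite !inE; apply/idP/eqP => [/linked_integral //|->]; exact: linked_refl.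
have [j0 mj0] : exists j0, m i0 j0 != 0%N.
  apply/existsP; apply: contraT => /existsPn n0; move: m1; rewrite big1 // => j _.
  by apply/eqP; have := n0 j; rewrite negbK.
have mj : m i0 j0 = 1%N /\ forall j, j != j0 -> m i0 j = 0%N.
  move: m1; rewrite (bigD1 j0) //=; case: (m i0 j0) mj0 => [|[|s]] // _.
    move=> /eqP; rewrite eqSS sum_nat_eq0 => /forallP n0; split=> // j nj.
    by apply/eqP; have := n0 j; rewrite nj.
case: mj => mj0E mjE; rewrite (bigD1 j0) //= mj0E mul1r big1 ?addr0 => [|j /mjE ->]; last first.
  by rewrite mul0r.
by rewrite expf_eq0 -normr_eq0 y1 oner_eq0 andbF.
Qed.

End AntipodeSquare.

(** * Traces of tripotent operators *)

Section TraceLemmas.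

Variable k : fieldType.
Implicit Types U V W : vectType k.

Lemma ltrace_tliftf U V W (F : W -> U -> V -> W) t :
  ltrace (fun x => tlift (F x) t) = tlift (fun a b => ltrace (fun x => F x a b) : k^o) t.
Proof.
rewrite /tlift ltrace_sum; apply: eq_bigr => i _; rewrite ltrace_sum; apply: eq_bigr => j _.
by rewrite ltraceZ.
Qed.

Hypothesis char_k : [pchar k] =i pred0.

Let two_neq0 : (2%:R : k) != 0.
Proof. by have /pcharf0P -> := char_k. Qed.

(** [P] acts as 1 and as -1 on the images of the idempotents [A] and [B], the halves of [P^2 + P]
    and [P^2 - P]; [a] and [b] are their ranks. *)
Lemma ltrace_tripotent V (P : V -> V) : linear P -> (forall x, P (P (P x)) = P x) ->
  exists a b : nat, [/\ ltrace P = a%:R - b%:R, ltrace (fun x => P (P x)) = a%:R + b%:R,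
   a = 0%N -> forall x, P (P x) = - P x & b = 0%N -> forall x, P (P x) = P x].
Proof.
move=> lP P3.
have half (x : V) : (2%:R^-1 : k) *: (x + x) = x.
  by rewrite -mulr2n -scaler_nat scalerA mulVf // scale1r.
pose A x := (2%:R^-1 : k) *: (P (P x) + P x).
pose B x := (2%:R^-1 : k) *: (P (P x) - P x).
have lA : linear A by rewrite /A; slin.
have lB : linear B by rewrite /B; slin.
have PA x : P (A x) = A x.
  by rewrite /A linearZ_ext // linearD_ext // P3 addrC.
have PB x : P (B x) = - B x.
  by rewrite /B linearZ_ext // linearB_ext // P3 -scalerN opprB.
have AA x : A (A x) = A x by rewrite {1}/A !PA half.
have BB x : B (B x) = B x by rewrite {1}/B PB (linearN_ext lP) PB opprK half.
have [a [aE a0 _]] := ltrace_idem lA AA; have [b [bE b0 _]] := ltrace_idem lB BB.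
exists a, b; split.
- rewrite -aE -bE -ltraceB; apply: eq_ltrace => x; rewrite /A /B -scalerBr opprB addrC addrA subrK.
  by rewrite half.
- rewrite -aE -bE -ltraceD; apply: eq_ltrace => x; rewrite /A /B -scalerDr addrACA subrr addr0.
  by rewrite half.
- move=> /a0 A0 x; apply/eqP; rewrite -addr_eq0; have /eqP := A0 x.
  by rewrite /A scaler_eq0 invr_eq0 (negPf two_neq0).
move=> /b0 B0 x; apply/eqP; rewrite -subr_eq0; have /eqP := B0 x.
by rewrite /B scaler_eq0 invr_eq0 (negPf two_neq0).
Qed.

End TraceLemmas.

(** * The regular character absorbs trace forms *)

Section RegularCharacter.

Variables (k : fieldType) (H : hopfType k).
Implicit Types a b h x y : H.

Local Notation S := (@antipode k H).
Local Notation eps := (@counit k H).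
Local Notation ev f := (f : 'Hom(H, k^o)).
Local Notation tau := (@regular_trace k H).

(* The isomorphism [H ⊗ V = H ⊗ V_triv] of left modules, at the level of traces. *)
Lemma tau_mul_trace (f : hopf_dual H) h : (forall a b, ev f (a * b) = ev f (b * a)) ->
  tlift (fun a b => tau a * ev f b : k^o) (comul h) = (ev f 1 : k) * tau h.
Proof.
move=> fC.
(* Expanding [S x] in the basis, [f (S x * y)] is the sum over [i] of [ev (c i) x * ev (g i) y].
   This cuts the twist by [S] into operators that can be moved cyclically under the trace. *)
have /fin_all_exists [g gE] : forall i : 'I_(dim H), exists g : hopf_dual H,
    forall y, ev g y = ev f (tbasis i * y).
  by move=> i; have [g gE] := @hom_of _ H k^o (fun y => ev f (tbasis i * y)) ltac:(slin); exists g.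
have /fin_all_exists [c cE] : forall i : 'I_(dim H), exists c : hopf_dual H,
    forall y, ev c y = dcoord i (S y).
  by move=> i; have [c cE] := @hom_of _ H k^o (fun y => dcoord i (S y)) ltac:(slin); exists c.
transitivity (ltrace (fun x => tlift (fun a b => (ev f b : k) *: (a * x)) (comul h))).
  by rewrite ltrace_tliftf; apply: eq_tlift => a b; rewrite ltraceZ mulrC.
transitivity (ltrace (fun x => \sum_i lop (g i) (h * lop (c i) x))).
  apply: eq_ltrace => x.
  transitivity (tlift (fun h1 h2 => tlift (fun x' x3 => tlift (fun x1 x2 =>
      (ev f (h2 * (x2 * S x3)) : k) *: (h1 * x1)) (comul x')) (comul x)) (comul h)).
    apply: eq_tlift => h1 h2.
    rewrite (comul_assoc (F := fun x1 x2 x3 => (ev f (h2 * (x2 * S x3)) : k) *: (h1 * x1)));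
      try by slin.
    rewrite -(counitr_tlift (F := fun z => (ev f h2 : k) *: (h1 * z))); last by slin.
    apply: eq_tlift => x1 x2.
    rewrite (antipoder_tlift (F := fun z => (ev f (h2 * z) : k) *: (h1 * x1))); last by slin.
    by rewrite mulr1.
  rewrite exchange_tlift.
  transitivity (tlift (fun x' x3 => \sum_i (dcoord i (S x3) : k) *: lop (g i) (h * x')) (comul x)).
    apply: eq_tlift => x' x3.
    transitivity (tlift (fun h1 h2 => tlift (fun x1 x2 => \sum_i (dcoord i (S x3) : k) *:
        ((ev f (tbasis i * (h2 * x2)) : k) *: (h1 * x1))) (comul x')) (comul h)).
      apply: eq_tlift => h1 h2; apply: eq_tlift => x1 x2.
      rewrite mulrA fC {1}[S x3]tbasis_sum mulr_suml linear_sum scaler_suml; apply: eq_bigr => i _.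
      by rewrite -scalerAl linearZ /= dcoordE scalerA.
    under eq_tlift => h1 h2 do rewrite tlift_sum.
    rewrite tlift_sum; apply: eq_bigr => i _.
    rewrite /lop comul_mul; try by slin.
    rewrite (linear_tlift (f := fun z => (dcoord i (S x3) : k) *: z)); last by slin.
    apply: eq_tlift => h1 h2.
    rewrite (linear_tlift (f := fun z => (dcoord i (S x3) : k) *: z)); last by slin.
    by apply: eq_tlift => x1 x2; rewrite gE.
  rewrite tlift_sum; apply: eq_bigr => i _.
  rewrite [X in h * X]/lop (linear_tlift (f := fun z => lop (g i) (h * z))); last by rewrite /lop; slin.
  apply: eq_tlift => x' x3; rewrite -scalerAr (linearZ_ext (lop_linear (g i))).
  by rewrite cE.
rewrite ltrace_sum.
transitivity (ltrace (fun x => \sum_i h * lop (c i) (lop (g i) x))).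
  rewrite ltrace_sum; apply: eq_bigr => i _.
  by rewrite (@ltraceC _ _ _ (lop (g i)) (fun x => h * lop (c i) x)) //; rewrite /lop; slin.
rewrite /regular_trace -ltraceZ; apply: eq_ltrace => x; rewrite -mulr_sumr scalerAr; congr (_ * _).
transitivity (tlift (fun a b => \sum_i (ev (c i * g i) b : k) *: a) (comul x)).
  by rewrite tlift_sum; apply: eq_bigr => i _; rewrite -lopM.
rewrite -[in RHS](counitr x) (linear_tlift (f := fun z => (ev f 1 : k) *: z)); last by slin.
apply: eq_tlift => a b; rewrite -scaler_suml scalerA; congr (_ *: _).
rewrite mulrC.
transitivity (eps b *: (ev f 1) : k^o); last by [].
rewrite -(antipodel_tlift (F := fun z => ev f z)); last by slin.
rewrite (eq_bigr (fun i => tlift (fun b1 b2 => ev (c i) b1 * ev (g i) b2 : k^o) (comul b))) => [|i _];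
  last by rewrite evM.
rewrite -tlift_sum; apply: (@eq_tlift _ _ _ k^o) => b1 b2.
rewrite {1}[S b1]tbasis_sum mulr_suml linear_sum; apply: eq_bigr => i _.
by rewrite -scalerAl linearZ /= cE gE dcoordE.
Qed.

End RegularCharacter.

(** * The antipode is an involution *)

Section AntipodeInvolutive.

Variables (k : closedFieldType) (H : hopfType k) (n : nat) (e : 'I_n -> H) (i0 : 'I_n).
Hypothesis char_k : [pchar k] =i pred0.
Hypothesis e_simple : simple_idempotents e.
Hypothesis intL : integral (e i0).
Variable lmb : hopf_dual H.
Hypothesis frob_lmb : frob (e i0) lmb = 1.
Implicit Types a b x y : H.

Local Notation S := (@antipode k H).
Local Notation L := (e i0).
Local Notation ev f := (f : 'Hom(H, k^o)).
Local Notation tau := (@regular_trace k H).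

Let S4 a : S (S (S (S a))) = a.
Proof. by apply: (antipode4 intL frob_lmb); exact: (lmb1_neq0 char_k e_simple intL frob_lmb). Qed.

Lemma rop_antipode2 f a : (forall x, ev f (S (S x)) = ev f x) -> rop f (S (S a)) = S (S (rop f a)).
Proof.
move=> fS; rewrite /rop antipode_tlift; try by slin.
rewrite antipode_tlift; try by slin.
rewrite (linear_tlift (f := fun z => S (S z))); last by slin.
by apply: eq_tlift => x y; rewrite fS !linearZ.
Qed.

(** The Larson-Radford trace formula for [S^2] twisted by [f]. The Casimir expansion produces third
    powers of [S], which [S^4 = id] and [S L = L] collapse. *)
Lemma ltrace_rop_antipode2 (f : hopf_dual H) :
  ltrace (fun x => rop f (S (S x))) = (ev lmb 1 : k) * ev f L.
Proof.
rewrite (ltrace_cas intL frob_lmb); last by rewrite /rop; slin.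
transitivity (tlift (fun a b => tlift (fun b1 b2 =>
   (ev f (S (S (S b2))) : k) *: ev lmb (S (S (S b1)) * a)) (comul b)) (comul L)).
  apply: (@eq_tlift _ _ _ k^o) => a b; rewrite /rop.
  rewrite antipode_tlift; try by slin.
  rewrite antipode_tlift; try by slin.
  rewrite antipode_tlift; try by slin.
  rewrite (linear_tlift (f := fun z => ev lmb (z * a))); last by slin.
  by apply: (@eq_tlift _ _ _ k^o) => b1 b2; rewrite -scalerAl linearZ.
rewrite -(comul_assoc (F := fun a b1 b2 =>
   (ev f (S (S (S b2))) : k) *: ev lmb (S (S (S b1)) * a))); try by slin.
rewrite -[in RHS](antipode_integral intL) -[in RHS](antipode_integral intL).
rewrite -[in RHS](antipode_integral intL).
transitivity ((ev lmb 1 : k) *: ev f (S (S (S L)))); last by [].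
rewrite -(counitl_tlift (F := fun z => (ev lmb 1 : k) *: ev f (S (S (S z))))); last by slin.
apply: (@eq_tlift _ _ _ k^o) => a b.
transitivity (tlift (fun a1 a2 => (ev f (S (S (S b))) : k) *: ev lmb (S (S (S (S a1 * a2)))))
   (comul a)).
  by apply: (@eq_tlift _ _ _ k^o) => a1 a2; rewrite !antipodeM S4.
rewrite (antipodel_tlift (F := fun z => (ev f (S (S (S b))) : k) *: ev lmb (S (S (S z)))));
  last by slin.
rewrite !antipode1; congr (_ *: _).
exact: mulrC.
Qed.

Let t_ex : exists t : hopf_dual H, forall x, ev t x = tau x.
Proof. by have [t tE] := @hom_of _ H k^o tau (tau_linear e_simple); exists t. Qed.

Lemma tau_one : tau 1 = (dim H)%:R.
Proof. by rewrite -ltrace_id; apply: eq_ltrace => x; rewrite mul1r. Qed.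

Lemma tau_integral : tau L = 1.
Proof.
case: intL => _ Lh eL; rewrite /regular_trace (eq_ltrace Lh).
by rewrite ltrace_rank1 //; slin.
Qed.

Lemma dimH_neq0 : (dim H)%:R != 0 :> k.
Proof.
have /pcharf0P -> := char_k; apply/eqP => d0; case/eqP: (oner_neq0 H).
by apply: v2r_inj; apply/rowP => i; have := ltn_ord i; rewrite {2}d0.
Qed.

(* Larson and Radford: [n^-1 r_tau S^2] is tripotent with trace [tr (S^2) / n],
   so [n = dim H] divides [tr (S^2)]. *)
Theorem antipode2_id a : S (S a) = a.
Proof.
have [t tE] := t_ex; pose d := (dim H)%:R : k.
have d0 : d != 0 := dimH_neq0.
have tS x : ev t (S (S x)) = ev t x.
  rewrite !tE /regular_trace (eq_ltrace (g := fun y => S (S (x * S (S y))))) => [|y].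
    rewrite (@ltraceC _ _ _ (fun z => S (S z)) (fun y => x * S (S y))); try by slin.
    by apply: eq_ltrace => y; rewrite S4.
  by rewrite !antipodeM S4.
have tt : t * t = d *: t.
  apply/lfunP => x; rewrite evM scale_lfunE.
  transitivity (tlift (fun a b => tau a * ev t b : k^o) (comul x)).
    by apply: (@eq_tlift _ _ _ k^o) => u v; congr (_ * _); exact: tE.
  rewrite tau_mul_trace => [|u v]; last by rewrite !tE (tau_mulC e_simple).
  by rewrite (tE 1) tau_one -tE.
pose P x := (d^-1 : k) *: rop t (S (S x)).
have lP : linear P by rewrite /P /rop; slin.
have rt x : rop t (rop t x) = d *: rop t x by rewrite -ropM tt ropZ.
have rS := rop_antipode2 _ tS.
have PP x : P (P x) = d^-1 *: rop t x.
  rewrite {1}/P /P !linearZ (linearZ_ext (rop_linear t)) -rS S4 rt !scalerA.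
  by rewrite -mulrA mulVf // mulr1.
have PPP x : P (P (P x)) = P x.
  rewrite PP /P (linearZ_ext (rop_linear t)) rt !scalerA -mulrA mulVf // mulr1.
  by [].
have [u [v [uvE _ _ _]]] := ltrace_tripotent char_k lP PPP.
have lS : linear (fun x => S (S x)) by slin.
have S6 x : S (S (S (S (S (S x))))) = S (S x) by rewrite S4.
have [c [c' [cE c2E c0 c0']]] := ltrace_tripotent char_k lS S6.
rewrite (eq_ltrace (g := fun x => x)) in c2E; last by move=> x; rewrite S4.
rewrite ltrace_id in c2E.
have th0 := lmb1_neq0 char_k e_simple intL frob_lmb.
rewrite (ltrace_antipode2 intL frob_lmb) in cE.
have thE : (ev lmb 1 : k) = d * (u%:R - v%:R).
  by rewrite -uvE ltraceZ ltrace_rop_antipode2 tE tau_integral mulr1 mulrA mulfV // mul1r.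
have int0 (z : int) : (z%:~R == 0 :> k) = (z == 0) := pchar0_intr_eq0 char_k z.
(* [c] and [c'] are the dimensions of the eigenspaces of [S^2] for 1 and -1. Their difference is a
   nonzero multiple of their sum, so one of them vanishes; it is not [c], as [S^2] fixes 1. *)
have : (c%:Z - c'%:Z == (c%:Z + c'%:Z) * (u%:Z - v%:Z)).
  rewrite -subr_eq0 -int0 !(rmorphB, rmorphM, rmorphD) /=.
  by rewrite -cE thE -c2E subrr.
have : u%:Z - v%:Z != 0.
  rewrite -int0 rmorphB /=; apply: contra th0 => /eqP uv.
  by rewrite thE uv mulr0.
move=> uv /eqP eqc.
have [cz|cz'] : c = 0%N \/ c' = 0%N by move: (u%:Z - v%:Z) uv eqc => m; nia.
- have := c0 cz 1; rewrite !antipode1 => /eqP; rewrite -addr_eq0 -mulr2n -scaler_nat.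
  rewrite scaler_eq0 oner_eq0 orbF; have /pcharf0P -> := char_k.
  by [].
by have := c0' cz' a; rewrite S4.
Qed.

Lemma lmb1_dim : ev lmb 1 = (dim H)%:R.
Proof.
rewrite -(ltrace_antipode2 intL frob_lmb) -ltrace_id; apply: eq_ltrace => x; exact: antipode2_id.
Qed.

(** For an idempotent [f] this converts the dimension of [f H^*] into a value at the integral. *)
Lemma ltrace_rop f : ltrace (rop f) = (dim H)%:R * ev f L.
Proof.
rewrite -lmb1_dim -ltrace_rop_antipode2; apply: eq_ltrace => x; by rewrite antipode2_id.
Qed.

Lemma lmb_tau x : ev lmb x = tau x.
Proof.
rewrite (tau_casw intL frob_lmb) (_ : casw e i0 = 1) ?mulr1 //.
rewrite /casw /cas.
transitivity (tlift (fun a b => S (S a * b)) (comul L)).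
  by apply: eq_tlift => a b; rewrite antipodeM antipode2_id.
by rewrite antipodel_tlift; [case: intL => _ _ ->; rewrite scale1r antipode1 | slin].
Qed.

End AntipodeInvolutive.

(** * Rational eigenvalues of integer matrices *)

Section IntegralEigenvalue.

Variable k : fieldType.
Hypothesis char_k : [pchar k] =i pred0.

Lemma int_eigenvalue (J : finType) (M : J -> J -> int) (y : J -> k) (c : k) :
    (exists j, y j != 0) -> (forall b, \sum_a y a * (M a b)%:~R = c * y b) ->
  exists2 P : {poly int}, P \is monic & root (map_poly intr P : {poly k}) c.
Proof.
case=> j yj eig; pose A : 'M[int]_#|J| := \matrix_(a, b) M (enum_val a) (enum_val b).
exists (char_poly A); first exact: char_poly_monic.
rewrite (map_char_poly (intr : {rmorphism int -> k})) -eigenvalue_root_char; apply/eigenvalueP.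
exists (\row_a y (enum_val a)).
  apply/rowP => b; rewrite !mxE -eig; under eq_bigr do rewrite !mxE.
  by rewrite [RHS](reindex _ (onW_bij _ (@enum_val_bij J))).
apply: contra yj => /eqP/rowP /(_ (enum_rank j)); rewrite !mxE enum_rankK => ->.
by [].
Qed.

(** Clearing denominators in [P(n/d) = 0] leaves an equation between integers, which holds in [k]
    exactly when it holds in [algC]; there [n/d] is a rational algebraic integer, hence an
    integer. *)
Lemma rational_eigenvalue_dvd (P : {poly int}) (c : k) (n d : nat) :
    P \is monic -> root (map_poly intr P : {poly k}) c -> (0 < d)%N -> c * d%:R = n%:R ->
  (d %| n)%N.
Proof.
move=> monP rP d0 cd; pose s := (size P).-1.
have s1 : size P = s.+1 by rewrite prednK // size_poly_gt0 monic_neq0.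
have hom (K : fieldType) (x : K) : x * d%:R = n%:R ->
    (\sum_(i < s.+1) P`_i * n%:Z ^+ i * d%:Z ^+ (s - i))%:~R = d%:R ^+ s * (map_poly intr P).[x].
  move=> xd; rewrite (@horner_coef_wide _ s.+1); last by rewrite -s1 size_poly.
  rewrite rmorph_sum mulr_sumr; apply: eq_bigr => i _ /=.
  rewrite coef_map !rmorphM !rmorphXn /= -!pmulrn -xd exprMn -mulrA -mulrA -exprD.
  by rewrite subnKC -1?ltnS // mulrA mulrC.
have sum0 : \sum_(i < s.+1) P`_i * n%:Z ^+ i * d%:Z ^+ (s - i) = 0 :> int.
  by apply/eqP; rewrite -(pchar0_intr_eq0 char_k) (hom _ _ cd) (eqP rP) mulr0.
pose x : algC := n%:R / d%:R.
have dC : d%:R != 0 :> algC by rewrite pnatr_eq0 -lt0n.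
have xd : x * d%:R = n%:R by rewrite divfK.
have rx : root (map_poly intr P : {poly algC}) x.
  rewrite rootE -(inj_eq (mulfI (expf_neq0 s dC))) mulr0 -hom // sum0.
  by rewrite rmorph0.
have xint : x \in Num.int.
  apply: Cint_rat_Aint; first by rewrite rpred_div // rpred_nat.
  apply: root_monic_Aint rx _ _; first exact: monic_map.
  by apply/polyOverP => i; rewrite coef_map intr_int.
have /intrP [m mE] := xint; move: xd; rewrite mE.
rewrite [d%:R]pmulrn [n%:R]pmulrn -intrM => /intr_inj mdn.
apply/dvdnP; exists (absz m); apply/eqP; rewrite -eqz_nat PoszM -mdn.
have m0 : 0 <= m by nia.
by rewrite gez0_abs.
Qed.

End IntegralEigenvalue.

(** * Characters and trace forms *)

Section CharacterRing.

Variables (k : fieldType) (H : hopfType k).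
Implicit Types a b h x y : H.
Implicit Types f g : hopf_dual H.

Local Notation S := (@antipode k H).
Local Notation ev f := (f : 'Hom(H, k^o)).

Lemma ltrace_tmap (V W : vectType k) (F : V -> V) (G : W -> W) : linear F -> linear G ->
  ltrace (tmap F G) = ltrace F * ltrace G.
Proof.
move=> lF lG.
rewrite (@ltrace_dual _ _ _ xpredT (fun p (t : tensor V W) => t p.1 p.2 : k^o)
   (fun p => tbasis p.1 ⊗ tbasis p.2)).
- rewrite /ltrace mulr_suml -(pair_big xpredT xpredT
    (fun i j => tmap F G (tbasis i ⊗ tbasis j) i j)) /=.
  apply: eq_bigr => i _; rewrite mulr_sumr; apply: eq_bigr => j _.
  rewrite /tmap tliftE; last by sbil.
  by rewrite /tprod !mxE big_ord1 !mxE.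
- by rewrite /tmap; slin.
- by move=> p c x y; rewrite !mxE.
by move=> t; rewrite {1}[t]tensor_span pair_big.
Qed.

Lemma ltrace_transpose (V : vectType k) (F : V -> V) (G : 'Hom(V, k^o) -> 'Hom(V, k^o)) :
  linear F -> linear G -> (forall phi v, G phi v = phi (F v)) -> ltrace G = ltrace F.
Proof.
move=> lF lG GE.
rewrite (@ltrace_dual _ _ _ xpredT (fun i (phi : 'Hom(V, k^o)) => phi (tbasis i))
  (fun i => dcoord i)) //.
- by apply: eq_bigr => i _; rewrite GE dcoordE.
- by move=> i; slin.
move=> phi; apply/lfunP => v; rewrite {1}[v]tbasis_sum linear_sum sum_lfunE.
by apply: eq_bigr => i _; rewrite linearZ /= scale_lfunE dcoordE scale_regC.
Qed.

(* [f] is the character of a possibly degenerate representation. *)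
Definition is_character f : Prop := exists (V : vectType k) (rho : H -> V -> V),
  [/\ forall h, linear (rho h), forall v, linear (rho^~ v),
      forall a b v, rho (a * b) v = rho a (rho b v) & forall h, ev f h = ltrace (rho h)].

Lemma is_characterM f g : is_character f -> is_character g -> is_character (f * g).
Proof.
case=> V [r [lr lr' rM rE]] [W [s [ls ls' sM sE]]].
pose rs h t := tlift (fun a b => tmap (r a) (s b) t) (comul h).
exists (tensor V W), rs; split.
- by rewrite /rs /tmap; slin.
- by rewrite /rs; slin.
- move=> a b; apply: tensor_extP => [||v w]; [by rewrite /rs /tmap; slin | by rewrite /rs /tmap; slin |].
  have E h (x : V) (y : W) : rs h (x ⊗ y) = tlift (fun a b => r a x ⊗ s b y) (comul h).
    by apply: eq_tlift => u u'; rewrite /tmap tliftE //; sbil.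
  rewrite !E comul_mul; try by slin.
  rewrite exchange_tlift (linear_tlift (f := rs a)); last by rewrite /rs /tmap; slin.
  apply: eq_tlift => b1 b2; rewrite E; apply: eq_tlift => a1 a2.
  by rewrite rM sM.
move=> h; rewrite evM /rs ltrace_tliftf; apply: (@eq_tlift _ _ _ k^o) => a b.
by rewrite ltrace_tmap // rE sE.
Qed.

Lemma is_character_antipode f : is_character f -> is_character (dual_antipode f).
Proof.
case=> V [r [lr lr' rM rE]].
have lphi h (phi : 'Hom(V, k^o)) : linear (fun v => phi (r (S h) v)) by slin.
have E h phi v : mk_hom (lphi h phi) v = phi (r (S h) v) by exact: mk_homE.
exists 'Hom(V, k^o), (fun h phi => mk_hom (lphi h phi)); split.
- by move=> h c x y; apply/lfunP => v; rewrite lfunPl !E lfunPl.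
- by move=> phi c x y; apply/lfunP => v; rewrite lfunPl !E linearP lr' linearP.
- by move=> a b phi; apply/lfunP => v; rewrite !E antipodeM rM.
move=> h; rewrite dual_antipodeE rE; apply/esym/ltrace_transpose => //.
  by move=> c x y; apply/lfunP => v; rewrite lfunPl !E lfunPl.
Qed.

Lemma is_character_idem f L : is_character f -> L * L = L -> exists m : nat, ev f L = m%:R.
Proof.
case=> V [r [lr lr' rM rE]] LL; rewrite rE; apply: ltrace_idem_nat => // v.
by rewrite -rM LL.
Qed.

(** The cocommutative elements of [H^*]; for semisimple [H] they form the character ring with
    scalars in [k], by [trace_form_expand]. *)
Definition trace_form f : Prop := forall a b, ev f (a * b) = ev f (b * a).

Lemma trace_formM f g : trace_form f -> trace_form g -> trace_form (f * g).
Proof.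
move=> fC gC a b; rewrite !evM !comul_mul; try by slin.
rewrite exchange_tlift; apply: (@eq_tlift _ _ _ k^o) => b1 b2.
by apply: (@eq_tlift _ _ _ k^o) => a1 a2; rewrite fC gC.
Qed.

Lemma trace_form_antipode f : trace_form f -> trace_form (dual_antipode f).
Proof. by move=> fC a b; rewrite !dual_antipodeE !antipodeM fC. Qed.

Lemma trace_formP c f g : trace_form f -> trace_form g -> trace_form (c *: f + g).
Proof. by move=> fC gC a b; rewrite !lfunPl fC gC. Qed.

Lemma trace_form1 : trace_form 1.
Proof. by move=> a b; rewrite !ev1 !counitM mulrC. Qed.

End CharacterRing.

(** * Orthogonality relations and the class equation *)

Section ClassEquation.

Variables (k : closedFieldType) (H : hopfType k) (n : nat) (e : 'I_n -> H) (i0 : 'I_n).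
Hypothesis char_k : [pchar k] =i pred0.
Hypothesis e_simple : simple_idempotents e.
Hypothesis intL : integral (e i0).
Variable lmb : hopf_dual H.
Hypothesis frob_lmb : frob (e i0) lmb = 1.
Implicit Types a b h x y : H.
Implicit Types f g : hopf_dual H.

Local Notation S := (@antipode k H).
Local Notation L := (e i0).
Local Notation ev f := (f : 'Hom(H, k^o)).
Local Notation SA := (@dual_antipode k H).
Local Notation T f := (ev f L).

Let S2 a : S (S a) = a := antipode2_id char_k e_simple intL frob_lmb a.

Let eE : [/\ \sum_i e i = 1, forall i j, e i * e j = if i == j then e i else 0 & forall i, e i != 0].
Proof. by case: e_simple. Qed.

Lemma T_mulC f g : T (f * g) = T (g * f).
Proof.
apply: (mulfI (dimH_neq0 H char_k)).
rewrite -!(ltrace_rop char_k e_simple intL frob_lmb).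
rewrite (eq_ltrace (ropM f g)) (eq_ltrace (ropM g f)).
by rewrite ltraceC //; apply: rop_linear.
Qed.

Definition irr_form i : hopf_dual H := mk_hom (chi_linear e_simple i).

Lemma irr_formE i x : ev (irr_form i) x = chi e i x.
Proof. exact: mk_homE. Qed.

Lemma irr_form_trace_form i : trace_form (irr_form i).
Proof. by move=> a b; rewrite !irr_formE (chi_mulC). Qed.

Lemma irr_form_character i : is_character (irr_form i).
Proof.
exists H, (fun h y => h * y * e i); split.
- by move=> h; slin.
- by move=> v; slin.
- by move=> a b v; case: eE => _ eO _; rewrite !mulrA -!mulrA eO eqxx.
by move=> h; rewrite irr_formE.
Qed.

(** The element representing the character of [H e_i] with respect to [lmb]; by [z_e] it is
    supported on the block of [e i]. *)
Let z i := cas L (fun x y => y * e i * x).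

Let X_z i x : ev (irr_form i) x = ev lmb (x * z i).
Proof.
rewrite irr_formE /chi (ltrace_cas intL frob_lmb); last by slin.
rewrite /z (cas_lin (f := fun u => ev lmb (x * u))); last by slin.
by apply: (@eq_cas _ _ _ k^o) => u v; rewrite !mulrA.
Qed.

Let z_e i j : ~~ linked e j i -> z i * e j = 0.
Proof.
move=> nl; rewrite /z (cas_lin (f := fun u => u * e j)); last by slin.
transitivity (cas L (fun x y => y * e i * (x * e j))); first by apply: eq_cas => x y; rewrite !mulrA.
rewrite (cas_r intL (F := fun x y => y * e i * x)); try by slin.
rewrite (eq_cas (G := fun _ _ => 0)) => [|x y]; last by rewrite S2 (linkedPn nl) mul0r.
by rewrite /cas /tlift big1 // => u _; rewrite big1 // => v _; rewrite scaler0.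
Qed.

(** With [d] the degree of the character, [lmb (z i)] is [chi i 1 = d] by [X_z]. It is also
    [d * chi i (z i)], because [lmb] is the sum of all [chi l] and only the [d] indices linked to
    [i] see [z i]. *)
Let X_z_val i j : ev (irr_form j) (z i) = (linked e i j)%:R.
Proof.
have nl l : ~~ linked e i l -> ev (irr_form l) (z i) = 0.
  move=> nil; rewrite irr_formE (chi_lam e_simple) big1 // => a al.
  apply: (lam_uniq e_simple); rewrite -mulrA z_e ?mulr0 ?scale0r //.
  apply: contra nil => ai; rewrite (linked_sym e_simple).
  by rewrite -(linked_eq e_simple _ al).
have [ij|/nl //] := boolP (linked e i j).
rewrite irr_formE -(chi_linked e_simple _ ij).
pose d := #|[pred j | linked e j i]|.
have d0 : d%:R != 0 :> k.
  have /pcharf0P -> := char_k; rewrite -lt0n; apply/card_gt0P; exists i.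
  by rewrite inE (linked_refl e_simple).
apply: (mulfI d0); rewrite mulr1; transitivity (ev lmb (z i)); last first.
  by rewrite -[z i]mul1r -X_z irr_formE (chi_one e_simple).
rewrite (lmb_tau char_k e_simple intL frob_lmb) (tau_chi e_simple).
rewrite (bigID (fun l => linked e l i)) /= [X in _ + X]big1 => [|l nil]; last first.
  by rewrite -irr_formE nl // (linked_sym e_simple).
rewrite addr0 (eq_bigr (fun=> chi e i (z i))) => [|l li]; last by rewrite (chi_linked e_simple _ li).
by rewrite sumr_const mulr_natl.
Qed.

(** Schur orthogonality. Writing the first character as [lmb (_ * z i)], the dual bases [L1] and
    [S(L2)] turn the pairing into the value of [irr_form j] at [z i]. *)
Lemma T_orthonormal i j : T (irr_form i * SA (irr_form j)) = (linked e i j)%:R.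
Proof.
rewrite evM -X_z_val.
transitivity (cas L (fun x y => ev (irr_form i) x * ev (irr_form j) y : k^o)).
  by apply: (@eq_tlift _ _ _ k^o) => a b; rewrite dual_antipodeE.
transitivity (cas L (fun x y => ev (irr_form j) ((ev lmb (x * z i) : k) *: y))).
  by apply: (@eq_cas _ _ _ k^o) => x y; rewrite linearZ /= X_z.
rewrite -(cas_lin (f := ev (irr_form j))); last by slin.
congr (ev (irr_form j) _).
rewrite (cas_r intL (F := fun x y => (ev lmb x : k) *: y)); try by slin.
rewrite S2 -[RHS]mulr1 -frob_lmb /frob (cas_lin (f := fun u => z i * u)); last by slin.
by apply: eq_cas => x y; rewrite -scalerAr.
Qed.

Lemma T_orthonormal_rep c d : is_crep e c -> is_crep e d -> T (irr_form c * SA (irr_form d)) = (c == d)%:R.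
Proof.
move=> Rc Rd; rewrite T_orthonormal (crep_linkedE e_simple) //.
by rewrite (eqP Rc).
Qed.

Lemma trace_form_expand f : trace_form f ->
  f = \sum_(c | is_crep e c) (T (f * SA (irr_form c)) : k) *: irr_form c.
Proof.
move=> fC.
have fE : f = \sum_(c | is_crep e c) (ev f (e c) : k) *: irr_form c.
  apply/lfunP => x; rewrite ev_sum (trace_form_chi e_simple (f := ev f)) //; last by slin.
  by apply: eq_bigr => c _; rewrite scale_lfunE irr_formE.
rewrite {1}fE; apply: eq_bigr => d Rd; congr (_ *: _).
rewrite {2}fE mulr_suml ev_sum (bigD1 d) //= big1 => [|c /andP [Rc nc]].
  by rewrite addr0 -scalerAl scale_lfunE T_orthonormal_rep // eqxx; exact/esym/mulr1.
by rewrite -scalerAl scale_lfunE T_orthonormal_rep // (negPf nc) scaler0.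
Qed.

Lemma T_character_nat f : is_character f -> exists m : nat, T f = m%:R.
Proof. by move=> cf; apply: is_character_idem => //; case: eE => _ -> _; rewrite eqxx. Qed.

Lemma T_dual_basis f g : trace_form g ->
  \sum_(i | is_crep e i) T (f * irr_form i) * T (SA (irr_form i) * g) = T (f * g).
Proof.
move=> gC; rewrite [in RHS](trace_form_expand gC) mulr_sumr ev_sum.
by apply: eq_bigr => i _; rewrite -scalerAr scale_lfunE T_mulC mulrC [in LHS]T_mulC.
Qed.

(* Kac-Zhu class equation: [1 / T f] is an eigenvalue of a matrix of multiplicities, with
   eigenvector the tensor square of the coordinates of [f]. *)
Theorem class_equation f (d : nat) : trace_form f -> f * f = f ->
    (forall g, trace_form g -> exists c : k, f * g * f = c *: f) ->
    (0 < d)%N -> ltrace (rop f) = d%:R -> (d %| dim H)%N.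
Proof.
move=> fC ff fprim d0 rd.
have nT : (dim H)%:R * T f = d%:R by rewrite -rd (ltrace_rop char_k e_simple intL frob_lmb).
have dk : d%:R != 0 :> k by have /pcharf0P -> := char_k; rewrite -lt0n.
have T0 : T f != 0 by apply: contra dk => /eqP T0; rewrite -nT T0 mulr0.
pose y c := T (f * SA (irr_form c)).
have fE := trace_form_expand fC.
(* Primitivity gives some scalar; applying [T], with [T (f * x * f) = T (f * x)], identifies it. *)
have fXf c : f * SA (irr_form c) * f = (y c / T f) *: f.
  have [m mE] := fprim _ (trace_form_antipode (irr_form_trace_form c)).
  rewrite mE; congr (_ *: _); apply: (mulIf T0); rewrite divfK // /y.
  have : T (f * SA (irr_form c) * f) = m * T f by rewrite mE scale_lfunE.
  by move=> <-; rewrite T_mulC mulrA ff.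
have cS i := is_character_antipode (irr_form_character i).
have /fin_all_exists [A AE] : forall p : 'I_n * 'I_n, exists A : 'I_n -> nat,
    forall i, T (irr_form i * irr_form p.1 * SA (irr_form p.2)) = (A i)%:R.
  move=> p.
  have /fin_all_exists [A AE] : forall i, exists m : nat,
      T (irr_form i * irr_form p.1 * SA (irr_form p.2)) = m%:R.
    move=> i; apply: T_character_nat.
    exact: is_characterM (is_characterM (irr_form_character i) (irr_form_character _)) (cS _).
  by exists A.
have /fin_all_exists [B BE] : forall p : 'I_n * 'I_n, exists B : 'I_n -> nat,
    forall i, T (SA (irr_form i) * irr_form p.1 * SA (irr_form p.2)) = (B i)%:R.
  move=> p.
  have /fin_all_exists [B BE] : forall i, exists m : nat,
      T (SA (irr_form i) * irr_form p.1 * SA (irr_form p.2)) = m%:R.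
    move=> i; apply: T_character_nat.
    exact: is_characterM (is_characterM (cS i) (irr_form_character _)) (cS _).
  by exists B.
pose R (p : 'I_n * 'I_n) := is_crep e p.1 && is_crep e p.2.
(* [M] describes left multiplication by the sum over [i] of [irr_form i] tensor [SA (irr_form i)],
   and [Y] holds the coordinates of [f] tensor [f]. The condition [R] keeps one index per
   irreducible character and fills the rest with zeros. *)
pose M (p q : 'I_n * 'I_n) : int :=
  (R q * \sum_(i | is_crep e i) A (p.1, q.1) i * B (p.2, q.2) i)%N%:Z.
pose Y (p : 'I_n * 'I_n) := if R p then y p.1 * y p.2 else 0.
have EA q i : T (irr_form i * f * SA (irr_form q)) = \sum_(c | is_crep e c) y c * (A (c, q) i)%:R.
  rewrite {1}fE mulr_sumr mulr_suml ev_sum; apply: eq_bigr => c _.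
  by rewrite -scalerAr -scalerAl scale_lfunE -AE.
have EB q i : T (SA (irr_form i) * f * SA (irr_form q)) = \sum_(c | is_crep e c) y c * (B (c, q) i)%:R.
  rewrite {1}fE mulr_sumr mulr_suml ev_sum; apply: eq_bigr => c _.
  by rewrite -scalerAr -scalerAl scale_lfunE -BE.
have [||P monP rP] := @int_eigenvalue k _ M Y (T f)^-1.
- have [c Rc yc] : exists2 c, is_crep e c & y c != 0.
    apply/exists_inP; apply: contraT => /exists_inPn h; case/eqP: T0.
    rewrite {1}fE big1 ?zero_lfunE // => c Rc.
    by have := h c Rc; rewrite negbK => /eqP; rewrite /y => ->; rewrite scale0r.
  by exists (c, c); rewrite /Y /R Rc /= mulf_neq0.
- move=> q; rewrite /Y /M; case: ifP => [Rq|nRq]; last first.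
    by rewrite mulr0 big1 // => p _; rewrite mul0n mulr0.
  transitivity (\sum_(i | is_crep e i)
    T (irr_form i * f * SA (irr_form q.1)) * T (SA (irr_form i) * f * SA (irr_form q.2))).
    rewrite (eq_bigr (fun p => \sum_(i | is_crep e i) (if R p then y p.1 * y p.2 else 0) *
       ((A (p.1, q.1) i)%:R * (B (p.2, q.2) i)%:R))) => [|p _]; last first.
      rewrite mul1n -pmulrn natr_sum mulr_sumr; apply: eq_bigr => i _.
      by rewrite natrM.
    rewrite exchange_big; apply: eq_bigr => i _ /=.
    rewrite EA EB big_distrlr /= pair_big /= [RHS]big_mkcond; apply: eq_bigr => p _.
    by rewrite -/(R p); case: ifP => _; rewrite ?mul0r // mulrACA.
  (* The sum over [i] contracts a pair of dual bases of the character ring, which joins the two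
     factors [f] in one product; [fXf] then evaluates it. *)
  have -> : \sum_(i | is_crep e i)
      T (irr_form i * f * SA (irr_form q.1)) * T (SA (irr_form i) * f * SA (irr_form q.2)) =
     T ((f * SA (irr_form q.1)) * (f * SA (irr_form q.2))).
    rewrite -T_dual_basis.
      by apply: eq_bigr => i _; rewrite -!mulrA [in LHS]T_mulC !mulrA.
    exact: trace_formM fC (trace_form_antipode (irr_form_trace_form _)).
  rewrite mulrA fXf -scalerAl scale_lfunE -/(y q.2).
  by rewrite [_ *: _]mulrAC mulrC.
(* By [nT] the eigenvalue [1 / T f] is the quotient of [dim H] by [d]. *)
apply: (rational_eigenvalue_dvd char_k monP rP d0).
by rewrite -nT mulrCA mulVf // mulr1.
Qed.

End ClassEquation.

(** * Splitting an idempotent inside a subalgebra *)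

Section IdempotentSplitting.

Variables (k : closedFieldType) (B : falgType k) (C : B -> Prop).
Hypothesis C1 : C 1.
Hypothesis CP : forall c u v, C u -> C v -> C (c *: u + v).
Hypothesis CM : forall u v, C u -> C v -> C (u * v).

Lemma subalg_horner x (p : {poly k}) : C x -> C (horner_alg x p).
Proof.
move=> Cx; elim/poly_ind: p => [|p c IH].
  by rewrite rmorph0; have := CP (-1) C1 C1; rewrite scaleN1r addNr.
rewrite rmorphD rmorphM /= horner_algX horner_algC addrC; apply: CP => //.
exact: CM.
Qed.

Lemma annihilating_poly (x : B) : exists2 P : {poly k}, P != 0 & horner_alg x P = 0.
Proof.
pose M : 'M[k]_((dim B).+1, dim B) := \matrix_i v2r (x ^+ i).
have : ~~ row_free M by rewrite /row_free neq_ltn ltnS rank_leq_col.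
rewrite -kermx_eq0 => /rowV0Pn [v /sub_kermxP vM v0].
exists (rVpoly v); first by apply: contra v0 => /eqP v0; rewrite -[v]rVpolyK v0 linear0.
apply: v2r_inj; rewrite linear0 -vM mulmx_sum_row /rVpoly poly_def rmorph_sum linear_sum /=.
apply: eq_bigr => i _; rewrite valK -mul_polyC rmorphM rmorphXn /= horner_algC horner_algX.
by rewrite -scalerAl mul1r linearZ rowK.
Qed.

Variable f : B.
Hypothesis ff : f * f = f.
Hypothesis Cf : C f.
Hypothesis f0 : f != 0.

Definition proper_idempotent e := [/\ C e, e * e = e, f * e = e, e * f = e & e != 0 /\ e != f].

(** Primary decomposition of [x] in the corner of [f]: two distinct eigenvalues there are separated
    by an idempotent that is a polynomial in [x], and otherwise [x] has a single eigenvalue [a]. *)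
Lemma idempotent_dichotomy x : C x -> f * x = x -> x * f = x ->
  (exists e, proper_idempotent e) \/ exists a m, f * (x - a%:A) ^+ m = 0.
Proof.
move=> Cx fx xf; pose phi p := f * horner_alg x p.
have comm p : horner_alg x p * f = f * horner_alg x p.
  elim/poly_ind: p => [|p c IH]; first by rewrite rmorph0 mulr0 mul0r.
  rewrite rmorphD rmorphM /= horner_algX horner_algC mulrDl mulrDr -mulrA xf mulrA -IH -mulrA fx.
  by rewrite -scalerAl -scalerAr mulr1 mul1r.
have phiM p r : phi (p * r) = phi p * phi r.
  by rewrite /phi rmorphM -{1}ff -!mulrA; congr (_ * _); rewrite !mulrA comm.
have Cphi p : C (phi p) by apply: CM => //; exact: subalg_horner.
have fphi p : f * phi p = phi p by rewrite /phi mulrA ff.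
have phif p : phi p * f = phi p by rewrite /phi -mulrA comm mulrA ff.
have phiD p r : phi (p + r) = phi p + phi r by rewrite /phi rmorphD mulrDr.
have phi1 : phi 1 = f by rewrite /phi rmorph1 mulr1.
have [P0 nz P0x] := annihilating_poly x.
have {P0x} : phi P0 = 0 by rewrite /phi P0x mulr0.
move: (leqnn (size P0)); move: {2}(size P0) => s; elim: s P0 nz => [|s IH] P nz le Px.
  by move: nz; rewrite -size_poly_eq0 -leqn0 le.
have /closed_rootP [a ra] : size P != 1%N.
  apply/negP => /size_poly1P [c c0 Pc]; case/negP: f0; move: Px.
  rewrite /phi Pc horner_algC -scalerAr mulr1 => /eqP.
  by rewrite scaler_eq0 (negPf c0).
have [m [Q Qa PQ]] := multiplicity_XsubC P a; rewrite nz /= in Qa.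
pose E := ('X - a%:P : {poly k}) ^+ m.
have m0 : (0 < m)%N.
  by rewrite lt0n; apply: contraNN Qa => /eqP m0; move: ra; rewrite PQ m0 expr0 mulr1.
have cop : coprimep E Q by rewrite coprimep_expl // coprimep_sym coprimep_XsubC.
have [[u v] /= uv] := Bezout_eq1_coprimepP _ _ cop.
have EQ : phi (E * Q) = 0 by rewrite mulrC -PQ.
have Q0 : Q != 0 by apply: contra Qa => /eqP ->; rewrite root0.
have sQ : (size Q <= s)%N.
  rewrite -ltnS (leq_trans _ le) // PQ size_Mmonic // ?monic_exp ?monicXsubC //.
  by rewrite size_exp_XsubC addnS /= -[X in (X < _)%N]addn0 ltn_add2l.
(* As [E] and [Q] are coprime with product annihilated, [g] is idempotent. If [g = 0] then [Q] alone
   annihilates [x], and its degree is smaller; if [g = f] then [E] alone does. *)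
pose g := phi (v * Q).
have g1 : f - g = phi (u * E) by rewrite -phi1 -uv phiD addrK.
have gg : g * (f - g) = 0.
  rewrite g1 -phiM (_ : v * Q * (u * E) = v * u * (E * Q)) ?(phiM (v * u)) ?EQ ?mulr0 //.
  by rewrite mulrACA [Q * E]mulrC.
have [g0|g0] := eqVneq g 0.
  apply: (IH Q) => //; rewrite -phif -[f](subr0) -{1}g0 g1 -phiM.
  by rewrite mulrCA [Q * E]mulrC phiM EQ mulr0.
have [gf|gf] := eqVneq g f; last first.
  left; exists g; split; rewrite // ?fphi ?phif //; first exact: Cphi.
  by apply/esym/eqP; rewrite -subr_eq0 -{1}(phif _ : g * f = g) -mulrBr gg.
right; exists a, m.
have : phi E = 0 by rewrite -phif -gf -phiM mulrCA phiM EQ mulr0.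
by rewrite /phi rmorphXn rmorphB /= horner_algX horner_algC.
Qed.

End IdempotentSplitting.

(** * Primitive idempotents of the character ring *)

Section PrimitiveDecomposition.

Variables (k : closedFieldType) (H : hopfType k) (n : nat) (e : 'I_n -> H) (i0 : 'I_n).
Hypothesis char_k : [pchar k] =i pred0.
Hypothesis e_simple : simple_idempotents e.
Hypothesis intL : integral (e i0).
Variable lmb : hopf_dual H.
Hypothesis frob_lmb : frob (e i0) lmb = 1.
Implicit Types a b h x y : H.
Implicit Types f g : hopf_dual H.

Local Notation L := (e i0).
Local Notation ev f := (f : 'Hom(H, k^o)).
Local Notation SA := (@dual_antipode k H).
Local Notation T f := (ev f L).
Local Notation tf := (@trace_form k H).

Lemma T_nilpotent f m : f ^+ m = 0 -> T f = 0.
Proof.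
move=> fm; apply: (mulfI (dimH_neq0 H char_k)).
rewrite -(ltrace_rop char_k e_simple intL frob_lmb) mulr0.
apply: (ltrace_nilp (m := m)); first exact: rop_linear.
have it j x : iter j (rop f) x = rop (f ^+ j) x.
  by elim: j => [|j IH]; rewrite ?rop1 // iterS IH exprSr ropM.
by move=> x; rewrite it fm /rop /tlift big1 // => i _; rewrite big1 // => j _;
  rewrite zero_lfunE scale0r scaler0.
Qed.

Definition primitive_form f := forall g, tf g -> exists c : k, f * g * f = c *: f.

(** Suppose that [x = f X f] is not a multiple of [f] and yields no idempotent: then it differs from
    such a multiple by a nilpotent [N != 0]. Orthonormality of the characters provides a product
    [w = N y] with [T w != 0], which is not nilpotent. Either [w] yields an idempotent or it divides
    a nonzero multiple of [f], which is impossible for a left multiple [N] that is nilpotent. *)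
Lemma split_or_primitive f : tf f -> f * f = f -> f != 0 ->
  primitive_form f \/ exists g, proper_idempotent tf f g.
Proof.
move=> fC ff f0.
have dich := @idempotent_dichotomy k (hopf_dual H) tf (@trace_form1 _ H) (@trace_formP _ H)
  (@trace_formM _ H) f ff fC f0.
have [/forallP pr|] := boolP [forall c, f * irr_form e_simple c * f \in <[f]>%VS].
  left=> g gC; rewrite (trace_form_expand char_k e_simple intL frob_lmb gC).
  suff /vlineP [c ->] : f * (\sum_(c | is_crep e c)
      (T (g * SA (irr_form e_simple c)) : k) *: irr_form e_simple c) * f \in <[f]>%VS by exists c.
  rewrite mulr_sumr mulr_suml; apply: memv_suml => c _.
  by rewrite -scalerAr -scalerAl memvZ.
case/forallPn => c nc; right.
set x := f * irr_form e_simple c * f in nc.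
have XC := irr_form_trace_form e_simple c.
have xC : tf x by apply: trace_formM => //; exact: trace_formM.
have fx : f * x = x by rewrite /x !mulrA ff.
have xf : x * f = x by rewrite /x -!mulrA ff.
have [//|[a [m am]]] := dich x xC fx xf.
pose N := x - a *: f.
have fN : f * N = N by rewrite mulrBr fx -scalerAr ff.
have Nf : N * f = N by rewrite mulrBl xf -scalerAl ff.
have NC : tf N by rewrite /N addrC -scaleNr; exact: trace_formP.
have N0 : N != 0.
  by apply: contra nc; rewrite subr_eq0 => /eqP ->; rewrite memvZ // memv_line.
have NE : N = f * (x - a%:A) by rewrite mulrBr fx -scalerAr mulr1.
have Nm j : f * N ^+ j = f * (x - a%:A) ^+ j.
  elim: j => [//|j IH]; rewrite !exprSr !mulrA IH {1}NE.
  have comm : f * (x - a%:A) = (x - a%:A) * f.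
    by rewrite mulrBr mulrBl fx xf -scalerAr -scalerAl mul1r mulr1.
  have commX i : f * (x - a%:A) ^+ i = (x - a%:A) ^+ i * f.
    by elim: i => [|i IHi]; rewrite ?mulr1 ?mul1r // exprS mulrA comm -!mulrA IHi.
  by rewrite mulrA commX -[X in X * _]mulrA ff.
have {m am} [m Nm0 Nm1] : exists2 m, N ^+ m.+1 != 0 & N ^+ m.+1 * N = 0.
  have : exists j, N ^+ j * N == 0.
    by exists m; rewrite -exprSr exprS -{1}Nf -mulrA Nm am mulr0.
  move=> ex; case: (ex_minnP ex) => [[|j] /eqP j0 jmin].
    by case/eqP: N0; rewrite -j0 expr0 mul1r.
  exists j => //; rewrite exprSr; apply/negP => /jmin.
  by rewrite ltnn.
have [d dP] : exists d, T (N * SA (irr_form e_simple d)) != 0.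
  apply/existsP; apply: contraT => /existsPn h; case/eqP: N0.
  rewrite (trace_form_expand char_k e_simple intL frob_lmb NC) big1 // => d _.
  by have := h d; rewrite negbK => /eqP ->; rewrite scale0r.
pose y := f * SA (irr_form e_simple d) * f; pose w := N * y.
have yC : tf y.
  by do !apply: trace_formM => //; apply/trace_form_antipode/irr_form_trace_form.
have wC : tf w by exact: trace_formM.
have fw : f * w = w by rewrite /w mulrA fN.
have wf : w * f = w by rewrite /w /y -!mulrA ff.
have Tw : T w != 0.
  rewrite /w /y !mulrA Nf (T_mulC char_k e_simple intL frob_lmb) !mulrA fN.
  by [].
have [//|[b [l bl]]] := dich w wC fw wf.
exfalso.
have [b0|b0] := eqVneq b 0.
  case/eqP: Tw; apply: (@T_nilpotent _ l.+1).
  move: bl; rewrite b0 scale0r subr0 => bl.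
  by rewrite exprS -{1}wf -mulrA bl mulr0.
(* Expanding the power modulo the right ideal of [w] leaves the constant term; as [b != 0], a
   nonzero multiple of [f] lies in that ideal. *)
have [t tE] : exists t, f * (w - b%:A) ^+ l = w * t + (- b) ^+ l *: f.
  elim: (l) => [|j [t IH]]; first by exists 0; rewrite mulr0 add0r scale1r mulr1.
  exists (t * (w - b%:A) + (- b) ^+ j *: f); rewrite exprSr mulrA IH mulrDl [w * (_ + _)]mulrDr mulrA.
  rewrite -addrA; congr (_ + _).
  rewrite -scalerAl mulrBr fw -!scalerAr mulr1 wf scalerBr scalerA exprSr mulrN.
  by rewrite scaleNr.
have {tE} : w * t = - (- b) ^+ l *: f.
  by apply/eqP; rewrite scaleNr -addr_eq0 -tE bl.
have c0 : - (- b) ^+ l != 0 by rewrite oppr_eq0 expf_neq0 // oppr_eq0.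
move: (- (- b) ^+ l) c0 => c0 nc0 wt.
case/eqP: Nm0; rewrite exprSr -{2}Nf mulrA -exprSr; apply: (scalerI nc0).
by rewrite scaler0 scalerAr -wt /w -[N * y * t]mulrA [N ^+ _ * _]mulrA Nm1 mul0r.
Qed.

End PrimitiveDecomposition.

(** * Idempotents of rank one *)

Section RankOne.

Variables (k : fieldType) (H : hopfType k).
Implicit Types f g : hopf_dual H.
Local Notation eps := (@counit k H).
Local Notation ev f := (f : 'Hom(H, k^o)).

Lemma counit_rop f x : eps (rop f x) = ev f x.
Proof. by rewrite -ev1 ev_rop mulr1. Qed.

(** [d] is the rank of [rop f]. If it is 1, then [f * g] is [g c] times [f] for every [g];
    associativity makes [g |-> g c] multiplicative on [H^*], which says that [c] is group-like. *)
Lemma idempotent_rank f : f * f = f -> exists d : nat,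
  [/\ ltrace (rop f) = d%:R, d = 0%N -> f = 0
    & d = 1%N -> exists2 c : H, grouplike c & forall x, rop f x = (ev f x : k) *: c].
Proof.
move=> ff; have [|d [dE d0 d1]] := ltrace_idem (rop_linear f).
  by move=> x; rewrite -ropM ff.
exists d; split=> // [/d0 h|/d1 [phi [v [lphi rE]]]].
  by apply/lfunP => x; rewrite zero_lfunE -counit_rop h linear0.
have fE x : ev f x = phi x * eps v by rewrite -counit_rop rE linearZ.
have [v0|v0] := eqVneq (eps v) 0.
  have f0 : f = 0 by apply/lfunP => x; rewrite zero_lfunE fE v0 mulr0.
  exists 1; first exact: grouplike1.
  move=> x; rewrite f0 zero_lfunE scale0r /rop /tlift big1 // => i _.
  by rewrite big1 // => j _; rewrite zero_lfunE scale0r scaler0.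
pose c := ((eps v)^-1 : k) *: v.
have rc x : rop f x = (ev f x : k) *: c by rewrite rE fE scalerA mulfK.
have [f0|f0] := eqVneq f 0.
  exists 1; first exact: grouplike1.
  by move=> x; rewrite rc f0 zero_lfunE !scale0r.
have fg g : f * g = (ev g c : k) *: f.
  by apply/lfunP => x; rewrite -ev_rop rc linearZ scale_lfunE scale_regC.
have inj (a b : k) : a *: f = b *: f -> a = b.
  by move/eqP; rewrite -subr_eq0 -scalerBl scaler_eq0 (negPf f0) orbF subr_eq0 => /eqP.
exists c => //; apply/grouplikeP; split; last first.
  by apply: inj; rewrite -ev1 -fg mulr1 scale1r.
apply: tensor_sep => g h; rewrite -[LHS](@evM _ _ g h) tliftE; last by sbil.
by apply: inj; rewrite -fg mulrA fg -scalerAl fg scalerA.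
Qed.

End RankOne.

(** * From small rank to group-like elements *)

Section GrouplikeSpan.

Variables (k : closedFieldType) (H : hopfType k).
Hypothesis char_k : [pchar k] =i pred0.
Hypothesis ssH : semisimple_algebra H.
Implicit Types a b h x : H.
Implicit Types f g : hopf_dual H.

Local Notation S := (@antipode k H).
Local Notation ev f := (f : 'Hom(H, k^o)).
Local Notation tf := (@trace_form k H).

Let frob_data : exists n (e : 'I_n -> H) i0 (lmb : hopf_dual H),
  [/\ simple_idempotents e, integral (e i0) & frob (e i0) lmb = 1].
Proof.
have [n [e es]] := semisimple_idempotents ssH.
have [i0 intL _] := integral_of_idempotents es.
by have [lmb lE] := frob_surj intL 1; exists n, e, i0, lmb.
Qed.

Lemma semisimple_integral : exists L : H, integral L.
Proof. by have [n [e [i0 [lmb [_ h _]]]]] := frob_data; exists (e i0). Qed.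

Lemma semisimple_antipode2 a : S (S a) = a.
Proof. by have [n [e [i0 [lmb [es iL fr]]]]] := frob_data; exact: (antipode2_id char_k es iL fr). Qed.

Lemma semisimple_ltrace_rop L f : integral L -> ltrace (rop f) = (dim H)%:R * ev f L.
Proof.
move=> iL; have [n [e [i0 [lmb [es iL' fr]]]]] := frob_data.
have -> : L = e i0.
  case: iL iL' => _ Lh eL [hL _ eL'].
  by have := Lh (e i0); rewrite hL eL eL' !scale1r.
exact: (ltrace_rop char_k es iL' fr).
Qed.

Lemma natrI_pchar0 (a b : nat) : a%:R = b%:R :> k -> a = b.
Proof.
have /pcharf0P h := char_k.
wlog le : a b / (a <= b)%N.
  by move=> WL E; have [/WL|/ltnW /WL] := leqP a b; [apply | move->].
move/eqP; rewrite eq_sym -subr_eq0 -natrB // h subn_eq0 => ba.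
by apply/eqP; rewrite eqn_leq le ba.
Qed.

(** Induction on a bound [d] for the rank: a proper idempotent [g] and its complement [f - g] are
    nonzero, and their ranks add up to that of [f]. *)
Lemma primitive_decomposition f : tf f -> f * f = f ->
  exists r : seq (hopf_dual H), f = \sum_(e <- r) e /\
    {in r, forall e, [/\ tf e, e * e = e, primitive_form e & e != 0]}.
Proof.
have [n [e0 [i0 [lmb [es iL fr]]]]] := frob_data.
have [d] : exists d : nat, f * f = f -> exists2 d' : nat, ltrace (rop f) = d'%:R & (d' <= d)%N.
  have [ff|nff] := eqVneq (f * f) f; last by exists 0%N => /eqP; rewrite (negPf nff).
  by have [d [dE _ _]] := idempotent_rank ff; exists d => _; exists d.
elim: d f => [|d IH] f fd fC ff; have [d' d'E le] := fd ff.
  have [d1 [d1E d10 _]] := idempotent_rank ff.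
  exists [::]; split; last by [].
  rewrite big_nil d10 //; apply: natrI_pchar0; rewrite -d1E d'E.
  by move: le; rewrite leqn0 => /eqP ->.
have [f0|f0] := eqVneq f 0; first by exists [::]; rewrite big_nil.
have [pf|[g [gC gg fg gf [g0 gnf]]]] := split_or_primitive char_k es iL fr fC ff f0.
  exists [:: f]; rewrite big_seq1; split=> // e; rewrite inE => /eqP -> //.
have hh : (f - g) * (f - g) = f - g.
  by rewrite mulrBl !mulrBr ff fg gf gg subrr subr0.
have hC : tf (f - g) by rewrite addrC -scaleN1r; exact: trace_formP.
have [dg [dgE dg0 _]] := idempotent_rank gg.
have [dh [dhE dh0 _]] := idempotent_rank hh.
have dsum : (dg + dh = d')%N.
  apply: natrI_pchar0; rewrite natrD -dgE -dhE -d'E -ltraceD; apply: eq_ltrace => x.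
  by rewrite -ropD addrC subrK.
have dg1 : (0 < dg)%N by rewrite lt0n; apply: contra g0 => /eqP /dg0 ->.
have dh1 : (0 < dh)%N.
  by rewrite lt0n; apply: contra gnf => /eqP /dh0 /eqP; rewrite subr_eq0 eq_sym.
have [|r1 [r1E r1P]] := IH g _ gC gg; first by move=> _; exists dg => //; lia.
have [|r2 [r2E r2P]] := IH (f - g) _ hC hh; first by move=> _; exists dh => //; lia.
exists (r1 ++ r2); split; first by rewrite big_cat /= -r1E -r2E addrC subrK.
by move=> e; rewrite mem_cat => /orP [/r1P|/r2P].
Qed.

(* [Lam] is the idempotent of a Hopf subalgebra of dual index [m]; each of its primitive
   summands has dimension dividing [dim H], hence dimension one. *)
Theorem small_index_grouplikes (Lam : hopf_dual H) (m : nat) :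
    tf Lam -> Lam * Lam = Lam -> ev Lam 1 = 1 -> ltrace (rop Lam) = m%:R ->
    (forall d, (d %| dim H)%N -> (d < m)%N -> d = 1%N) ->
  exists (r : seq (hopf_dual H)) (c : hopf_dual H -> H),
    {in r, forall e, grouplike (c e)} /\
    forall h, rop Lam h = \sum_(e <- r) (ev e h : k) *: c e.
Proof.
move=> LC LL L1 Lm small.
have [n [e0 [i0 [lmb [es iL fr]]]]] := frob_data.
have d0 := dimH_neq0 H char_k.
have l1 := lmb1_dim char_k es iL fr.
pose l0 := ((dim H)%:R^-1 : k) *: lmb.
have lC : tf lmb by move=> a b; rewrite !(lmb_tau char_k es iL fr) (tau_mulC es).
(* [lmb] is a left integral as well: [lmb 1 = dim H] is nonzero, so the modular element is 1. *)
have Ll : Lam * lmb = lmb.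
  rewrite (lmb_left iL fr); have := lop_lmb iL fr 1.
  rewrite /lop comul_one; try by slin.
  by rewrite l1 => /(scalerI d0) <-; rewrite L1 scale1r.
have lL : lmb * Lam = lmb by rewrite (lmb_right iL fr) L1 scale1r.
have ll : l0 * l0 = l0.
  by rewrite /l0 -scalerAl -scalerAr (lmb_right iL fr) l1 !scalerA mulrAC -mulrA mulfV // mulr1.
have Ll0 : Lam * l0 = l0 by rewrite -scalerAr Ll.
have l0L : l0 * Lam = l0 by rewrite -scalerAl lL.
(* Removing [l0], of rank one, keeps the rank of every summand strictly below [m], as [small]
   requires. *)
pose f := Lam - l0.
have ff : f * f = f by rewrite mulrBl !mulrBr LL Ll0 l0L ll subrr subr0.
have fC : tf f.
  rewrite /f /l0 addrC -scaleNr; exact: trace_formP.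
have l0r : ltrace (rop l0) = 1.
  rewrite (ltrace_rop char_k es iL fr) scale_lfunE (lmb_integral iL fr) mulrA.
  by rewrite [_ * _^-1]mulfV // mulr1.
have fr1 : ltrace (rop f) + 1 = m%:R.
  transitivity (ltrace (rop f) + ltrace (rop l0)); first by rewrite l0r.
  by rewrite -ltraceD -Lm; apply: eq_ltrace => x; rewrite -ropD subrK.
have [r [fE rP]] := primitive_decomposition fC ff.
have rank1 : {in r, forall e, ltrace (rop e) = 1}.
  have rk (s : seq (hopf_dual H)) : {in s, forall e, e * e = e} -> exists2 t : nat,
      \sum_(e <- s) ltrace (rop e) = t%:R & forall e d, e \in s -> ltrace (rop e) = d%:R -> (d <= t)%N.
    elim: s => [|e s IH] sP; first by exists 0%N; rewrite ?big_nil.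
    have [|t tE tP] := IH; first by move=> e' e's; apply: sP; rewrite inE e's orbT.
    have [d [dE _ _]] := idempotent_rank (sP e (mem_head _ _)).
    exists (d + t)%N; first by rewrite big_cons tE dE natrD.
    move=> e' d'; rewrite inE => /orP [/eqP ->|e's e'E].
      by rewrite dE => /natrI_pchar0 <-; rewrite leq_addr.
    by rewrite (leq_trans (tP _ _ e's e'E)) // leq_addl.
  have [|t tE tP] := rk r; first by move=> e /rP [].
  move=> e er; have [eC ee pe ne] := rP e er.
  have [d [dE dz _]] := idempotent_rank ee.
  have d1 : (0 < d)%N by rewrite lt0n; apply: contra ne => /eqP /dz ->.
  have tm : (t + 1 = m)%N.
    apply: natrI_pchar0; rewrite natrD -tE -fr1; congr (_ + _).
    rewrite -ltrace_sum; apply: eq_ltrace => x; by rewrite fE rop_sum.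
  rewrite dE (small d) //; last by have := tP e d er dE; lia.
  exact: (class_equation char_k es iL fr eC ee pe d1 dE).
have one e : e * e = e -> ltrace (rop e) = 1 ->
    exists2 c : H, grouplike c & forall x, rop e x = (ev e x : k) *: c.
  move=> ee e1; have [d [dE _ d1]] := idempotent_rank ee; apply: d1.
  by apply: natrI_pchar0; rewrite -dE e1.
(* The group-like elements of the summands are collected in one function; its value 1 off the list
   is a filler. *)
have [c cP] : exists c : hopf_dual H -> H, {in l0 :: r, forall e,
    grouplike (c e) /\ forall x, rop e x = (ev e x : k) *: c e}.
  have : {in l0 :: r, forall e, e * e = e /\ ltrace (rop e) = 1}.
    move=> e; rewrite inE => /orP [/eqP ->|er]; first by [].
    by split; [case: (rP e er) | exact: rank1].
  elim: (l0 :: r) => [|e s IH] sP; first by exists (fun=> 1).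
  have [|c cP] := IH; first by move=> e' e's; apply: sP; rewrite inE e's orbT.
  have [ee e1] := sP e (mem_head _ _); have [c0 gc0 c0P] := one e ee e1.
  exists (fun g : hopf_dual H => if g == e then c0 else c g) => e'.
  by rewrite inE; have [->|ne] /= := eqVneq e' e; last exact: cP.
exists (l0 :: r), c; split; first by move=> e /cP [].
move=> h; have -> : Lam = \sum_(e <- l0 :: r) e by rewrite big_cons -fE addrC subrK.
rewrite rop_sum; apply: eq_big_seq => e /cP [_ ->].
by [].
Qed.

End GrouplikeSpan.

(** * Group algebras spanned by group-like elements *)

Section LRMorphism.

Variables (k : fieldType) (A B : falgType k).

Lemma lrmorphism_of (f : A -> B) : linear f -> f 1 = 1 -> {morph f : x y / x * y} ->
  exists F : {lrmorphism A -> B}, F =1 f.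
Proof.
move=> lf f1 fM.
pose F : {lrmorphism A -> B} := HB.pack f (GRing.isLinear.Build _ _ _ _ _ lf)
  (GRing.isMonoidMorphism.Build A B f (f1, fM)).
by exists F.
Qed.

End LRMorphism.

Section GrouplikeGroup.

Variables (k : fieldType) (H : hopfType k).
Local Notation S := (@antipode k H).

Lemma grouplike_group (s : seq H) : uniq s -> {in s, forall a, grouplike a} -> 1 \in s ->
    {in s &, forall a b, a * b \in s} -> {in s, forall a, S a \in s} ->
  exists (gT : finGroupType) (iota : gT -> H), [/\ injective iota,
    forall a, a \in s <-> exists g, a = iota g, iota 1%g = 1,
    forall x y, iota (x * y)%g = iota x * iota y & forall x, iota x^-1%g = S (iota x)].
Proof.
move=> us gl s1 sM sS.
pose mulT (a b : seq_sub s) : seq_sub s := SeqSub (sM _ _ (ssvalP a) (ssvalP b)).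
pose oneT : seq_sub s := SeqSub s1.
pose invT (a : seq_sub s) : seq_sub s := SeqSub (sS _ (ssvalP a)).
have mA : associative mulT by move=> a b c; apply: val_inj; rewrite /= mulrA.
have m1 : left_id oneT mulT by move=> a; apply: val_inj; rewrite /= mul1r.
have mV : left_inverse oneT invT mulT.
  by move=> a; apply: val_inj; rewrite /= grouplike_mulVr //; apply/gl/ssvalP.
pose gT : finGroupType := HB.pack (seq_sub s) (Finite_isGroup.Build (seq_sub s) mA m1 mV).
exists gT, (fun x : gT => ssval (x : seq_sub s)); split=> //.
- exact: val_inj.
move=> a; split=> [aS|[g ->]]; last exact: (ssvalP (g : seq_sub s)).
by exists (SeqSub aS : seq_sub s).
Qed.

Variables (gT : finGroupType) (iota : gT -> H).
Hypothesis iota_inj : injective iota.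
Hypothesis iota_gl : forall g, grouplike (iota g).
Hypothesis iota1 : iota 1%g = 1.
Hypothesis iotaM : forall x y, iota (x * y)%g = iota x * iota y.
Hypothesis iotaV : forall x, iota x^-1%g = S (iota x).
Local Notation kG := (group_algebra k gT).

Lemma group_algebra_morphism : exists i : {lrmorphism kG -> H},
  [/\ hopf_morphism i, injective i & forall g, i (gdelta k g) = iota g].
Proof.
pose f : kG -> H := glift iota.
have lf : linear f by move=> c x y; rewrite /f linearP.
have fd g : f (gdelta k g) = iota g by rewrite /f gliftE.
have fM : {morph f : x y / x * y}.
  move=> x y; move: x; apply: group_algebra_ext => [||g].
  - by move=> c u v; rewrite mulPl lf.
  - by move=> c u v; rewrite lf mulPl.
  move: y; apply: group_algebra_ext => [||h].
  - by move=> c u v; rewrite mulPr lf.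
  - by move=> c u v; rewrite lf mulPr.
  by rewrite -[_ * gdelta k h]/(group_mul _ _) group_mulE !fd iotaM.
have f1 : f 1 = 1 by rewrite -iota1 -fd.
have [F FE] := lrmorphism_of lf f1 fM.
have lF : linear F by exact: linearP.
exists F; split; last by move=> g; rewrite FE.
- split.
  + apply: group_algebra_ext => [||g].
    * by move=> c u v; rewrite !linearP.
    * by rewrite /tmap; slin.
    case/grouplikeP: (iota_gl g) => cg _.
    rewrite FE fd cg -[comul (gdelta k g)]/(group_comul _) /group_comul gliftE.
    by rewrite tmapE -fd -FE.
  + apply: group_algebra_ext => [||g].
    * by move=> c u v; rewrite !linearP.
    * by move=> c u v; rewrite !linearP.
    case/grouplikeP: (iota_gl g) => _ eg.
    by rewrite FE fd eg -[counit (gdelta k g)]/(group_counit _) /group_counit gliftE.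
  apply: group_algebra_ext => [||g].
  + by move=> c u v; rewrite !linearP.
  + by move=> c u v; rewrite !linearP.
  by rewrite FE fd -iotaV -[antipode (gdelta k g)]/(group_antipode _) /group_antipode gliftE FE fd.
have ker x : F x = 0 -> x = 0.
  rewrite FE => x0; apply/ffunP => g; rewrite ffunE.
  apply: (@grouplike_free _ H gT (index_enum gT) iota (fun g => (x : {ffun gT -> k^o}) g)) => //.
  - exact: index_enum_uniq.
  - by move=> u v _ _; exact: iota_inj.
  - exact: mem_index_enum.
by move=> x y xy; apply/eqP; rewrite -subr_eq0; apply/eqP/ker; rewrite linearB /= xy subrr.
Qed.

End GrouplikeGroup.

(** * The quotient onto functions on a group of characters *)

Section FunctionAlgebraQuotient.

Variables (k : fieldType) (H : hopfType k) (gT : finGroupType) (iota : gT -> hopf_dual H).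
Hypothesis iota_inj : injective iota.
Hypothesis iota_gl : forall g, grouplike (iota g).
Hypothesis iota1 : iota 1%g = 1.
Hypothesis iotaM : forall x y, iota (x * y)%g = iota x * iota y.
Hypothesis iotaV : forall x, iota x^-1%g = dual_antipode (iota x).
Local Notation kG := (group_algebra k gT).
Local Notation ev f := (f : 'Hom(_, k^o)).

Lemma dual_grouplike (f : hopf_dual H) : grouplike f ->
  (forall a b, ev f (a * b) = ev f a * ev f b) /\ ev f 1 = 1.
Proof.
case/grouplikeP => cf ef; split=> [a b|]; last exact: ef.
by rewrite -lshift_dualE -dual_comul_contract -[dual_comul f]/(comul f) cf contractE scale_lfunE.
Qed.

Lemma group_dual_ext (f f' : hopf_dual kG) :
  (forall g, ev f (gdelta k g) = ev f' (gdelta k g)) -> f = f'.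
Proof. by move=> ff; apply/lfunP; apply: group_algebra_ext => //; exact: linearP. Qed.

Let pi_lin (h : H) : linear (glift (fun g => ev (iota g) h) : kG -> k^o).
Proof. exact: linearP. Qed.

(** Evaluation at group-like elements of [H^*], which are algebra maps; it is the transpose of the
    inclusion of their group algebra into [H^*]. *)
Lemma function_algebra_quotient : exists p : {lrmorphism H -> hopf_dual kG},
  [/\ hopf_morphism p, forall b, exists h, p h = b
    & forall h g, ev (p h) (gdelta k g) = ev (iota g) h].
Proof.
pose f h : hopf_dual kG := mk_hom (pi_lin h).
have fd h g : ev (f h) (gdelta k g) = ev (iota g) h by rewrite /f mk_homE gliftE.
have lf : linear f.
  by move=> c x y; apply: group_dual_ext => g; rewrite lfunPl !fd linearP.
have comulG g : comul (gdelta k g : kG) = gdelta k g ⊗ gdelta k g by exact: gliftE.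
have f1 : f 1 = 1.
  apply: group_dual_ext => g; rewrite fd ev1 (dual_grouplike (iota_gl g)).2.
  exact/esym/gliftE.
have fM : {morph f : x y / x * y}.
  move=> x y; apply: group_dual_ext => g; rewrite evM comulG tliftE; last by sbil.
  by rewrite !fd (dual_grouplike (iota_gl g)).1.
have [F FE] := lrmorphism_of lf f1 fM.
have Fd h g : ev (F h) (gdelta k g) = ev (iota g) h by rewrite FE.
have lF a : linear (fun u => ev (F u) a : k^o) by move=> c x y; rewrite linearP lfunPl.
have gM g g' : gdelta k g * gdelta k g' = gdelta k (g * g')%g :> kG by exact: group_mulE.
exists F; split=> //.
- split.
  + move=> h; apply: dual_separate => a b.
    transitivity (tlift (fun u v => ev (F u) a * ev (F v) b : k^o) (comul h)); last first.
      move: (comul h); apply: tensor_extP => [||u v]; first by slin.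
        by rewrite /tmap; slin.
      rewrite tliftE; last by sbil.
      by rewrite tmapE contractE scale_lfunE.
    rewrite -[comul (F h)]/(dual_comul (F h)) dual_comul_contract lshift_dualE.
    move: a; apply: (@group_algebra_ext k gT k^o (fun a => ev (F h) (a * b))) => [||g]; [by slin | by slin |].
    move: b; apply: (@group_algebra_ext k gT k^o (fun b => ev (F h) (gdelta k g * b))) => [||g'];
      [by slin | by slin |].
    rewrite gM Fd iotaM evM.
    by apply: (@eq_tlift _ _ _ k^o) => u v; rewrite !Fd.
  + move=> h; rewrite -[counit (F h)]/(ev (F h) (gdelta k 1%g)) Fd iota1.
    exact: ev1.
  move=> h; apply: group_dual_ext => g.
  rewrite -[antipode (F h)]/(dual_antipode (F h)) dual_antipodeE.
  have -> : antipode (gdelta k g : kG) = gdelta k g^-1%g by exact: gliftE.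
  by rewrite !Fd iotaV dual_antipodeE.
(* [M] pairs the group-like elements with a basis of [H]. Their independence makes its rows
   independent, so every function on [gT] is attained. *)
move=> b; pose M : 'M[k]_(#|gT|, dim H) :=
  \matrix_(j, i) ev (iota (enum_val j)) (tbasis i).
have free : row_free M.
  rewrite -kermx_eq0; apply/rowV0P => v /sub_kermxP vM.
  apply/rowP => j; rewrite mxE.
  apply: (@grouplike_free _ (hopf_dual H) _ (index_enum _) (fun j : 'I_#|gT| => iota (enum_val j))
    (v 0)) => //.
  - exact: index_enum_uniq.
  - by move=> x y _ _ /iota_inj /enum_val_inj.
  apply/lfunP => x; rewrite zero_lfunE [x]tbasis_sum linear_sum; apply: big1 => i _.
  rewrite linearZ /= ev_sum; have /rowP /(_ i) := vM; rewrite !mxE => vMi.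
  rewrite (eq_bigr (fun j => v 0 j * M j i)) => [|l _]; last by rewrite scale_lfunE mxE.
  by rewrite vMi scaler0.
have full : row_full M^T by rewrite /row_full mxrank_tr.
have /row_fullP [B BE] := full.
pose w : 'rV[k]_#|gT| := \row_j ev b (gdelta k (enum_val j)).
exists (r2v (w *m B)); apply: group_dual_ext => g; rewrite Fd.
have : (w *m B *m M^T) 0 (enum_rank g) = w 0 (enum_rank g) by rewrite -mulmxA BE mulmx1.
rewrite [w 0 _]mxE enum_rankK => <-; rewrite mxE [X in ev _ X]tbasis_sum r2vK linear_sum.
by apply: eq_bigr => i _; rewrite linearZ /= !mxE enum_rankK.
Qed.

End FunctionAlgebraQuotient.

(** * Coinvariants as fixed points *)

Section Coinvariants.

Variables (k : fieldType) (H : hopfType k) (gT : finGroupType) (iota : gT -> hopf_dual H).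
Local Notation kG := (group_algebra k gT).
Local Notation ev f := (f : 'Hom(_, k^o)).
Variable p : {lrmorphism H -> hopf_dual kG}.
Hypothesis pE : forall h g, ev (p h) (gdelta k g) = ev (iota g) h.

Lemma bidual (V : vectType k) (g : 'Hom('Hom(V, k^o), k^o)) :
  exists b : V, forall f : 'Hom(V, k^o), g f = f b.
Proof.
exists (\sum_i (g (dcoord i) : k) *: tbasis i) => f.
have -> : f = \sum_i (f (tbasis i) : k) *: dcoord i.
  apply/lfunP => v; rewrite {1}[v]tbasis_sum linear_sum sum_lfunE.
  by apply: eq_bigr => i _; rewrite linearZ scale_lfunE dcoordE scale_regC.
rewrite linear_sum sum_lfunE; apply: eq_bigr => i _; rewrite linearZ scale_lfunE /=.
congr (_ *: _); rewrite linear_sum (bigD1 i) //= big1 => [|j nj].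
  by rewrite addr0 linearZ /= dcoordE /tbasis r2vK mxE !eqxx; exact/esym/mulr1.
by rewrite linearZ /= dcoordE /tbasis r2vK mxE eqxx eq_sym (negPf nj) scaler0.
Qed.

(** By [bidual] every functional on the dual of the group algebra is evaluation at an element of it,
    and the [gdelta] span; so coinvariance is one condition for each group element. *)
Lemma right_coinvP h : reflect (forall g, lop (iota g) h = h) (h \in right_coinv p).
Proof.
have lp b : linear (fun u => ev (p u) b : k^o) by move=> c x y; rewrite linearP lfunPl.
have e1 g : ev (1 : hopf_dual kG) (gdelta k g) = 1 by rewrite ev1; exact: gliftE.
apply: (iffP eqP) => [E g|E].
  have := congr1 (tlift (fun (u : H) (f : hopf_dual kG) => (ev f (gdelta k g) : k) *: u)) E.
  rewrite tliftE; last by sbil.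
  rewrite e1 scale1r => E'; rewrite -[RHS]E' /lop /rop; move: (comul h); apply: tensor_extP => [||u v].
  - by slin.
  - by rewrite /tmap; slin.
  rewrite tmapE !tliftE; try by sbil.
  by rewrite pE.
apply: tensor_sep => f f'; have [b bE] := bidual f'.
transitivity (tlift (fun u v => ev f u * ev (p v) b : k^o) (comul h)).
  move: (comul h); apply: tensor_extP => [||u v]; [by rewrite /tmap; slin | by slin |].
  rewrite tmapE !tliftE; try by sbil.
  by rewrite bE.
rewrite tliftE; last by sbil.
rewrite bE; move: b {bE}.
apply: (@group_algebra_ext k gT k^o (fun b => tlift (fun u v => ev f u * ev (p v) b : k^o) (comul h)))
  => [||g]; [by slin | by slin |].
rewrite e1 mulr1 -{2}(E g) ev_lop evM.
by apply: (@eq_tlift _ _ _ k^o) => u v; rewrite pE.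
Qed.

Lemma left_coinvP h : reflect (forall g, rop (iota g) h = h) (h \in left_coinv p).
Proof.
have lp b : linear (fun u => ev (p u) b : k^o) by move=> c x y; rewrite linearP lfunPl.
have e1 g : ev (1 : hopf_dual kG) (gdelta k g) = 1 by rewrite ev1; exact: gliftE.
apply: (iffP eqP) => [E g|E].
  have := congr1 (tlift (fun (f : hopf_dual kG) (u : H) => (ev f (gdelta k g) : k) *: u)) E.
  rewrite tliftE; last by sbil.
  rewrite e1 scale1r => E'; rewrite -[RHS]E' /lop /rop; move: (comul h); apply: tensor_extP => [||u v].
  - by slin.
  - by rewrite /tmap; slin.
  rewrite tmapE !tliftE; try by sbil.
  by rewrite pE.
apply: tensor_sep => f' f; have [b bE] := bidual f'.
transitivity (tlift (fun v u => ev (p v) b * ev f u : k^o) (comul h)).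
  move: (comul h); apply: tensor_extP => [||u v]; [by rewrite /tmap; slin | by slin |].
  rewrite tmapE !tliftE; try by sbil.
  by rewrite bE.
rewrite tliftE; last by sbil.
rewrite bE; move: b {bE}.
apply: (@group_algebra_ext k gT k^o (fun b => tlift (fun v u => ev (p v) b * ev f u : k^o) (comul h)))
  => [||g]; [by slin | by slin |].
rewrite e1 mul1r -{2}(E g) ev_rop evM.
by apply: (@eq_tlift _ _ _ k^o) => u v; rewrite pE.
Qed.

End Coinvariants.

Section Identity.

Variables (k : fieldType) (H : hopfType k).

Lemma hopf_id : exists i : {lrmorphism H -> H}, hopf_morphism i /\ i =1 id.
Proof.
have [F FE] := @lrmorphism_of k H H id (@linear_id _ _) erefl (fun _ _ => erefl).
exists F; split=> //; split=> h; rewrite ?FE //.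
by move: (comul h); apply: tensor_extP => [||u v]; rewrite /tmap; [by [] | slin |
  rewrite tliftE ?FE //; sbil].
Qed.

Lemma hopf_iso_refl : hopf_iso H H.
Proof. by have [F [hF FE]] := hopf_id; exists F; split=> //; exists id => x; rewrite FE. Qed.

End Identity.

(** * Group-like elements fixed by a group of characters *)

Section GrouplikeCombinations.

Variables (k : fieldType) (H : hopfType k).

(** Different summands may carry the same group-like element; their coefficients are added so that
    independence applies. *)
Lemma grouplike_collect (I : eqType) (r : seq I) (c : I -> H) (a : I -> k) :
  exists d : H -> k, \sum_(i <- r) a i *: c i = \sum_(x <- undup (map c r)) d x *: x.
Proof.
exists (fun x => \sum_(i <- r | c i == x) a i).
under [RHS]eq_bigr => x _ do rewrite scaler_suml big_mkcond /=.
rewrite exchange_big; apply: eq_big_seq => i ir /=.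
rewrite (bigD1_seq (c i)) ?undup_uniq ?mem_undup ?map_f //= eqxx big1 ?addr0 // => x.
by rewrite eq_sym => /negPf ->.
Qed.

Lemma grouplike_mem_span (u : seq H) (d : H -> k) (x : H) :
    uniq u -> {in u, forall y, grouplike y} -> grouplike x -> x = \sum_(y <- u) d y *: y ->
  x \in u.
Proof.
move=> uu gu gx xE; apply: contraT => xu; case/eqP: (oner_neq0 k).
pose c y := if y == x then 1 else - d y.
have c0 : \sum_(y <- x :: u) c y *: (fun y : H => y) y = 0.
  rewrite big_cons /c eqxx scale1r {1}xE -big_split big_seq /=; apply: big1 => y yu.
  have -> : (y == x) = false by apply: contraNF xu => /eqP <-.
  by rewrite scaleNr subrr.
rewrite -(grouplike_free _ _ _ c0 (mem_head x u)) /c ?eqxx //; first by rewrite /= xu.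
by move=> y; rewrite inE => /orP [/eqP ->|/gu].
Qed.

End GrouplikeCombinations.

Section FixedGrouplikes.

Variables (k : fieldType) (H : hopfType k) (s : seq (hopf_dual H)).
Implicit Types h x y : H.
Implicit Types f : hopf_dual H.
Local Notation S := (@antipode k H).
Local Notation ev f := (f : 'Hom(H, k^o)).
Hypothesis S2 : forall h, S (S h) = h.
Hypothesis s_gl : {in s, forall f, grouplike f}.
Hypothesis s_antipode : {in s, forall f, dual_antipode f \in s}.

Let evgM f h h' : f \in s -> ev f (h * h') = ev f h * ev f h'.
Proof. by move=> /s_gl /dual_grouplike [->]. Qed.

Let evg1 f : f \in s -> ev f 1 = 1.
Proof. by move=> /s_gl /dual_grouplike [_ ->]. Qed.

Variables (r : seq (hopf_dual H)) (c : hopf_dual H -> H).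
Hypothesis c_gl : {in r, forall e, grouplike (c e)}.
Hypothesis fixed_span : forall h, {in s, forall f, rop f h = h} ->
  h = \sum_(e <- r) (ev e h : k) *: c e.

(** The list [map c r] is not known to be closed under products. Cut down to the common kernel of
    the characters in [s], it consists of all group-like elements in that kernel
    ([mem_fixed_grouplikes]), which form a group. *)
Definition fixed_grouplikes : seq H :=
  [seq x <- undup (map c r) | all (fun f => ev f x == 1) s].

Lemma fixed_grouplikes_uniq : uniq fixed_grouplikes.
Proof. by rewrite filter_uniq // undup_uniq. Qed.

Lemma fixed_grouplikes_gl x : x \in fixed_grouplikes -> grouplike x.
Proof. by rewrite mem_filter mem_undup => /andP [_ /mapP [e er ->]]; exact: c_gl. Qed.

Lemma fixed_grouplikes_ev x f : x \in fixed_grouplikes -> f \in s -> ev f x = 1.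
Proof. by rewrite mem_filter => /andP [/allP h _] /h /eqP. Qed.

(** Each [f] in [s] multiplies the coefficient of a group-like [y] by [f y]; by independence a fixed
    [h] has no component at a [y] with [f y != 1]. *)
Lemma rop_fixed_span h : {in s, forall f, rop f h = h} ->
  exists d : H -> k, h = \sum_(x <- fixed_grouplikes) d x *: x.
Proof.
move=> fixh; have [d dE] := grouplike_collect r c (fun e => ev e h).
exists d; rewrite big_filter {1}(fixed_span fixh) dE [RHS]big_mkcond /=.
apply: eq_big_seq => x xr.
have [//|/allPn [f fs fx]] := boolP (all _ _).
have gl y : y \in undup (map c r) -> grouplike y.
  by rewrite mem_undup => /mapP [e er ->]; exact: c_gl.
suff -> : d x = 0 by rewrite scale0r.
have hE : h = \sum_(x <- undup (map c r)) d x *: x by rewrite -dE -fixed_span.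
have s0 : \sum_(y <- undup (map c r)) (d y * (ev f y - 1)) *: (fun y : H => y) y = 0.
  have := fixh f fs; rewrite {1 2}hE (linear_sum_ext (rop_linear f)) => /eqP.
  rewrite -subr_eq0 -sumrB => /eqP E; rewrite -[RHS]E.
  apply: eq_big_seq => y yr; rewrite (linearZ_ext (rop_linear f)) grouplike_rop; last exact: gl.
  by rewrite scalerA -scalerBl mulrBr mulr1.
have := grouplike_free (undup_uniq _) _ _ s0 xr => /(_ (fun _ _ _ _ E => E) gl) /eqP.
by rewrite mulf_eq0 subr_eq0 (negPf fx) orbF => /eqP.
Qed.

Lemma mem_fixed_grouplikes x : grouplike x -> {in s, forall f, ev f x = 1} -> x \in fixed_grouplikes.
Proof.
move=> gx fx; have [|d dE] := @rop_fixed_span x.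
  by move=> f fs; rewrite grouplike_rop // fx // scale1r.
apply: grouplike_mem_span dE => //; first exact: fixed_grouplikes_uniq.
exact: fixed_grouplikes_gl.
Qed.

Lemma rop_fixedP h : {in s, forall f, rop f h = h} <->
  exists d : H -> k, h = \sum_(x <- fixed_grouplikes) d x *: x.
Proof.
split; first exact: rop_fixed_span.
case=> d -> f fs; rewrite (linear_sum_ext (rop_linear f)).
apply: eq_big_seq => x xG; rewrite (linearZ_ext (rop_linear f)) grouplike_rop.
  by rewrite (fixed_grouplikes_ev xG fs) scale1r.
exact: fixed_grouplikes_gl.
Qed.

Lemma fixed_grouplikesV x : x \in fixed_grouplikes -> S x \in fixed_grouplikes.
Proof.
move=> xG; apply: mem_fixed_grouplikes; first exact/grouplikeS/fixed_grouplikes_gl.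
by move=> f fs; rewrite -dual_antipodeE (fixed_grouplikes_ev xG) // s_antipode.
Qed.

Lemma fixed_grouplikesM x y :
  x \in fixed_grouplikes -> y \in fixed_grouplikes -> x * y \in fixed_grouplikes.
Proof.
move=> xG yG; apply: mem_fixed_grouplikes.
  by apply: grouplikeM; exact: fixed_grouplikes_gl.
by move=> f fs; rewrite evgM // !(fixed_grouplikes_ev _ fs) // mulr1.
Qed.

Lemma fixed_grouplikes1 : 1 \in fixed_grouplikes.
Proof. by apply: mem_fixed_grouplikes; [exact: grouplike1 | exact: evg1]. Qed.

(** The antipode carries elements fixed by all [lop f] to elements fixed by all [rop f], because [s]
    is stable under [dual_antipode], and it permutes [fixed_grouplikes]. Both sides thus have the
    same span, which makes the quotient normal. *)
Lemma lop_fixedP h : {in s, forall f, lop f h = h} <->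
  exists d : H -> k, h = \sum_(x <- fixed_grouplikes) d x *: x.
Proof.
split=> [fixh|[d ->] f fs]; last first.
  rewrite (linear_sum_ext (lop_linear f)).
  apply: eq_big_seq => x xG; rewrite (linearZ_ext (lop_linear f)).
  rewrite /lop grouplike_tlift; [|by slin|by slin|exact: fixed_grouplikes_gl].
  by rewrite (fixed_grouplikes_ev xG fs) scale1r.
have [|d dE] := @rop_fixed_span (S h).
  move=> f fs; rewrite /rop antipode_tlift; try by slin.
  rewrite -[in RHS](fixh _ (s_antipode fs)) /lop [RHS]linear_tlift; last by slin.
  by apply: eq_tlift => a b; rewrite linearZ /= dual_antipodeE.
exists (fun x => d (S x)); rewrite -[LHS]S2 dE linear_sum.
rewrite (perm_big (map S fixed_grouplikes)) /=; last first.
  apply: uniq_perm; first exact: fixed_grouplikes_uniq.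
    by rewrite map_inj_uniq ?fixed_grouplikes_uniq // => x y /(congr1 S); rewrite !S2.
  move=> x; apply/idP/mapP => [xG|[y yG ->]]; last exact: fixed_grouplikesV.
  by exists (S x); rewrite ?S2 // fixed_grouplikesV.
by rewrite big_map; apply: eq_bigr => x _; rewrite linearZ /= S2.
Qed.

End FixedGrouplikes.

(** * The counit as the last quotient map *)

Section CounitQuotient.

Variables (k : fieldType) (K : hopfType k).

(** Everything in [K] is coinvariant for the counit, on both sides, so the coinvariants are [K]
    itself. *)
Lemma counit_quotient : trivial_hopf K -> exists f : {lrmorphism K -> k^o},
  [/\ hopf_morphism f, forall b, exists h, f h = b, normal_morphism f
    & trivial_hopf_sub (right_coinv f)].
Proof.
move=> trK.
have [f fE] := @lrmorphism_of k K k^o counit (fun c x y => linearP _ c x y) (@counit1 _ _) (@counitM _ _).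
have x1 (x : k^o) : (x : k) *: (1 : k^o) = x by exact: mulr1.
have tpr (a : K) (x : k^o) : a ⊗ x = (x : k) *: (a ⊗ (1 : k^o)).
  by rewrite -(linearZ_ext (f := fun z : k^o => a ⊗ z)) ?x1 //; slin.
have tpl (a : K) (x : k^o) : x ⊗ a = (x : k) *: ((1 : k^o) ⊗ a).
  by rewrite -tprodZl x1.
have tid1 (h : K) : tmap idfun f (comul h) = h ⊗ 1.
  rewrite -{2}[h]counitr (linear_tlift (f := fun u => u ⊗ (1 : k^o))); last by slin.
  by apply: eq_tlift => a b; rewrite tprodZl /= fE -tpr.
have t1id (h : K) : tmap f idfun (comul h) = 1 ⊗ h.
  rewrite -{2}[h]counitl (linear_tlift (f := fun u => (1 : k^o) ⊗ u)); last by slin.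
  apply: eq_tlift => a b; rewrite /= fE (tpl b).
  by rewrite -(linearZ_ext (f := fun z => (1 : k^o) ⊗ z)) //; slin.
have allr h : h \in right_coinv f by apply/eqP; exact: tid1.
have alll h : h \in left_coinv f by apply/eqP; exact: t1id.
exists f; split.
- split=> h.
  + transitivity (tlift (fun a b => (counit a * counit b : k) *: ((1 : k^o) ⊗ (1 : k^o))) (comul h)).
      transitivity ((f h : k) *: ((1 : k^o) ⊗ (1 : k^o))); first by [].
      rewrite fE -{1}[h]counitl.
      rewrite (linear_tlift (f := fun u => (counit u : k) *: ((1 : k^o) ⊗ (1 : k^o)))); last by slin.
      by apply: eq_tlift => a b; rewrite linearZ.
    apply: eq_tlift => a b; rewrite !fE.
    by rewrite -[counit a in RHS]mulr1 -[counit b in RHS]mulr1 (tprodZl (counit a : k) (1 : k^o)) -scalerA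
      -(linearZ_ext (f := fun z : k^o => 1 ⊗ z)) //; slin.
  + by rewrite fE.
  by rewrite !fE counit_antipode.
- by move=> b; exists ((b : k) *: 1); rewrite fE linearZ /= counit1; exact: mulr1.
- by move=> h; rewrite allr alll.
have [i [hi iE]] := hopf_id K; exists K, i; split=> //.
- by move=> x y; rewrite !iE.
by move=> h; split=> // _; exists h; rewrite iE.
Qed.

End CounitQuotient.

(** * The chain of quotients in dimension [p^2 q^2] *)

Theorem lemma3p5 (k : closedFieldType) (p q : nat) (H : hopfType k)
  (char_k : [pchar k] =i pred0)
  (prime_p : prime p) (prime_q : prime q) (lt_p4_q : (p ^ 4 < q)%N)
  (ssH : semisimple_algebra H)
  (dimH : \dim {:H} = (p ^ 2 * q ^ 2)%N)
  (order_GHdual : grouplike_order (hopf_dual H) (p * q ^ 2)) :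
  upper_semisolvable H.
Proof.
case: order_GHdual => s [us ss sP].
have p1 := prime_gt1 prime_p; have q1 := prime_gt1 prime_q.
have lt_pq : (p < q)%N.
  by apply: leq_ltn_trans lt_p4_q; rewrite -{1}[p]expn1 leq_pexp2l // ltnW.
have gls f : f \in s <-> grouplike f by rewrite sP.
have sgl : {in s, forall f, grouplike f} by move=> f /gls.
have s1 : 1 \in s by apply/gls; exact: grouplike1.
have sM : {in s &, forall f g, f * g \in s}.
  by move=> f g /gls gf /gls gg; apply/gls; exact: grouplikeM.
have sV : {in s, forall f, dual_antipode f \in s}.
  by move=> f /gls gf; apply/gls; exact: (grouplikeS gf).
have S2 := semisimple_antipode2 char_k ssH.
have [L intL] := semisimple_integral ssH; have [hL Lh eL] := intL.
pose m : k := (size s)%:R.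
have m0 : m != 0.
  have /pcharf0P -> := char_k; rewrite ss muln_eq0 expn_eq0 negb_or -!lt0n /=.
  by rewrite (ltnW p1) andbT -lt0n ltnW.
pose Lam : hopf_dual H := m^-1 *: \sum_(f <- s) f.
have avg (V : vectType k) (v : V) : m^-1 *: \sum_(f <- s) v = v.
  by rewrite big_const_seq count_predT iter_addr_0 -scaler_nat scalerA mulVf // scale1r.
have fLam f : f \in s -> f * Lam = Lam.
  move=> fs; rewrite /Lam -scalerAr mulr_sumr; congr (_ *: _).
  rewrite -(big_map (fun g => f * g) xpredT (fun g => g)); apply: perm_big.
  have injf : injective (fun g : hopf_dual H => f * g).
    move=> g g' E; have := congr1 (fun z => dual_antipode f * z) E.
    by rewrite /= !mulrA (grouplike_mulVr (sgl f fs)) !mul1r.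
  apply: uniq_perm; rewrite ?map_inj_uniq // => g.
  apply/mapP/idP => [[g' g's ->]|gs]; first exact: sM.
  exists (dual_antipode f * g); first by rewrite sM // sV.
  by rewrite mulrA (grouplike_mulrV (sgl f fs)) mul1r.
have LamLam : Lam * Lam = Lam.
  by rewrite {1}/Lam -scalerAl mulr_suml (eq_big_seq (fun=> Lam)) ?avg.
have Lamf : forall h, {in s, forall f, rop f h = h} -> rop Lam h = h.
  by move=> h fixh; rewrite /Lam ropZ rop_sum (eq_big_seq (fun=> h)) ?avg.
have evLam h : ((Lam : 'Hom(H, k^o)) h : k) = m^-1 * \sum_(f <- s) ((f : 'Hom(H, k^o)) h : k).
  by rewrite scale_lfunE ev_sum.
have LamC : trace_form Lam.
  move=> a b; rewrite !evLam; congr (_ * _); apply: eq_big_seq => f /sgl /dual_grouplike [fM _].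
  by rewrite !fM mulrC.
have Lam1 : (Lam : 'Hom(H, k^o)) 1 = 1.
  rewrite evLam (eq_big_seq (fun=> 1)) => [|f /sgl /dual_grouplike [_ ->] //].
  exact: (avg k^o 1).
(* An algebra map [f] other than the counit vanishes at [L], as [f h * f L = counit h * f L]; only
   the unit of the group contributes. *)
have LamL : (Lam : 'Hom(H, k^o)) L = m^-1.
  rewrite evLam (bigD1_seq 1) //= big1_seq => [|f /andP [nf fs]].
    by rewrite ev1 eL addr0 mulr1.
  have /sgl /dual_grouplike [fM _] := fs; apply/eqP; apply: contraNT nf => fL.
  apply/eqP/lfunP => h; rewrite ev1; apply: (mulIf fL).
  by rewrite -fM hL linearZ.
have dimHE : dim H = (p * size s)%N by rewrite -dimvf dimH ss; lia.
have LamR : ltrace (rop Lam) = p%:R.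
  by rewrite (semisimple_ltrace_rop char_k ssH _ intL) LamL dimHE natrM mulfK.
(* A prime factor of a [d > 1] dividing [dim H] is [p] or [q], neither of which is below [p]. *)
have small d : (d %| dim H)%N -> (d < p)%N -> d = 1%N.
  rewrite -dimvf dimH => dn dp; apply/eqP; apply: contraT => d1.
  have d0 : (0 < d)%N by apply: dvdn_gt0 dn; rewrite muln_gt0 !expn_gt0 (ltnW p1) (ltnW q1).
  have d2 : (1 < d)%N by rewrite ltn_neqAle eq_sym d1.
  have rd := pdiv_dvd d; have rp := pdiv_prime d2.
  have le : (pdiv d < p)%N := leq_ltn_trans (dvdn_leq d0 rd) dp.
  have := dvdn_trans rd dn; rewrite Euclid_dvdM // !Euclid_dvdX // !dvdn_prime2 //.
  by case/orP => /andP [/eqP E _]; move: le; rewrite E; lia.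
have [r [c [cgl cE]]] := small_index_grouplikes char_k ssH LamC LamLam Lam1 LamR small.
have fspan h : {in s, forall f, rop f h = h} -> h = \sum_(e <- r) ((e : 'Hom(H, k^o)) h : k) *: c e.
  by move=> /Lamf {1}<-.
have [gT [iota [iinj imem i1 iM iV]]] := grouplike_group us sgl s1 sM sV.
have igl g : grouplike (iota g) by apply/sgl/imem; exists g.
have [pi [hpi spi piE]] := function_algebra_quotient iinj igl i1 iM iV.
pose Gam := fixed_grouplikes s r c.
have Gu : uniq Gam := fixed_grouplikes_uniq s r c.
have Ggl : {in Gam, forall x, grouplike x} by move=> x; exact: (fixed_grouplikes_gl cgl).
have G1 : 1 \in Gam := fixed_grouplikes1 sgl cgl fspan.
have GM : {in Gam &, forall x y, x * y \in Gam}.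
  by move=> x y; exact: (fixed_grouplikesM sgl cgl fspan).
have GV : {in Gam, forall x, antipode x \in Gam}.
  by move=> x; exact: (fixed_grouplikesV sV cgl fspan).
have [gT2 [io2 [iinj2 imem2 i12 iM2 iV2]]] := grouplike_group Gu Ggl G1 GM GV.
have igl2 g : grouplike (io2 g) by apply/Ggl/imem2; exists g.
have [j [hj jinj jE]] := group_algebra_morphism iinj2 igl2 i12 iM2 iV2.
have coR h : h \in right_coinv pi <-> exists d : H -> k, h = \sum_(x <- Gam) d x *: x.
  rewrite -(lop_fixedP S2 sV cgl fspan); split=> [/(right_coinvP piE) R f /imem [g ->] //|R].
  by apply/(right_coinvP piE) => g; apply/R/imem; exists g.
have coL h : h \in left_coinv pi <-> exists d : H -> k, h = \sum_(x <- Gam) d x *: x.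
  rewrite -(rop_fixedP cgl fspan); split=> [/(left_coinvP piE) R f /imem [g ->] //|R].
  by apply/(left_coinvP piE) => g; apply/R/imem; exists g.
(* The chain runs from [H] to the functions on the group of the group-likes in [s], then to the
   ground field. *)
pose K (i : nat) : hopfType k := match i with
  0 => H | 1 => hopf_dual (group_algebra k gT) | _ => k^o end.
exists 2%N, K; split=> //; first exact: hopf_iso_refl.
case=> [_|[_|//]].
  exists pi; split=> //.
    by move=> h; apply/idP/idP => [/coR/coL|/coL/coR].
  exists (group_algebra k gT2), j; split=> //; last first.
    by exists gT2; left; exact: hopf_iso_refl.
  have GE (d : H -> k) : \sum_(x <- Gam) d x *: x = \sum_g d (io2 g) *: io2 g.
    rewrite -(big_map io2 xpredT (fun x => d x *: x)); apply: perm_big.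
    apply: uniq_perm => //; first by rewrite map_inj_uniq ?index_enum_uniq.
    move=> x; apply/idP/mapP => [/imem2 [g ->]|[g _ ->]]; first by exists g; rewrite ?mem_index_enum.
    by apply/imem2; exists g.
  have jsum (a : group_algebra k gT2) : j a = \sum_g (a : {ffun gT2 -> k^o}) g *: io2 g.
    rewrite -{1}(glift_delta a) linear_sum; apply: eq_bigr => g _.
    by rewrite linearZ /= jE.
  move=> h; split=> [/coR [d ->]|[a ->]].
    exists (\sum_g d (io2 g) *: gdelta k g); rewrite GE linear_sum; apply: eq_bigr => g _.
    by rewrite linearZ /= jE.
  (* The coefficients of [a] are carried along the injective [io2]; the value 0 off its image is a
     filler. *)
  apply/coR; exists (fun x => if [pick g | io2 g == x] is Some g then (a : {ffun gT2 -> k^o}) g else 0).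
  rewrite GE jsum; apply: eq_bigr => g _; case: pickP => [g' /eqP /iinj2 -> //|/(_ g)].
  by rewrite eqxx.
apply: counit_quotient; exists gT; right; exact: hopf_iso_refl.
Qed.
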